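(* Let $\Delta$ be an $ADE$ (simply laced) Dynkin graph on vertices $1,\dots,k$ with $k\ge2$, let $S=\mathbb{C}\times\cdots\times\mathbb{C}$ ($k$ copies), and let $\Pi$ be the preprojective algebra of type $\Delta$ over $\mathbb{C}$. Then $\Pi$, considered as an algebra object in the monoidal category of $S$-$S$-bimodules, has a Frobenius structure with Nakayama morphism of order $2$.
   Context: **Bimodules.** $S=\mathbb{C}^k$ has basis of idempotents $e_1,\dots,e_k$. The category $\mathcal D$ of finite-dimensional $S$-$S$-bimodules ($\mathbb{C}$ acting centrally) is monoidal under $\otimes=\otimes_S$, with unit $\mathbf 1=S$, and is semisimple and rigid: the left dual of $M$ is $M^\vee=\mathrm{Hom}_{\mathrm{mod}\text{-}S}(M,S)$ (right $S$-module maps), with evaluation $e_M:M^\vee\otimes M\to S$ and coevaluation $c_M:S\to M\otimes M^\vee$. It is pivotal via the canonical isomorphisms $\iota_M:M\to M^{\vee\vee}$ coming from $e_iM^\vee e_j\cong(e_jMe_i)^*$ and the canonical double-dual isomorphism of finite-dimensional vector spaces. **Preprojective algebra.** Let $Q$ be any quiver whose underlying graph is $\Delta$. Add to $Q$ an arrow $a^*:j\to i$ for each arrow $a:i\to j$ of $Q$ to obtain $\overline Q$. Then $\Pi=\mathbb{C}\overline Q/\left(\sum_{a\in Q_1}(aa^*-a^*a)\right)$; it does not depend on the orientation of $Q$. The subalgebra spanned by the trivial paths $e_1,\dots,e_k$ is identified with $S$, and this makes $\Pi$ an algebra object in $\mathcal D$. **Frobenius structures.** A Frobenius structure on an algebra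 object $(A,m,u)$ in a monoidal category, with $A$ left dualizable, is a pair $(W,n)$ with $W$ an object and $n:A\to W$ a map such that, with $\kappa=n\circ m$, the map $\varphi=(\kappa\otimes 1_{A^\vee})\circ(1_A\otimes c_A):A\to A\otimes A\otimes A^\vee\to W\otimes A^\vee$ is invertible. An object $W$ is invertible if it is left dualizable and its evaluation $e_W:W^\vee\otimes W\to\mathbf 1$ and coevaluation $c_W$ are isomorphisms. Frobenius structures whose Nakayama morphism is considered are required to have $W$ invertible; write $V=W^\vee$. **Nakayama morphism.** $\alpha:V\otimes A\to A\otimes V$ is the composite $V\otimes A\xrightarrow{1_V\otimes\varphi}V\otimes W\otimes A^\vee\xrightarrow{e_W\otimes(\varphi^\vee)^{-1}}A^{\vee\vee}\otimes V\xrightarrow{\iota_A^{-1}\otimes1_V}A\otimes V$, where $\varphi^\vee:A^{\vee\vee}\otimes V\cong(W\otimes A^\vee)^\vee\to A^\vee$ is the dual of $\varphi$. For $n\ge1$, $\alpha^n:V^{\otimes n}\otimes A\to A\otimes V^{\otimes n}$ is obtained by applying $\alpha$ repeatedly to move $A$ past the $n$ factors $V$ (e.g. $\alpha^2=(\alpha\otimes1_V)(1_V\otimes\alpha)$). Write $\alpha^n=1$ if there is an invertible map $\xi:V^{\otimes n}\to\mathbf 1$ such that $(1_A\otimes\xi)\circ\alpha^n\circ(\xi^{-1}\otimes1_A):A\to A$ is the identity. The order of $\alpha$ is the minimal $n\in\{1,2,\dots,\infty\}$ with $\alpha^n=1$. *)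

(* Defs.v *)
From HB Require Import structures.
From mathcomp Require Import all_boot all_order all_algebra.
From mathcomp Require Import perm finmap boolp monalg.

Set Implicit Arguments.
Unset Strict Implicit.
Unset Printing Implicit Defensive.

Import GRing.Theory.
Local Open Scope ring_scope.
Local Open Scope lfun_scope.

Section LinearAux.
Variable F : fieldType.

Lemma linfun_linear (aT rT : vectType F) (f : aT -> rT) :
  linear f -> linfun f =1 f.
Proof.
move=> lf x.
pose g : {linear aT -> rT} := HB.pack f (GRing.isLinear.Build _ _ _ _ f lf).
exact: (lfunE g).
Qed.

Definition bilinear_map (U V W : lmodType F) (b : U -> V -> W) : Prop :=
  (forall x, linear (b x)) /\ (forall y, linear (b^~ y)).

(* The quotient space [V / U], realised on a complement of [U]. *)
Section QuotientSpace.
Variables (V : vectType F) (U : {vspace V}).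

Definition quotv : vectType F := subvs_of (U^C)%VS.

Definition quotv_pi : 'Hom(V, quotv) := linfun (fun x => vsproj (U^C)%VS (x - projv U x)).

Lemma quotv_piE x : quotv_pi x = vsproj (U^C)%VS (x - projv U x).
Proof.
rewrite linfun_linear // => a u v.
by rewrite [projv U _]linearP -[RHS]linearP scalerBr opprD addrACA.
Qed.

Lemma val_quotv_pi x : vsval (quotv_pi x) = x - projv U x.
Proof.
rewrite quotv_piE vsprojK // -lker_proj memv_ker linearB/= projv_proj.
by rewrite subrr.
Qed.

Lemma quotv_pi_eq0 x : (quotv_pi x == 0) = (x \in U).
Proof.
have v0 z : z = 0 :> quotv -> vsval z = 0 by move=> ->.
apply/eqP/idP => [/v0|xU].
  by rewrite val_quotv_pi => /subr0_eq->; apply: memv_pi.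
by apply: val_inj; rewrite /= val_quotv_pi projv_id// subrr.
Qed.

Lemma quotv_pi_val (y : quotv) : quotv_pi (vsval y) = y.
Proof.
apply: val_inj; rewrite /= val_quotv_pi.
suff -> : projv U (vsval y) = 0 by rewrite subr0.
by apply/eqP; rewrite -memv_ker lker_proj subvsP.
Qed.

End QuotientSpace.
End LinearAux.

Section Bimodules.
Variables (F : fieldType) (k : nat).

Notation S := {ffun 'I_k -> F^o}.

Definition idem (i : 'I_k) : S := [ffun j => (i == j)%:R].

(* [lact s] is [x |-> s x] and [ract s] is [x |-> x s]. *)
Record bimod := Bimod {
  bcar :> vectType F;
  lact : S -> 'End(bcar);
  ract : S -> 'End(bcar);
  lact_linear : linear lact;
  ract_linear : linear ract;
  lact1 : lact 1 = \1;
  ract1 : ract 1 = \1;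
  lactM : forall s t, lact (s * t) = lact s \o lact t;
  ractM : forall s t, ract (s * t) = ract t \o ract s;
  lractC : forall s t, lact s \o ract t = ract t \o lact s
}.

Arguments lact {b} s.
Arguments ract {b} s.

(* The morphisms of the category of bimodules are the linear maps satisfying
   [bimod_hom]. *)
Definition bimod_hom (M N : bimod) (f : 'Hom(M, N)) : Prop :=
  (forall s, f \o lact s = lact s \o f) /\ (forall s, f \o ract s = ract s \o f).

Definition bimod_iso (M N : bimod) (f : 'Hom(M, N)) : Prop :=
  bimod_hom f /\
  exists g : 'Hom(N, M), [/\ bimod_hom g, g \o f = \1 & f \o g = \1].

Lemma idem_sum (s : S) : s = \sum_i s i *: idem i.
Proof.
apply/ffunP => j; rewrite sum_ffunE (bigD1 j)//= big1 => [|i ij].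
  by rewrite !ffunE eqxx addr0 [RHS]mulr1.
by rewrite !ffunE (negPf ij) [LHS]mulr0.
Qed.

Section Actions.
Variable M : bimod.
Implicit Types (x y : M) (s t : S).

Lemma lact_linear1 x : linear ((fun s => lact s x) : S -> M).
Proof. by move=> a s t; rewrite lact_linear add_lfunE scale_lfunE. Qed.
Lemma ract_linear1 x : linear ((fun s => ract s x) : S -> M).
Proof. by move=> a s t; rewrite ract_linear add_lfunE scale_lfunE. Qed.

Lemma lactE s x : lact s x = \sum_i s i *: lact (idem i) x.
Proof.
rewrite [in LHS](idem_sum s) -(linfun_linear (lact_linear1 x)) linear_sum.
by apply: eq_bigr => i _; rewrite linearZ/= linfun_linear//; apply: lact_linear1.
Qed.

Lemma ractE s x : ract s x = \sum_i s i *: ract (idem i) x.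
Proof.
rewrite [in LHS](idem_sum s) -(linfun_linear (ract_linear1 x)) linear_sum.
by apply: eq_bigr => i _; rewrite linearZ/= linfun_linear//; apply: ract_linear1.
Qed.

Lemma lact_one x : lact 1 x = x.
Proof. by rewrite lact1 id_lfunE. Qed.
Lemma ract_one x : ract 1 x = x.
Proof. by rewrite ract1 id_lfunE. Qed.
Lemma lact_mul s t x : lact (s * t) x = lact s (lact t x).
Proof. by rewrite lactM comp_lfunE. Qed.
Lemma ract_mul s t x : ract (s * t) x = ract t (ract s x).
Proof. by rewrite ractM comp_lfunE. Qed.
Lemma lract s t x : lact s (ract t x) = ract t (lact s x).
Proof. by have /lfunP/(_ x) := lractC M s t; rewrite !comp_lfunE. Qed.

End Actions.

Section Unit.

Definition unit_act (s : S) : 'End(S) := linfun (fun t => s * t).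

Lemma unit_actE s t : unit_act s t = s * t.
Proof.
rewrite linfun_linear // => a u v; apply/ffunP => i.
by rewrite !ffunE mulrDr scalerAr.
Qed.

Fact unit_act_linear : linear unit_act.
Proof.
move=> a s t; apply/lfunP => u; rewrite add_lfunE scale_lfunE !unit_actE.
by apply/ffunP => i; rewrite !ffunE mulrDl scalerAl.
Qed.

Lemma ffun_mulC (s t : S) : s * t = t * s.
Proof. by apply/ffunP => i; rewrite !ffunE; apply: mulrC. Qed.

Fact unit_act1 : unit_act 1 = \1.
Proof. by apply/lfunP => t; rewrite unit_actE id_lfunE mul1r. Qed.
Fact unit_actM s t : unit_act (s * t) = unit_act s \o unit_act t.
Proof. by apply/lfunP => u; rewrite comp_lfunE !unit_actE mulrA. Qed.
Fact unit_actMr s t : unit_act (s * t) = unit_act t \o unit_act s.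
Proof. by rewrite ffun_mulC unit_actM. Qed.
Fact unit_actC s t : unit_act s \o unit_act t = unit_act t \o unit_act s.
Proof. by rewrite -unit_actM -unit_actMr. Qed.

Definition unitB : bimod :=
  @Bimod S unit_act unit_act unit_act_linear unit_act_linear unit_act1 unit_act1
    unit_actM unit_actMr unit_actC.

End Unit.

Section Tensor.
Variables M N : bimod.

(* The tensor product over [F], in coordinates. *)
Definition tensF : vectType F := 'M[F]_(\dim {:M}, \dim {:N}).

Definition pureF (x : M) (y : N) : tensF :=
  \matrix_(a, b) (coord (vbasis {:M}) a x * coord (vbasis {:N}) b y).

Definition tensF_lift (P : vectType F) (b : M -> N -> P) : 'Hom(tensF, P) :=
  linfun (fun z : tensF =>
    \sum_i \sum_j z i j *: b (vbasis {:M})`_i (vbasis {:N})`_j).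

Lemma tensF_liftE (P : vectType F) (b : M -> N -> P) z :
  tensF_lift b z = \sum_i \sum_j z i j *: b (vbasis {:M})`_i (vbasis {:N})`_j.
Proof.
rewrite linfun_linear // => a u v.
rewrite scaler_sumr -big_split; apply: eq_bigr => i _ /=.
rewrite scaler_sumr -big_split; apply: eq_bigr => j _ /=.
by rewrite !mxE scalerDl scalerA.
Qed.

Lemma pureF_bilinear : bilinear_map pureF.
Proof.
split=> [x a u v|y a u v]; apply/matrixP => i j; rewrite !mxE !linearP/=.
  by rewrite mulrDr mulrCA.
by rewrite mulrDl mulrA.
Qed.

Lemma tensF_lift_pure (P : vectType F) (b : M -> N -> P) x y :
  bilinear_map b -> tensF_lift b (pureF x y) = b x y.
Proof.
move=> [br bl]; rewrite tensF_liftE.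
rewrite [in RHS](coord_vbasis (memvf x)) [in RHS](coord_vbasis (memvf y)).
set s := \sum_(i < \dim {:N}) _.
rewrite -(linfun_linear (bl s)) linear_sum; apply: eq_bigr => i _.
rewrite linearZ/= linfun_linear; last exact: bl.
rewrite -(linfun_linear (br _)) linear_sum scaler_sumr; apply: eq_bigr => j _.
by rewrite linearZ/= linfun_linear ?mxE ?scalerA//; apply: br.
Qed.

Lemma tensF_ext (P : vectType F) (f g : 'Hom(tensF, P)) :
  (forall x y, f (pureF x y) = g (pureF x y)) -> f = g.
Proof.
move=> fg; apply/lfunP => z.
have -> : z = \sum_i \sum_j z i j *: pureF (vbasis {:M})`_i (vbasis {:N})`_j.
  apply/matrixP => i j; rewrite summxE (bigD1 i)//= [X in _ + X]big1 => [|i' ni].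
    rewrite addr0 summxE (bigD1 j)//= [X in _ + X]big1 => [|j' nj].
      by rewrite !mxE !coord_free ?(basis_free (vbasisP _))// !eqxx !mulr1 addr0.
    rewrite !mxE !coord_free ?(basis_free (vbasisP _))//.
    by rewrite [X in _ * X]mulrC (negPf nj : (_ == _) = false) mul0r mulr0.
  rewrite summxE big1// => j' _.
  rewrite !mxE !coord_free ?(basis_free (vbasisP _))//.
  by rewrite (negPf ni : (_ == _) = false) mul0r mulr0.
rewrite !linear_sum; apply: eq_bigr => i _; rewrite !linear_sum.
by apply: eq_bigr => j _; rewrite !linearZ/= fg.
Qed.

(* [x |-> x s (x) y - x (x) s y] *)
Definition balF (s : S) : 'End(tensF) :=
  tensF_lift (fun x y => pureF (ract s x) y - pureF x (lact s y)).

Definition balancing : {vspace tensF} := (\sum_(i < k) limg (balF (idem i)))%VS.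

Definition tens_car : vectType F := quotv balancing.

Definition pure (x : M) (y : N) : tens_car := quotv_pi balancing (pureF x y).

(* The linear map out of [tens_car] induced by a balanced bilinear map [b]. *)
Definition tens_lift (P : vectType F) (b : M -> N -> P) : 'Hom(tens_car, P) :=
  linfun (fun z : tens_car => tensF_lift b (vsval z)).

Definition balanced (P : vectType F) (b : M -> N -> P) : Prop :=
  bilinear_map b /\ forall s x y, b (ract s x) y = b x (lact s y).

Lemma pure_bilinear : bilinear_map pure.
Proof.
by split=> [x a u v|y a u v]; rewrite -linearP/= /pure;
  [rewrite (pureF_bilinear.1)|rewrite (pureF_bilinear.2)].
Qed.

Lemma balF_bilinear s :
  bilinear_map (fun x y => pureF (ract s x) y - pureF x (lact s y)).
Proof.
have [pr pl] := pureF_bilinear.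
split=> [x a u v|y a u v]; rewrite linearP/= ?pr ?pl scalerBr opprD addrACA.
  by [].
by [].
Qed.

Lemma balFE s x y : balF s (pureF x y) = pureF (ract s x) y - pureF x (lact s y).
Proof. exact/tensF_lift_pure/balF_bilinear. Qed.

Lemma pure_balanced : balanced pure.
Proof.
split; first exact: pure_bilinear.
have [pr pl] := pure_bilinear.
have H i x y : pure (ract (idem i) x) y = pure x (lact (idem i) y).
  apply: subr0_eq; apply/eqP; rewrite /pure -linearB/= quotv_pi_eq0 -balFE.
  by apply: (subvP (sumv_sup i _ _)) (memv_img _ (memvf _)).
move=> s x y; rewrite ractE lactE.
rewrite -(linfun_linear (pl y)) -(linfun_linear (pr x)) !linear_sum.
apply: eq_bigr => i _; rewrite !linearZ/= !linfun_linear ?H//.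
Qed.

Lemma tens_ext (P : vectType F) (f g : 'Hom(tens_car, P)) :
  (forall x y, f (pure x y) = g (pure x y)) -> f = g.
Proof.
move=> fg; have : f \o quotv_pi balancing = g \o quotv_pi balancing.
  by apply: tensF_ext => x y; rewrite !comp_lfunE fg.
move=> /lfunP E; apply/lfunP => z.
by have := E (vsval z); rewrite !comp_lfunE quotv_pi_val.
Qed.

Lemma tens_lift_pure (P : vectType F) (b : M -> N -> P) x y :
  balanced b -> tens_lift b (pure x y) = b x y.
Proof.
move=> [bb bal]; rewrite /tens_lift linfun_linear; last by move=> a u v; rewrite !linearP.
rewrite val_quotv_pi linearB/= tensF_lift_pure// -[RHS]subr0; congr (_ - _).
have : (balancing <= lker (tensF_lift b))%VS.
  apply/subv_sumP => i _; apply/subvP => _ /memv_imgP[z _ ->].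
  rewrite memv_ker -comp_lfunE.
  suff -> : tensF_lift b \o balF (idem i) = 0 by rewrite zero_lfunE.
  apply: tensF_ext => {}x {}y.
  by rewrite comp_lfunE balFE linearB/= !tensF_lift_pure// bal subrr zero_lfunE.
move/subvP => sub.
have : projv balancing (pureF x y) \in lker (tensF_lift b) by apply/sub/memv_pi.
by rewrite memv_ker => /eqP.
Qed.

End Tensor.

End Bimodules.

Arguments idem F {k} i.
Arguments lact {F k b} s.
Arguments ract {F k b} s.

Section TensorBimodule.
Variables (F : fieldType) (k : nat).
Notation S := {ffun 'I_k -> F^o}.
Notation bimod := (bimod F k).
Notation unitB := (unitB F k).

Section TensMap.
Variables M N M' N' : bimod.

Definition tensm_car (f : 'Hom(M, M')) (g : 'Hom(N, N')) :
    'Hom(tens_car M N, tens_car M' N') :=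
  tens_lift (fun x y => pure (f x) (g y)).

Lemma tensm_balanced (f : 'Hom(M, M')) (g : 'Hom(N, N')) :
    (forall s, f \o ract s = ract s \o f) ->
    (forall s, g \o lact s = lact s \o g) ->
  balanced (fun x y => pure (f x) (g y)).
Proof.
have [[pr pl] bal] := pure_balanced M' N'.
move=> fs gs; split; first split=> [x a u v|y a u v].
- by rewrite linearP pr.
- by rewrite linearP pl.
- move=> s x y; have /lfunP/(_ x) := fs s; have /lfunP/(_ y) := gs s.
  by rewrite !comp_lfunE => -> ->; rewrite bal.
Qed.

Lemma tensm_car_pure (f : 'Hom(M, M')) (g : 'Hom(N, N')) x y :
    (forall s, f \o ract s = ract s \o f) ->
    (forall s, g \o lact s = lact s \o g) ->
  tensm_car f g (pure x y) = pure (f x) (g y).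
Proof. by move=> fs gs; apply/tens_lift_pure/tensm_balanced. Qed.

End TensMap.

Lemma lact_comm (M : bimod) s t : lact s \o lact t = lact t \o lact s :> 'End(M).
Proof. by rewrite -!lactM ffun_mulC. Qed.
Lemma ract_comm (M : bimod) s t : ract s \o ract t = ract t \o ract s :> 'End(M).
Proof. by rewrite -!ractM ffun_mulC. Qed.

Section Tens.
Variables M N : bimod.

Definition tens_lact (s : S) : 'End(tens_car M N) := tensm_car (lact s) \1.
Definition tens_ract (s : S) : 'End(tens_car M N) := tensm_car \1 (ract s).

Lemma tens_lact_pure s x y : tens_lact s (pure x y) = pure (lact s x) y.
Proof.
rewrite tensm_car_pure ?id_lfunE// => t; first exact: lractC.
by rewrite comp_lfun1l comp_lfun1r.
Qed.

Lemma tens_ract_pure s x y : tens_ract s (pure x y) = pure x (ract s y).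
Proof.
rewrite tensm_car_pure ?id_lfunE// => t; last exact/esym/lractC.
by rewrite comp_lfun1l comp_lfun1r.
Qed.

Fact tens_lact_linear : linear tens_lact.
Proof.
have [pr pl] := pure_bilinear M N.
move=> a s t; apply: tens_ext => x y.
rewrite add_lfunE scale_lfunE !tens_lact_pure lact_linear add_lfunE scale_lfunE.
exact: pl.
Qed.
Fact tens_ract_linear : linear tens_ract.
Proof.
have [pr pl] := pure_bilinear M N.
move=> a s t; apply: tens_ext => x y.
rewrite add_lfunE scale_lfunE !tens_ract_pure ract_linear add_lfunE scale_lfunE.
exact: pr.
Qed.
Fact tens_lact1 : tens_lact 1 = \1.
Proof. by apply: tens_ext => x y; rewrite tens_lact_pure lact_one id_lfunE. Qed.
Fact tens_ract1 : tens_ract 1 = \1.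
Proof. by apply: tens_ext => x y; rewrite tens_ract_pure ract_one id_lfunE. Qed.
Fact tens_lactM s t : tens_lact (s * t) = tens_lact s \o tens_lact t.
Proof.
by apply: tens_ext => x y; rewrite comp_lfunE !tens_lact_pure lact_mul.
Qed.
Fact tens_ractM s t : tens_ract (s * t) = tens_ract t \o tens_ract s.
Proof.
by apply: tens_ext => x y; rewrite comp_lfunE !tens_ract_pure ract_mul.
Qed.
Fact tens_lractC s t : tens_lact s \o tens_ract t = tens_ract t \o tens_lact s.
Proof.
apply: tens_ext => x y.
by rewrite !comp_lfunE tens_lact_pure !tens_ract_pure tens_lact_pure.
Qed.

Definition tens : bimod :=
  @Bimod F k (tens_car M N) tens_lact tens_ract tens_lact_linear
    tens_ract_linear tens_lact1 tens_ract1 tens_lactM tens_ractM tens_lractC.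

End Tens.

Lemma bimod_hom_lift (M N P : bimod) (b : M -> N -> P) : balanced b ->
    (forall s x y, b (lact s x) y = lact s (b x y)) ->
    (forall s x y, b x (ract s y) = ract s (b x y)) ->
  bimod_hom (tens_lift b : 'Hom(tens M N, P)).
Proof.
move=> bb bl br; split=> s; apply: tens_ext => x y; rewrite !comp_lfunE /=.
  by rewrite tens_lact_pure !tens_lift_pure.
by rewrite tens_ract_pure !tens_lift_pure.
Qed.

Definition tensm (M N M' N' : bimod) (f : 'Hom(M, M')) (g : 'Hom(N, N')) :
  'Hom(tens M N, tens M' N') := tensm_car f g.

Definition assoc (M N P : bimod) : 'Hom(tens (tens M N) P, tens M (tens N P)) :=
  tens_lift (fun (z : tens M N) (p : P) =>
    tens_lift (fun x y => pure x (pure y p : tens N P)) z).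

Definition assocV (M N P : bimod) : 'Hom(tens M (tens N P), tens (tens M N) P) :=
  tens_lift (fun (x : M) (z : tens N P) =>
    tens_lift (fun y p => pure (pure x y : tens M N) p) z).

Definition lunit (M : bimod) : 'Hom(tens unitB M, M) :=
  tens_lift (fun (s : unitB) x => lact s x).
Definition lunitV (M : bimod) : 'Hom(M, tens unitB M) :=
  linfun (fun x => @pure _ _ unitB M (1 : S) x).
Definition runit (M : bimod) : 'Hom(tens M unitB, M) :=
  tens_lift (fun x (s : unitB) => ract s x).
Definition runitV (M : bimod) : 'Hom(M, tens M unitB) :=
  linfun (fun x => @pure _ _ M unitB x (1 : S)).

Section Dual.
Variable M : bimod.

Definition dualv : {vspace 'Hom(M, unitB)} :=
  (\bigcap_(i < k) lker (linfun (fun f : 'Hom(M, unitB) =>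
      f \o ract (idem F i) - (ract (idem F i) \o f))))%VS.

Lemma dualvP (f : 'Hom(M, unitB)) :
  reflect (forall s x, f (ract s x) = ract s (f x)) (f \in dualv).
Proof.
have lin i : linear (fun f : 'Hom(M, unitB) =>
    f \o ract (idem F i) - (ract (idem F i) \o f)).
  move=> a u v; apply/lfunP => x.
  rewrite !(add_lfunE, opp_lfunE, scale_lfunE, comp_lfunE) linearP.
  by rewrite scalerBr opprD addrACA.
have E : (f \in dualv) = [forall i : 'I_k, f \o ract (idem F i) == ract (idem F i) \o f].
  rewrite memvE; apply/subv_bigcapP/forallP => H i.
    by have := H i isT; rewrite -memvE memv_ker linfun_linear// subr_eq0.
  by move=> _; rewrite -memvE memv_ker linfun_linear// subr_eq0.
rewrite E; apply: (iffP forallP) => [H s x|H i].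
  rewrite (ractE s x) (ractE s (f x)) linear_sum; apply: eq_bigr => i _.
  by have /eqP/lfunP/(_ x) := H i; rewrite !comp_lfunE linearZ/= => ->.
by apply/eqP/lfunP => x; rewrite !comp_lfunE H.
Qed.

Definition dual_car : vectType F := subvs_of dualv.

Definition dapp (f : dual_car) : 'Hom(M, unitB) := vsval f.

Definition mk_dual (g : M -> S) : dual_car := vsproj dualv (linfun g).

Lemma mk_dualE (g : M -> S) : linear g -> (forall s x, g (ract s x) = g x * s) ->
  dapp (mk_dual g) =1 g.
Proof.
move=> lg gs x; rewrite /dapp vsprojK ?linfun_linear//.
by apply/dualvP => s y; rewrite /= unit_actE !linfun_linear// gs ffun_mulC.
Qed.

Lemma dual_ract (f : dual_car) s x : dapp f (ract s x) = dapp f x * s.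
Proof.
by have /dualvP-> := subvsP f; rewrite /= unit_actE ffun_mulC.
Qed.

Lemma dual_ext (f g : dual_car) : dapp f =1 dapp g -> f = g.
Proof. by move=> fg; apply/val_inj/lfunP. Qed.

(* [(s f)(x) = s f(x)] and [(f s)(x) = f(s x)]. *)
Definition dual_lact (s : S) : 'End(dual_car) :=
  linfun (fun f => mk_dual (fun x => s * dapp f x)).
Definition dual_ract_map (s : S) : 'End(dual_car) :=
  linfun (fun f => mk_dual (fun x => dapp f (lact s x))).

Lemma mulS_linear (s : S) : linear (fun t : S => s * t).
Proof. by move=> a u v; rewrite -!unit_actE linearP. Qed.
Lemma mulS_linearr (t : S) : linear (fun s : S => s * t).
Proof. by move=> a u v /=; rewrite ![_ * t]ffun_mulC mulS_linear. Qed.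

Lemma mk_dual_lact s (f : dual_car) :
  dapp (mk_dual (fun x => s * dapp f x)) =1 (fun x => s * dapp f x).
Proof.
apply: mk_dualE => [a u v|t x]; first by rewrite [dapp f _]linearP mulS_linear.
by rewrite dual_ract mulrA.
Qed.
Lemma mk_dual_ract s (f : dual_car) :
  dapp (mk_dual (fun x => dapp f (lact s x))) =1 (fun x => dapp f (lact s x)).
Proof.
apply: mk_dualE => [a u v|t x]; first by rewrite linearP [dapp f _]linearP.
by rewrite lract dual_ract.
Qed.

Lemma val_dualP a (f g : dual_car) x :
  dapp (a *: f + g) x = a *: dapp f x + dapp g x.
Proof. by rewrite /dapp [vsval _]linearP add_lfunE scale_lfunE. Qed.

Lemma dual_lactE s f x : dapp (dual_lact s f) x = s * dapp f x.
Proof.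
rewrite linfun_linear ?mk_dual_lact// => a u v; apply: dual_ext => y.
by rewrite val_dualP !mk_dual_lact val_dualP mulS_linear.
Qed.
Lemma dual_ractE s f x : dapp (dual_ract_map s f) x = dapp f (lact s x).
Proof.
rewrite linfun_linear ?mk_dual_ract// => a u v; apply: dual_ext => y.
by rewrite val_dualP !mk_dual_ract val_dualP.
Qed.

Fact dual_lact_linear : linear dual_lact.
Proof.
move=> a s t; apply/lfunP => f; apply: dual_ext => x.
rewrite add_lfunE scale_lfunE val_dualP !dual_lactE.
exact: mulS_linearr.
Qed.
Fact dual_ract_linear : linear dual_ract_map.
Proof.
move=> a s t; apply/lfunP => f; apply: dual_ext => x.
rewrite add_lfunE scale_lfunE val_dualP !dual_ractE.
by rewrite lact_linear add_lfunE scale_lfunE linearP.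
Qed.
Fact dual_lact1 : dual_lact 1 = \1.
Proof.
by apply/lfunP => f; apply: dual_ext => x; rewrite dual_lactE id_lfunE mul1r.
Qed.
Fact dual_ract1 : dual_ract_map 1 = \1.
Proof.
by apply/lfunP => f; apply: dual_ext => x; rewrite dual_ractE id_lfunE lact_one.
Qed.
Fact dual_lactM s t : dual_lact (s * t) = dual_lact s \o dual_lact t.
Proof.
apply/lfunP => f; apply: dual_ext => x.
by rewrite comp_lfunE !dual_lactE mulrA.
Qed.
Fact dual_ractM s t : dual_ract_map (s * t) = dual_ract_map t \o dual_ract_map s.
Proof.
apply/lfunP => f; apply: dual_ext => x.
by rewrite comp_lfunE !dual_ractE lact_mul.
Qed.
Fact dual_lractC s t :
  dual_lact s \o dual_ract_map t = dual_ract_map t \o dual_lact s.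
Proof.
apply/lfunP => f; apply: dual_ext => x.
by rewrite !comp_lfunE dual_lactE !dual_ractE dual_lactE.
Qed.

Definition ldual : bimod :=
  @Bimod F k dual_car dual_lact dual_ract_map dual_lact_linear dual_ract_linear
    dual_lact1 dual_ract1 dual_lactM dual_ractM dual_lractC.

Definition ev : 'Hom(tens ldual M, unitB) :=
  tens_lift (fun (f : ldual) (x : M) => dapp f x : unitB).

(* [1] is sent to the canonical element [\sum b (x) b'] of a dual basis of the
   right module [M]: from a basis [b] of [M] over [F] with coordinate forms
   [b^*], the elements [b e_j] and the maps [x |-> b^*(x e_j) e_j] form one. *)
Definition coev_form (a : 'I_(\dim {:M})) (j : 'I_k) : ldual :=
  mk_dual (fun x => coord (vbasis {:M}) a (ract (idem F j) x) *: idem F j).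

Definition coev1 : tens M ldual :=
  \sum_(a < \dim {:M}) \sum_(j < k) pure (ract (idem F j) (vbasis {:M})`_a) (coev_form a j).

Definition coev : 'Hom(unitB, tens M ldual) :=
  linfun (fun s : unitB => lact s coev1).

End Dual.
End TensorBimodule.

Section Rigidity.
Lemma linear_sum_of (F : fieldType) (U V : lmodType F) (f : U -> V) :
  linear f -> forall (I : finType) (h : I -> U), f (\sum_i h i) = \sum_i f (h i).
Proof.
move=> lf I h.
pose g : {linear U -> V} := HB.pack f (GRing.isLinear.Build _ _ _ _ f lf).
exact: (linear_sum g).
Qed.

Variables (F : fieldType) (k : nat).
Notation S := {ffun 'I_k -> F^o}.
Notation bimod := (bimod F k).
Notation unitB := (unitB F k).
Variable M : bimod.

Lemma idem_mul (i : 'I_k) : idem F i * idem F i = idem F i.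
Proof. by apply/ffunP => j; rewrite !ffunE; case: eqP => _; rewrite ?mulr1 ?mulr0. Qed.

Lemma sum_idem : \sum_i idem F i = 1 :> S.
Proof.
rewrite [RHS]idem_sum; apply: eq_bigr => i _.
by rewrite ffunE scale1r.
Qed.

Lemma idem_mulr (s : S) (j : 'I_k) : idem F j * s = s j *: idem F j.
Proof.
apply/ffunP => i; rewrite !ffunE; case: eqP => [->|_]; first exact: mulrC.
by rewrite [LHS]mul0r [RHS]mulr0.
Qed.

Lemma scaleSl (c : F) (s t : S) : (c *: s) * t = c *: (s * t).
Proof. by apply/ffunP => i; rewrite !ffunE; apply/esym/mulrA. Qed.
Lemma scaleSr (c : F) (s t : S) : s * (c *: t) = c *: (s * t).
Proof. by rewrite ffun_mulC scaleSl ffun_mulC. Qed.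

Lemma ract_scale (c : F) s (x : M) : ract (c *: s) x = c *: ract s x.
Proof.
have := linfun_linear (@ract_linear1 _ _ M x) => E.
by have := E (c *: s); rewrite linearZ/= E.
Qed.

Lemma ract_sum (s : 'I_k -> S) (x : M) :
  ract (\sum_i s i) x = \sum_i ract (s i) x.
Proof.
have := linfun_linear (@ract_linear1 _ _ M x) => E.
by have := E (\sum_i s i); rewrite linear_sum /= => <-; apply: eq_bigr => i _; rewrite E.
Qed.

Lemma coev_formE a j x :
  dapp (coev_form (M := M) a j) x =
  coord (vbasis {:M}) a (ract (idem F j) x) *: idem F j.
Proof.
apply: mk_dualE => [c u v|s y].
  by rewrite !linearP/= scalerDl scalerA.
rewrite -ract_mul ffun_mulC idem_mulr ract_scale.
by rewrite linearZ/= scaleSl idem_mulr scalerA mulrC.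
Qed.

Definition dbv (a : 'I_(\dim {:M})) (j : 'I_k) : M :=
  ract (idem F j) (vbasis {:M})`_a.

(* [dbv] and [coev_form] are dual bases of the right module [M]. *)
Lemma dual_basis (x : M) :
  x = \sum_a \sum_j ract (dapp (coev_form a j) x) (dbv a j).
Proof.
rewrite exchange_big /= -[LHS]ract_one -sum_idem ract_sum.
apply: eq_bigr => j _.
rewrite -{1}idem_mul ract_mul {1}(coord_vbasis (memvf (ract (idem F j) x))).
rewrite linear_sum; apply: eq_bigr => a _; rewrite linearZ/= /dbv -ract_mul.
by rewrite coev_formE scaleSr idem_mul ract_scale.
Qed.

Lemma dual_basis_dual (f : ldual M) :
  f = \sum_a \sum_j lact (dapp f (dbv a j)) (coev_form a j : ldual M).
Proof.
apply: dual_ext => x; rewrite {1}(dual_basis x) linear_sum.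
have -> : dapp (\sum_a \sum_j lact (dapp f (dbv a j)) (coev_form a j : ldual M)) x
    = \sum_a \sum_j dapp (lact (dapp f (dbv a j)) (coev_form a j : ldual M)) x.
  rewrite /dapp linear_sum sum_lfunE; apply: eq_bigr => a _.
  by rewrite linear_sum sum_lfunE.
apply: eq_bigr => a _; rewrite linear_sum; apply: eq_bigr => j _.
by rewrite /= dual_ract [RHS]dual_lactE ffun_mulC.
Qed.

Lemma ev_balanced : balanced (fun (f : ldual M) (x : M) => dapp f x : unitB).
Proof.
split; first split=> [f a u v|x a f g].
- by rewrite linearP.
- exact: val_dualP.
- by move=> s f x; rewrite [LHS]dual_ractE.
Qed.

Lemma ev_pure f x : ev M (pure (f : ldual M) x) = dapp f x.
Proof. exact/tens_lift_pure/ev_balanced. Qed.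

Lemma ev_hom : bimod_hom (ev M).
Proof.
apply: bimod_hom_lift; first exact: ev_balanced.
  by move=> s f x; rewrite /= unit_actE [LHS]dual_lactE.
by move=> s f x; rewrite /= unit_actE dual_ract ffun_mulC.
Qed.

Lemma lact_coev1 s : lact s (coev1 M) = ract s (coev1 M).
Proof.
have [[pr pl] bal] := pure_balanced M (ldual M).
have prs (x : M) (I : finType) (h : I -> ldual M) :
    pure x (\sum_i h i) = \sum_i pure x (h i) by apply: linear_sum_of.
have pls (y : ldual M) (I : finType) (h : I -> M) :
    pure (\sum_i h i) y = \sum_i pure (h i) y by apply: (linear_sum_of (pl y)).
have -> : ract s (coev1 M) = \sum_b \sum_l \sum_a \sum_j
    pure (ract (dapp (coev_form a j) (lact s (dbv b l))) (dbv a j))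
         (coev_form b l : ldual M).
  under eq_bigr => b _ do rewrite exchange_big /=.
  rewrite exchange_big /=.
  transitivity (\sum_a \sum_j pure (dbv a j) (ract s (coev_form a j : ldual M))).
    rewrite /coev1 linear_sum; apply: eq_bigr => a _; rewrite linear_sum.
    by apply: eq_bigr => j _; rewrite [LHS]tens_ract_pure.
  apply: eq_bigr => a _; rewrite [RHS]exchange_big /= exchange_big /=.
  under [RHS]eq_bigr => l _ do rewrite exchange_big /=.
  rewrite [RHS]exchange_big /=; apply: eq_bigr => j _.
  rewrite [X in pure _ X = _]dual_basis_dual prs.
  apply: eq_bigr => b _; rewrite prs; apply: eq_bigr => l _.
  by rewrite -bal dual_ractE.
rewrite /coev1 linear_sum; apply: eq_bigr => b _; rewrite linear_sum.
apply: eq_bigr => l _; rewrite [LHS]tens_lact_pure.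
rewrite [X in pure X _ = _]dual_basis pls.
by apply: eq_bigr => a _; rewrite pls.
Qed.

Lemma coevE s : coev M s = lact (s : S) (coev1 M).
Proof. by rewrite /coev linfun_linear//; apply: (@lact_linear1 _ _ (tens M (ldual M))). Qed.

Lemma coev_hom : bimod_hom (coev M).
Proof.
split=> s; apply/lfunP => t; rewrite !comp_lfunE !coevE /= unit_actE.
  exact: (@lact_mul _ _ (tens M (ldual M))).
rewrite ffun_mulC (@lact_mul _ _ (tens M (ldual M))) lact_coev1.
exact: (@lract _ _ (tens M (ldual M))).
Qed.

Lemma pivot_linear (x : M) : linear (fun f : ldual M =>
  [ffun i => \sum_j dapp f (lact (idem F i) x) j] : S).
Proof.
move=> a f g; apply/ffunP => i; rewrite !ffunE scaler_sumr -big_split.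
by apply: eq_bigr => j _; rewrite val_dualP !ffunE.
Qed.

Lemma idem_coef (s : S) i : (idem F i * s) i = s i.
Proof. by rewrite !ffunE eqxx [LHS]mul1r. Qed.
End Rigidity.

Section Coherence.
Variables (F : fieldType) (k : nat).
Notation S := {ffun 'I_k -> F^o}.
Notation bimod := (bimod F k).
Notation unitB := (unitB F k).

Section Assoc.
Variables M N P : bimod.

Lemma assoc_balanced1 (p : P) :
  balanced (fun (x : M) (y : N) => pure x (pure y p : tens N P)).
Proof.
have [[pr pl] bal] := pure_balanced N P.
have [[qr ql] bal'] := pure_balanced M (tens N P).
split; first split=> [x a u v|y a u v]; rewrite ?pl ?qr ?ql//.
by move=> s x y; rewrite bal'; congr pure; rewrite [LHS]tens_lact_pure.
Qed.

Lemma assoc_balanced2 : balanced (fun (z : tens M N) (p : P) =>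
  tens_lift (fun x y => pure x (pure y p : tens N P)) z).
Proof.
have [[pr pl] bal] := pure_balanced N P.
have [[qr ql] bal'] := pure_balanced M (tens N P).
split; first split=> [z a p q|p a u v].
- rewrite /= -scale_lfunE -add_lfunE; congr (fun_of_lfun _ z).
  apply: tens_ext => x y; rewrite add_lfunE scale_lfunE.
  by rewrite !tens_lift_pure ?pr ?qr//; apply: assoc_balanced1.
- by rewrite /= linearP.
- move=> s z p; rewrite -comp_lfunE; congr (fun_of_lfun _ z).
  apply: tens_ext => x y; rewrite comp_lfunE /= tens_ract_pure.
  by rewrite !tens_lift_pure ?bal//; apply: assoc_balanced1.
Qed.

Lemma assoc_pure x y p :
  assoc M N P (pure (pure x y : tens M N) p) = pure x (pure y p : tens N P).
Proof.
rewrite /assoc tens_lift_pure; last exact: assoc_balanced2.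
by rewrite tens_lift_pure//; apply: assoc_balanced1.
Qed.

Lemma assocV_balanced1 (x : M) :
  balanced (fun (y : N) (p : P) => pure (pure x y : tens M N) p).
Proof.
have [[pr pl] bal] := pure_balanced M N.
have [[qr ql] bal'] := pure_balanced (tens M N) P.
split; first split=> [y a u v|p a u v]; rewrite ?pr ?qr ?ql//.
by move=> s y p; rewrite -bal'; congr pure; rewrite [RHS]tens_ract_pure.
Qed.

Lemma assocV_balanced2 : balanced (fun (x : M) (z : tens N P) =>
  tens_lift (fun y p => pure (pure x y : tens M N) p) z).
Proof.
have [[pr pl] bal] := pure_balanced M N.
have [[qr ql] bal'] := pure_balanced (tens M N) P.
split; first split=> [x a u v|z a u v]; first by rewrite /= linearP.
- rewrite /= -scale_lfunE -add_lfunE; congr (fun_of_lfun _ z).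
  apply: tens_ext => y p; rewrite add_lfunE scale_lfunE.
  by rewrite !tens_lift_pure ?pl ?ql//; apply: assocV_balanced1.
- move=> s x z; rewrite -comp_lfunE; congr (fun_of_lfun _ z).
  apply: tens_ext => y p; rewrite comp_lfunE /= tens_lact_pure.
  by rewrite !tens_lift_pure ?bal//; apply: assocV_balanced1.
Qed.

Lemma assocV_pure x y p :
  assocV M N P (pure x (pure y p : tens N P)) = pure (pure x y : tens M N) p.
Proof.
rewrite /assocV tens_lift_pure; last exact: assocV_balanced2.
by rewrite tens_lift_pure//; apply: assocV_balanced1.
Qed.

End Assoc.

Section Unitors.
Variable M : bimod.

Lemma lunit_balanced : balanced (fun (s : unitB) (x : M) => lact s x).
Proof.
split; first split=> [s a x y|x a s t]; first by rewrite /= linearP.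
- exact: lact_linear1.
- by move=> s t x; rewrite /= unit_actE ffun_mulC lact_mul.
Qed.

Lemma runit_balanced : balanced (fun (x : M) (s : unitB) => ract s x).
Proof.
split; first split=> [x a s t|s a x y].
- exact: ract_linear1.
- by rewrite /= linearP.
- by move=> s x t; rewrite /= unit_actE ract_mul.
Qed.

Lemma lunit_pure s x : lunit M (pure (s : unitB) x) = lact s x.
Proof. exact/tens_lift_pure/lunit_balanced. Qed.
Lemma runit_pure x s : runit M (pure x (s : unitB)) = ract s x.
Proof. exact/tens_lift_pure/runit_balanced. Qed.
Lemma lunitVE x : lunitV M x = @pure _ _ unitB M (1 : S) x.
Proof. by rewrite linfun_linear//; apply: (pure_bilinear unitB M).1. Qed.
Lemma runitVE x : runitV M x = @pure _ _ M unitB x (1 : S).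
Proof. by rewrite linfun_linear//; apply: (pure_bilinear M unitB).2. Qed.

End Unitors.

Lemma tensm_pure (M N M' N' : bimod) (f : 'Hom(M, M')) (g : 'Hom(N, N')) x y :
  bimod_hom f -> bimod_hom g -> tensm f g (pure x y) = pure (f x) (g y).
Proof. by move=> [_ fr] [gl _]; apply: tensm_car_pure. Qed.

Lemma bimod_hom1 (M : bimod) : bimod_hom (\1 : 'End(M)).
Proof. by split=> s; rewrite comp_lfun1l comp_lfun1r. Qed.

Lemma bimod_hom_comp (M N P : bimod) (f : 'Hom(N, P)) (g : 'Hom(M, N)) :
  bimod_hom f -> bimod_hom g -> bimod_hom (f \o g).
Proof.
by move=> [fl fr] [gl gr]; split=> s;
  rewrite -comp_lfunA ?gl ?gr comp_lfunA ?fl ?fr comp_lfunA.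
Qed.

Lemma zigzag (M : bimod) :
  runit M \o (tensm \1 (ev M) \o (assoc M (ldual M) M
    \o (tensm (coev M) \1 \o lunitV M))) = \1.
Proof.
apply/lfunP => x; rewrite !comp_lfunE id_lfunE lunitVE.
rewrite tensm_pure; [|exact: coev_hom|exact: bimod_hom1].
rewrite coevE id_lfunE (@lact_one _ _ (tens M (ldual M))) /coev1.
have [_ pl] := pure_bilinear (tens M (ldual M)) M.
rewrite [RHS]dual_basis (linear_sum_of (pl x)) !linear_sum.
apply: eq_bigr => a _; rewrite (linear_sum_of (pl x)) !linear_sum.
apply: eq_bigr => j _ /=; rewrite assoc_pure.
rewrite tensm_pure; [|exact: bimod_hom1|exact: ev_hom].
by rewrite id_lfunE ev_pure runit_pure.
Qed.

Lemma zigzag_dual (M : bimod) :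
  lunit (ldual M) \o (tensm (ev M) \1 \o (assocV (ldual M) M (ldual M)
    \o (tensm \1 (coev M) \o runitV (ldual M)))) = \1.
Proof.
apply/lfunP => f; rewrite !comp_lfunE id_lfunE runitVE.
rewrite tensm_pure; [|exact: bimod_hom1|exact: coev_hom].
rewrite coevE id_lfunE (@lact_one _ _ (tens M (ldual M))) /coev1.
have [pr _] := pure_bilinear (ldual M) (tens M (ldual M)).
rewrite [RHS]dual_basis_dual (linear_sum_of (pr f)) !linear_sum.
apply: eq_bigr => a _; rewrite (linear_sum_of (pr f)) !linear_sum.
apply: eq_bigr => j _ /=; rewrite assocV_pure.
rewrite tensm_pure; [|exact: ev_hom|exact: bimod_hom1].
by rewrite id_lfunE ev_pure lunit_pure.
Qed.

End Coherence.

Section Frobenius.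
Variables (F : fieldType) (k : nat).
Notation S := {ffun 'I_k -> F^o}.
Notation bimod := (bimod F k).
Notation unitB := (unitB F k).

Record algobj := Algobj {
  acar :> bimod;
  amul : 'Hom(tens acar acar, acar);
  aunit : 'Hom(unitB, acar);
  amul_hom : bimod_hom amul;
  aunit_hom : bimod_hom aunit;
  amulA : amul \o tensm amul \1 = amul \o tensm \1 amul \o assoc acar acar acar;
  amul1l : amul \o tensm aunit \1 = lunit acar;
  amul1r : amul \o tensm \1 aunit = runit acar
}.

Section DualMaps.
Variables M N : bimod.

Definition dualm (f : 'Hom(M, N)) : 'Hom(ldual N, ldual M) :=
  linfun (fun g : ldual N => mk_dual (fun x => dapp g (f x)) : ldual M).

(* [g (x) f |-> (x (x) y |-> g (f(x) y))] *)
Definition dual_tens : 'Hom(tens (ldual N) (ldual M), ldual (tens M N)) :=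
  tens_lift (fun (g : ldual N) (f : ldual M) =>
    mk_dual (tens_lift (fun x y => dapp g (lact (dapp f x) y)) :
             tens M N -> S) : ldual (tens M N)).

End DualMaps.

(* For [x] in [e_i M e_j], the form on [e_j M^v e_i] that evaluates the
   functional corresponding to [f] at [x] is [f |-> (f x) j]; it corresponds to
   the element [f |-> (f x) j *: e_i] of [e_i M^vv e_j].  For general [x] these
   are summed over all components [e_i x e_j]. *)
Definition pivot (M : bimod) : 'Hom(M, ldual (ldual M)) :=
  linfun (fun x : M => mk_dual (fun f : ldual M =>
    [ffun i => \sum_j dapp f (lact (idem F i) x) j] : S) : ldual (ldual M)).

Lemma lact_dualE (M : bimod) s (f : ldual M) x :
  dapp (lact s f) x = s * dapp f x.
Proof. exact: dual_lactE. Qed.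
Lemma ract_dualE (M : bimod) s (f : ldual M) x :
  dapp (ract s f) x = dapp f (lact s x).
Proof. exact: dual_ractE. Qed.

Section DualMapsTheory.
Variables M N : bimod.

Lemma dualmE (f : 'Hom(M, N)) (g : ldual N) x : bimod_hom f ->
  dapp (dualm f g) x = dapp g (f x).
Proof.
move=> [_ fr]; have E (h : ldual N) :
    dapp (mk_dual (fun x => dapp h (f x)) : ldual M) =1 (fun x => dapp h (f x)).
  apply: mk_dualE => [a u v|s y]; first by rewrite !linearP.
  by have /lfunP/(_ y) := fr s; rewrite !comp_lfunE => ->; rewrite dual_ract.
rewrite linfun_linear ?E// => a u v; apply: dual_ext => y.
by rewrite val_dualP !E val_dualP.
Qed.

Lemma dual_tens_balanced1 (g : ldual N) (f : ldual M) :
  balanced (fun x y => dapp g (lact (dapp f x) y)).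
Proof.
split; first split=> [x a u v|y a u v].
- by rewrite !linearP.
- rewrite linearP lact_linear add_lfunE scale_lfunE.
  by rewrite linearP.
- by move=> s x y; rewrite dual_ract lact_mul.
Qed.

Lemma mk_dual_tensE g f : dapp (mk_dual (tens_lift (fun x y => dapp g (lact (dapp f x) y)) :
  tens M N -> S) : ldual (tens M N)) =1 tens_lift (fun x y => dapp g (lact (dapp f x) y)).
Proof.
apply: mk_dualE => [a u v|s z]; first by rewrite linearP.
rewrite ffun_mulC -unit_actE -!comp_lfunE; congr (fun_of_lfun _ z).
apply: tens_ext => x y; rewrite !comp_lfunE /= tens_ract_pure unit_actE.
rewrite !tens_lift_pure; [|exact: dual_tens_balanced1..].
by rewrite lract dual_ract ffun_mulC.
Qed.

End DualMapsTheory.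

Section Pivot.
Variable M : bimod.

Lemma mk_pivotE (x : M) : dapp (mk_dual (fun f : ldual M =>
    [ffun i => \sum_j dapp f (lact (idem F i) x) j] : S) : ldual (ldual M)) =1
  (fun f : ldual M => [ffun i => \sum_j dapp f (lact (idem F i) x) j] : S).
Proof.
apply: mk_dualE => [|s f]; first exact: pivot_linear.
apply/ffunP => i; rewrite !ffunE /= mulr_suml; apply: eq_bigr => j _.
rewrite dual_ractE -lact_mul ffun_mulC idem_mulr lactE (bigD1 i)//= big1 => [|l li].
  by rewrite addr0 !ffunE eqxx linearZ/= ffunE [X in X *: _]mulr1 [LHS]mulrC.
by rewrite !ffunE eq_sym (negPf li) [X in X *: _]mulr0 scale0r.
Qed.

Lemma pivotE (x : M) (f : ldual M) i :
  dapp (pivot M x) f i = \sum_j dapp f (lact (idem F i) x) j.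
Proof.
rewrite linfun_linear; first by rewrite mk_pivotE ffunE.
move=> a u v; apply: dual_ext => g; rewrite val_dualP !mk_pivotE.
apply/ffunP => l; rewrite !ffunE scaler_sumr -big_split; apply: eq_bigr => j _.
by rewrite !linearP/= !ffunE.
Qed.

Lemma pivot_hom : bimod_hom (pivot M).
Proof.
split=> s; apply/lfunP => x; rewrite !comp_lfunE; apply: dual_ext => f; apply/ffunP => i.
  rewrite lact_dualE pivotE ffunE pivotE mulr_sumr; apply: eq_bigr => j _.
  rewrite -lact_mul idem_mulr lactE (bigD1 i)//= big1 => [|l li].
    by rewrite addr0 !ffunE eqxx linearZ/= ffunE [X in X *: _]mulr1.
  by rewrite !ffunE eq_sym (negPf li) [X in X *: _]mulr0 scale0r.
rewrite ract_dualE !pivotE; apply: eq_bigr => j _.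
by rewrite lract dual_ract lact_dualE ffun_mulC.
Qed.

Lemma pivot_inj : lker (pivot M) == 0%VS.
Proof.
apply/lker0P; apply: raddf_inj => x ix0.
have H i (f : ldual M) : dapp f (lact (idem F i) x) = 0.
  apply/ffunP => j; have := pivotE x (lact (idem F j) f) i.
  rewrite ix0 /dapp linear0 zero_lfunE ffunE -/(dapp _) => E.
  rewrite ffunE [RHS]E (bigD1 j)//= big1 => [|l lj].
    by rewrite addr0 lact_dualE idem_coef.
  by rewrite lact_dualE idem_mulr !ffunE eq_sym (negPf lj) [LHS]mulr0.
rewrite -[x]lact_one -sum_idem (linear_sum_of (@lact_linear1 _ _ M x)) big1// => i _.
rewrite [LHS]dual_basis big1// => a _; rewrite big1// => j _.
by rewrite H; have := ract_scale 0 0 (dbv a j); rewrite !scale0r.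
Qed.

Lemma pivot_surj (phi : ldual (ldual M)) : exists x, pivot M x = phi.
Proof.
pose tr (s : S) : F := \sum_l s l.
have trP : scalar tr.
  move=> a u v; rewrite /tr mulr_sumr -big_split; apply: eq_bigr => l _.
  by rewrite !ffunE.
pose trL : {scalar S} := HB.pack tr (GRing.isLinear.Build _ _ _ _ tr trP).
have trE s : tr s = trL s by [].
have hE (h : ldual M) a j : lact (dapp h (dbv a j)) (coev_form a j : ldual M)
    = tr (dapp h (dbv a j)) *: (coev_form a j : ldual M).
  apply: dual_ext => y; rewrite lact_dualE /dapp linearZ/= scale_lfunE -/(dapp _).
  rewrite /dbv dual_ract -/(dapp _) [X in tr X]ffun_mulC [X in X * _]ffun_mulC idem_mulr.
  rewrite scaleSl; congr (_ *: _); last first.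
    by rewrite /dapp -/(dapp (coev_form a j)) coev_formE scaleSr idem_mul.
  rewrite /tr (bigD1 j)//= big1 => [|l lj]; first by rewrite !ffunE eqxx addr0 [RHS]mulr1.
  by rewrite !ffunE eq_sym (negPf lj) [LHS]mulr0.
exists (\sum_a \sum_j tr (dapp phi (coev_form a j : ldual M)) *: dbv a j).
apply: dual_ext => f; apply/ffunP => i; rewrite pivotE.
pose h := ract (idem F i) f : ldual M.
transitivity (tr (dapp phi h)); last first.
  rewrite /h dual_ract ffun_mulC idem_mulr /tr (bigD1 i)//= big1 => [|l li].
    by rewrite !ffunE eqxx addr0 [LHS]mulr1.
  by rewrite !ffunE eq_sym (negPf li) [LHS]mulr0.
rewrite -[LHS]/(tr _) -ract_dualE -/h {2}[h]dual_basis_dual !linear_sum !trE linear_sum.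
rewrite [RHS]linear_sum; apply: eq_bigr => a _; rewrite !linear_sum.
apply: eq_bigr => j _ /=; rewrite hE !linearZ/= !trE !linearZ/=.
exact: mulrC.
Qed.

Lemma pivot_iso : bimod_iso (pivot M).
Proof.
split; first exact: pivot_hom.
have KV := lker0_compVf pivot_inj.
have VK : pivot M \o (pivot M)^-1 = \1.
  apply/lfunP => phi; have [x <-] := pivot_surj phi.
  by rewrite comp_lfunE -(comp_lfunE _^-1) KV !id_lfunE.
have [il ir] := pivot_hom.
exists (pivot M)^-1; split=> //; split=> s.
  rewrite -[LHS]comp_lfun1r -VK -comp_lfunA (comp_lfunA (lact s)) -il.
  by rewrite !comp_lfunA KV comp_lfun1l.
rewrite -[LHS]comp_lfun1r -VK -comp_lfunA (comp_lfunA (ract s)) -ir.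
by rewrite !comp_lfunA KV comp_lfun1l.
Qed.

End Pivot.

Definition invertible_obj (W : bimod) : Prop :=
  bimod_iso (ev W) /\ bimod_iso (coev W).

Section Structure.
Variables (A : algobj) (W : bimod) (n : 'Hom(A, W)).

Definition frob_form : 'Hom(tens A A, W) := n \o amul A.

Definition frob_map : 'Hom(A, tens W (ldual A)) :=
  tensm frob_form \1 \o assocV A A (ldual A) \o tensm \1 (coev A) \o runitV A.

Definition frobenius_structure : Prop := bimod_hom n /\ bimod_iso frob_map.

Definition frob_map_dual : 'Hom(tens (ldual (ldual A)) (ldual W), ldual A) :=
  dualm frob_map \o dual_tens W (ldual A).

(* [f^-1] denotes the inverse when [f] is bijective, which [pivot_iso] and the
   Frobenius condition guarantee here. *)
Definition nakayama : 'Hom(tens (ldual W) A, tens A (ldual W)) :=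
  tensm (pivot A)^-1 \1
  \o (lunit (tens (ldual (ldual A)) (ldual W))
  \o (tensm (ev W) (frob_map_dual)^-1
  \o (assocV (ldual W) W (ldual A)
  \o tensm \1 frob_map))).

End Structure.

Section NakayamaPowers.
Variables (A V : bimod) (alpha : 'Hom(tens V A, tens A V)).

(* [V^(x)1] is [V (x) S] here, which is canonically [V]. *)
Fixpoint tens_pow (n : nat) : bimod :=
  if n is n'.+1 then tens V (tens_pow n') else unitB.

Fixpoint nakayama_pow (n : nat) : 'Hom(tens (tens_pow n) A, tens A (tens_pow n)) :=
  match n with
  | 0 => runitV A \o lunit A
  | n'.+1 =>
      assoc A V (tens_pow n')
      \o (tensm alpha \1
      \o (assocV V A (tens_pow n')
      \o (tensm \1 (nakayama_pow n')
      \o assoc V (tens_pow n') A)))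
  end.

Definition nakayama_pow_trivial (n : nat) : Prop :=
  exists2 xi : 'Hom(tens_pow n, unitB), bimod_iso xi &
    runit A \o (tensm \1 xi \o (nakayama_pow n \o (tensm xi^-1 \1 \o lunitV A)))
    = \1.

Definition nakayama_order (n : nat) : Prop :=
  [/\ (0 < n)%N, nakayama_pow_trivial n &
      forall m, (0 < m < n)%N -> ~ nakayama_pow_trivial m].

End NakayamaPowers.
End Frobenius.

Section AlgebraToObject.
Variables (F : fieldType) (k : nat).
Notation S := {ffun 'I_k -> F^o}.
Variables (V : vectType F) (mu : V -> V -> V) (one : V) (e : 'I_k -> V).
Hypotheses (mu_bilinear : bilinear_map mu) (muA : associative mu).
Hypotheses (mu1l : left_id one mu) (mu1r : right_id one mu).
Hypothesis e_mul : forall i j, mu (e i) (e j) = if i == j then e i else 0.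
Hypothesis e_sum : \sum_i e i = one.

Definition sembed (s : S) : V := \sum_i (s i : F) *: e i.

Let mur x : linear (mu x) := mu_bilinear.1 x.
Let mul_ y : linear (mu^~ y) := mu_bilinear.2 y.

Lemma sembed_linear : linear sembed.
Proof.
move=> a s t; rewrite /sembed scaler_sumr -big_split; apply: eq_bigr => i _ /=.
by rewrite !ffunE scalerDl scalerA.
Qed.

Lemma sembed1 : sembed 1 = one.
Proof.
by rewrite -e_sum; apply: eq_bigr => i _; rewrite ffunE scale1r.
Qed.

Lemma muZl c x y : mu (c *: x) y = c *: mu x y.
Proof.
have m0 : mu 0 y = 0.
  by have := mul_ y (-1) 0 0; rewrite scaler0 addr0 scaleN1r addNr.
by have := mul_ y c x 0; rewrite /= !addr0 m0 addr0.
Qed.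
Lemma muZr c x y : mu x (c *: y) = c *: mu x y.
Proof.
have m0 : mu x 0 = 0.
  by have := mur x (-1) 0 0; rewrite scaler0 addr0 scaleN1r addNr.
by have := mur x c y 0; rewrite /= !addr0 m0 addr0.
Qed.

Lemma sembedM s t : sembed (s * t) = mu (sembed s) (sembed t).
Proof.
rewrite /sembed (linear_sum_of (mul_ _)); apply: eq_bigr => i _.
rewrite (linear_sum_of (mur _)) (bigD1 i)//= big1 => [|j ij].
  by rewrite addr0 ffunE muZl muZr e_mul eqxx scalerA.
by rewrite muZl muZr e_mul eq_sym (negPf ij) !scaler0.
Qed.

Definition alg_lact (s : S) : 'End(V) := linfun (fun x => mu (sembed s) x).
Definition alg_ract (s : S) : 'End(V) := linfun (fun x => mu x (sembed s)).

Lemma alg_lactE s x : alg_lact s x = mu (sembed s) x.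
Proof. by rewrite linfun_linear//; apply: mur. Qed.
Lemma alg_ractE s x : alg_ract s x = mu x (sembed s).
Proof. by rewrite linfun_linear//; apply: mul_. Qed.

Fact alg_lact_linear : linear alg_lact.
Proof.
move=> a s t; apply/lfunP => x; rewrite add_lfunE scale_lfunE !alg_lactE.
by rewrite sembed_linear; apply: mul_.
Qed.
Fact alg_ract_linear : linear alg_ract.
Proof.
move=> a s t; apply/lfunP => x; rewrite add_lfunE scale_lfunE !alg_ractE.
by rewrite sembed_linear mur.
Qed.
Fact alg_lact1 : alg_lact 1 = \1.
Proof. by apply/lfunP => x; rewrite alg_lactE sembed1 mu1l id_lfunE. Qed.
Fact alg_ract1 : alg_ract 1 = \1.
Proof. by apply/lfunP => x; rewrite alg_ractE sembed1 mu1r id_lfunE. Qed.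
Fact alg_lactM s t : alg_lact (s * t) = alg_lact s \o alg_lact t.
Proof.
by apply/lfunP => x; rewrite comp_lfunE !alg_lactE sembedM muA.
Qed.
Fact alg_ractM s t : alg_ract (s * t) = alg_ract t \o alg_ract s.
Proof.
by apply/lfunP => x; rewrite comp_lfunE !alg_ractE sembedM muA.
Qed.
Fact alg_lractC s t : alg_lact s \o alg_ract t = alg_ract t \o alg_lact s.
Proof.
by apply/lfunP => x; rewrite !comp_lfunE !alg_ractE !alg_lactE muA.
Qed.

Definition alg_bimod : bimod F k :=
  @Bimod F k V alg_lact alg_ract alg_lact_linear alg_ract_linear alg_lact1
    alg_ract1 alg_lactM alg_ractM alg_lractC.

Definition alg_mul : 'Hom(tens alg_bimod alg_bimod, alg_bimod) :=
  tens_lift (mu : alg_bimod -> alg_bimod -> alg_bimod).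
Definition alg_unit : 'Hom(unitB F k, alg_bimod) := linfun sembed.

Lemma alg_unitE s : alg_unit s = sembed s.
Proof. by rewrite linfun_linear//; apply: sembed_linear. Qed.

Lemma mu_balanced : balanced (mu : alg_bimod -> alg_bimod -> alg_bimod).
Proof.
split; first exact: mu_bilinear.
move=> s x y; rewrite -[LHS]/(mu (alg_ract s x) y) -[RHS]/(mu x (alg_lact s y)).
by rewrite alg_ractE alg_lactE muA.
Qed.

Lemma alg_mul_pure x y : alg_mul (pure (x : alg_bimod) (y : alg_bimod)) = mu x y.
Proof. exact/tens_lift_pure/mu_balanced. Qed.

Fact alg_mul_hom : bimod_hom alg_mul.
Proof.
apply: bimod_hom_lift; first exact: mu_balanced.
  by move=> s x y; rewrite /= !alg_lactE muA.
by move=> s x y; rewrite /= !alg_ractE muA.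
Qed.

Fact alg_unit_hom : bimod_hom alg_unit.
Proof.
split=> s; apply/lfunP => t; rewrite !comp_lfunE !alg_unitE /= unit_actE.
  by rewrite alg_lactE sembedM.
by rewrite alg_ractE ffun_mulC sembedM.
Qed.

Fact alg_mulA : alg_mul \o tensm alg_mul \1 =
  alg_mul \o tensm \1 alg_mul \o assoc alg_bimod alg_bimod alg_bimod.
Proof.
have h1 := bimod_hom1 alg_bimod; have hm := alg_mul_hom.
apply: tens_ext => z p.
pose f : 'Hom(tens alg_bimod alg_bimod, alg_bimod) := linfun (fun z => mu (alg_mul z) p).
have fE w : f w = mu (alg_mul w) p.
  rewrite linfun_linear// => a u v; rewrite linearP; exact: mul_.
pose g : 'Hom(tens alg_bimod alg_bimod, alg_bimod) :=
  linfun (fun z => (alg_mul \o tensm \1 alg_mul \o assoc alg_bimod alg_bimod alg_bimod)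
   (pure z (p : alg_bimod))).
have gE w : g w = (alg_mul \o tensm \1 alg_mul \o assoc alg_bimod alg_bimod alg_bimod)
   (pure w (p : alg_bimod)).
  rewrite linfun_linear// => a u v.
  by rewrite (pure_bilinear (tens alg_bimod alg_bimod) alg_bimod).2 linearP.
rewrite -gE comp_lfunE tensm_pure// id_lfunE alg_mul_pure -fE.
congr (fun_of_lfun _ z); apply: tens_ext => x y.
rewrite fE gE !comp_lfunE assoc_pure tensm_pure// id_lfunE !alg_mul_pure.
exact/esym/muA.
Qed.

Fact alg_mul1l : alg_mul \o tensm alg_unit \1 = lunit alg_bimod.
Proof.
apply: tens_ext => s x; rewrite comp_lfunE lunit_pure tensm_pure.
- by rewrite id_lfunE alg_mul_pure alg_unitE /= alg_lactE.
- exact: alg_unit_hom.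
- exact: bimod_hom1.
Qed.

Fact alg_mul1r : alg_mul \o tensm \1 alg_unit = runit alg_bimod.
Proof.
apply: tens_ext => x s; rewrite comp_lfunE runit_pure tensm_pure.
- by rewrite id_lfunE alg_mul_pure alg_unitE /= alg_ractE.
- exact: bimod_hom1.
- exact: alg_unit_hom.
Qed.

Definition alg_obj : algobj F k :=
  @Algobj F k alg_bimod alg_mul alg_unit alg_mul_hom alg_unit_hom
    alg_mulA alg_mul1l alg_mul1r.

End AlgebraToObject.

Record quiver (k : nat) := Quiver {
  arrow : finType;
  src : arrow -> 'I_k;
  tgt : arrow -> 'I_k
}.
Arguments src {k q} a.
Arguments tgt {k q} a.

Section PathAlgebra.
Variables (F : fieldType) (k : nat) (Q : quiver k).

Fixpoint walk (i : 'I_k) (s : seq (arrow Q)) : bool :=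
  if s is a :: s' then (src a == i) && walk (tgt a) s' else true.

Definition walk_end (i : 'I_k) (s : seq (arrow Q)) : 'I_k := last i (map tgt s).

(* A path is a start vertex with a composable sequence of arrows, the first
   arrow being written on the left. *)
Record qpath := QPath {
  qpath_val : 'I_k * seq (arrow Q);
  _ : walk qpath_val.1 qpath_val.2
}.
HB.instance Definition _ := [isSub for qpath_val].
HB.instance Definition _ := [Choice of qpath by <:].

Definition pstart (p : qpath) := (val p).1.
Definition pend (p : qpath) := walk_end (val p).1 (val p).2.

Lemma walk_cat i s t : walk i (s ++ t) = walk i s && walk (walk_end i s) t.
Proof. by elim: s i => //= a s IH i; rewrite IH andbA. Qed.

Lemma walk_end_cat i s t : walk_end i (s ++ t) = walk_end (walk_end i s) t.
Proof. by rewrite /walk_end map_cat last_cat. Qed.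

Definition triv (i : 'I_k) : qpath := @QPath (i, [::]) isT.

Fact apath_proof (a : arrow Q) : walk (src a) [:: a].
Proof. by rewrite /= eqxx. Qed.
Definition apath (a : arrow Q) : qpath := @QPath (src a, [:: a]) (apath_proof a).

Definition pcat (p q : qpath) : option qpath :=
  if pend p == pstart q then insub (pstart p, (val p).2 ++ (val q).2) else None.

Lemma pcat_some p q : pend p = pstart q ->
  exists2 r, pcat p q = Some r & val r = (pstart p, (val p).2 ++ (val q).2).
Proof.
move=> e; rewrite /pcat e eqxx; case: insubP => [r _ rE|]; first by exists r.
case: p q e => [[i s] /= ws] [[j t] /= wt]; rewrite /pend /pstart /= => e.
by rewrite walk_cat ws e wt.
Qed.

Lemma pcat_none p q : pend p != pstart q -> pcat p q = None.
Proof. by rewrite /pcat => /negPf->. Qed.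

Lemma pcatA p q r : obind (pcat p) (pcat q r) = obind (pcat^~ r) (pcat p q).
Proof.
have [e1|n1] := eqVneq (pend q) (pstart r); have [e2|n2] := eqVneq (pend p) (pstart q).
- have [x -> vx] := pcat_some e1; have [y -> vy] := pcat_some e2 => /=.
  have ex : pend p = pstart x by rewrite /pstart vx.
  have ey : pend y = pstart r.
    by rewrite -e1 /pend vy /= walk_end_cat -/(pend p) e2.
  have [u -> vu] := pcat_some ex; have [w -> vw] := pcat_some ey.
  by congr Some; apply: val_inj; rewrite /= vu vw /pstart vx vy /= catA.
- have [x -> vx] := pcat_some e1; rewrite (pcat_none n2) /=.
  by rewrite pcat_none// /pstart vx.
- have [y -> vy] := pcat_some e2; rewrite (pcat_none n1) /=.
  by rewrite pcat_none// /pend vy /= walk_end_cat -/(pend p) e2.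
- by rewrite (pcat_none n1) (pcat_none n2).
Qed.

Definition pathalg : Type := {malg F[qpath]}.
HB.instance Definition _ := GRing.Lmodule.on pathalg.

Definition pbasis (p : qpath) : pathalg := << p >>%R.

Definition pext (V : lmodType F) (h : qpath -> V) (f : pathalg) : V :=
  \sum_(p <- msupp f) f@_p *: h p.

Lemma pextEw (V : lmodType F) (h : qpath -> V) (f : pathalg) (d : {fset qpath}) :
  (msupp f `<=` d)%fset -> pext h f = \sum_(p <- d) f@_p *: h p.
Proof.
move=> le; rewrite /pext (big_fset_incl _ le)// => p _ /mcoeff_outdom->.
by rewrite scale0r.
Qed.

Lemma pext_linear (V : lmodType F) (h : qpath -> V) : linear (pext h).
Proof.
move=> a f g; pose d := (msupp f `|` msupp g `|` msupp (a *: f + g))%fset.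
have lf : (msupp f `<=` d)%fset by rewrite /d -fsetUA fsubsetUl.
have lg : (msupp g `<=` d)%fset by rewrite /d fsetUAC fsubsetUr.
have lfg : (msupp (a *: f + g) `<=` d)%fset by rewrite fsubsetUr.
rewrite (pextEw h lf) (pextEw h lg) (pextEw h lfg) scaler_sumr -big_split.
by apply: eq_bigr => p _ /=; rewrite mcoeffD mcoeffZ scalerDl scalerA.
Qed.

Lemma pext_basis (V : lmodType F) (h : qpath -> V) p : pext h (pbasis p) = h p.
Proof.
rewrite (pextEw h (d := [fset p]%fset)) ?msuppU_le//.
by rewrite big_seq_fset1 mcoeffUU scale1r.
Qed.

Lemma pathalgE (f : pathalg) : f = \sum_(p <- msupp f) f@_p *: pbasis p.
Proof.
rewrite [LHS]monalgE; apply: eq_bigr => p _; apply/malgP => q.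
by rewrite mcoeffZ !mcoeffU mulrnAr mulr1.
Qed.

Lemma pathalg_ext (V : lmodType F) (f g : pathalg -> V) : linear f -> linear g ->
  (forall p, f (pbasis p) = g (pbasis p)) -> f =1 g.
Proof.
move=> lf lg fg x.
pose f' : {linear pathalg -> V} := HB.pack f (GRing.isLinear.Build _ _ _ _ f lf).
pose g' : {linear pathalg -> V} := HB.pack g (GRing.isLinear.Build _ _ _ _ g lg).
rewrite -[f x]/(f' x) -[g x]/(g' x) (pathalgE x) !linear_sum.
by apply: eq_bigr => p _; rewrite !linearZ/= fg.
Qed.

Definition pmul_basis (p q : qpath) : pathalg :=
  if pcat p q is Some r then pbasis r else 0.

Definition pmul (f g : pathalg) : pathalg :=
  pext (fun p => pext (pmul_basis p) g) f.

Definition pone : pathalg := \sum_i pbasis (triv i).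

Lemma pmul_basisE p q : pmul (pbasis p) (pbasis q) = pmul_basis p q.
Proof. by rewrite /pmul !pext_basis. Qed.

Lemma pmul_linearl g : linear (pmul^~ g).
Proof. exact: pext_linear. Qed.

Lemma pmul_linearr f : linear (pmul f).
Proof.
move=> a g h; rewrite /pmul [in RHS]/pext scaler_sumr -big_split.
by apply: eq_bigr => p _ /=; rewrite pext_linear scalerDr !scalerA mulrC.
Qed.

Lemma pmul_linear0 g : pmul 0 g = 0.
Proof. by rewrite /pmul /pext msupp0 big_seq_fset0. Qed.

Lemma pmul_linear0r f : pmul f 0 = 0.
Proof.
by rewrite /pmul /pext big1// => p _; rewrite msupp0 big_seq_fset0 scaler0.
Qed.

Fact pmulA : associative pmul.
Proof.
have L1 f g := pmul_linearr f; have L2 f g := pmul_linearl g.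
move=> f g h.
apply: (pathalg_ext (f := fun f => pmul f (pmul g h)) (g := fun f => pmul (pmul f g) h)).
- exact: pmul_linearl.
- by move=> a u v; rewrite pmul_linearl; apply: pmul_linearl.
move=> p.
apply: (pathalg_ext (f := fun g => pmul _ (pmul g h)) (g := fun g => pmul (pmul _ g) h)).
- by move=> a u v; rewrite [pmul (a *: u + v) h]pmul_linearl pmul_linearr.
- by move=> a u v; rewrite pmul_linearr; apply: pmul_linearl.
move=> q.
apply: (pathalg_ext (f := fun h => pmul _ (pmul _ h)) (g := fun h => pmul _ h)).
- by move=> a u v; rewrite !pmul_linearr.
- by move=> a u v; rewrite !pmul_linearr.
move=> r; rewrite !pmul_basisE /pmul_basis.
have := pcatA p q r.
case: (pcat q r) => [x|]; case: (pcat p q) => [y|]; rewrite [obind _ _]/= [RHS]/= => E.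
- by rewrite !pmul_basisE /pmul_basis E.
- by rewrite pmul_linear0 pmul_basisE /pmul_basis E.
- by rewrite pmul_linear0r pmul_basisE /pmul_basis -E.
- by rewrite pmul_linear0 pmul_linear0r.
Qed.

Lemma pcat_triv i p : pcat (triv i) p = if i == pstart p then Some p else None.
Proof.
have [e|n] := eqVneq i (pstart p); last by rewrite pcat_none.
have [r -> vr] := @pcat_some (triv i) p e; congr Some; apply: val_inj.
by rewrite vr /= [pstart _]e /pstart -surjective_pairing.
Qed.

Lemma pcat_trivr i p : pcat p (triv i) = if pend p == i then Some p else None.
Proof.
have [e|n] := eqVneq (pend p) i; last by rewrite pcat_none.
have [r -> vr] := @pcat_some p (triv i) e; congr Some; apply: val_inj.
by rewrite vr /= cats0 /pstart -surjective_pairing.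
Qed.

Lemma pmul_suml (I : finType) (h : I -> pathalg) g :
  pmul (\sum_i h i) g = \sum_i pmul (h i) g.
Proof. exact: (linear_sum_of (pmul_linearl g)). Qed.
Lemma pmul_sumr (I : finType) (h : I -> pathalg) f :
  pmul f (\sum_i h i) = \sum_i pmul f (h i).
Proof. exact: (linear_sum_of (pmul_linearr f)). Qed.

Fact pmul1l : left_id pone pmul.
Proof.
move=> f; apply: (pathalg_ext (f := pmul pone) (g := id)) => //.
  exact: pmul_linearr.
move=> p; rewrite pmul_suml (bigD1 (pstart p))//= big1 => [|i ip].
  by rewrite pmul_basisE /pmul_basis pcat_triv eqxx addr0.
by rewrite pmul_basisE /pmul_basis pcat_triv (negPf ip).
Qed.

Fact pmul1r : right_id pone pmul.
Proof.
move=> f; apply: (pathalg_ext (f := pmul^~ pone) (g := id)) => //.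
  exact: pmul_linearl.
move=> p; rewrite /= pmul_sumr (bigD1 (pend p))//= big1 => [|i ip].
  by rewrite pmul_basisE /pmul_basis pcat_trivr eqxx addr0.
by rewrite pmul_basisE /pmul_basis pcat_trivr eq_sym (negPf ip).
Qed.

Fact pmulDl : left_distributive pmul +%R.
Proof. by move=> f g h; have := pmul_linearl h 1 f g; rewrite /= !scale1r. Qed.
Fact pmulDr : right_distributive pmul +%R.
Proof. by move=> f g h; have := pmul_linearr f 1 g h; rewrite /= !scale1r. Qed.

HB.instance Definition _ := GRing.Zmodule_isPzRing.Build pathalg
  pmulA pmul1l pmul1r pmulDl pmulDr.

Lemma pscalerAl a (f g : pathalg) : a *: (f * g) = (a *: f) * g.
Proof.
by have := pmul_linearl g a f 0; rewrite /= pmul_linear0 !addr0.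
Qed.
Lemma pscalerAr a (f g : pathalg) : a *: (f * g) = f * (a *: g).
Proof.
by have := pmul_linearr f a g 0; rewrite /= pmul_linear0r !addr0.
Qed.

Lemma triv_mul i j : pbasis (triv i) * pbasis (triv j) =
  if i == j then pbasis (triv i) else 0 :> pathalg.
Proof.
rewrite [LHS]pmul_basisE /pmul_basis pcat_triv /pstart /=.
by case: eqP => [->|].
Qed.

End PathAlgebra.

Section Ideal.
Variables (A : pzRingType) (r : A).

Definition ideal_gen (x : A) : Prop :=
  exists s : seq (A * A), x = \sum_(ab <- s) ab.1 * r * ab.2.

Lemma ideal0 : ideal_gen 0.
Proof. by exists [::]; rewrite big_nil. Qed.
Lemma idealD x y : ideal_gen x -> ideal_gen y -> ideal_gen (x + y).
Proof. by move=> [s ->] [t ->]; exists (s ++ t); rewrite big_cat. Qed.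
Lemma idealMl a x : ideal_gen x -> ideal_gen (a * x).
Proof.
move=> [s ->]; exists [seq (a * ab.1, ab.2) | ab <- s].
by rewrite big_map mulr_sumr; apply: eq_bigr => ab _; rewrite !mulrA.
Qed.
Lemma idealMr a x : ideal_gen x -> ideal_gen (x * a).
Proof.
move=> [s ->]; exists [seq (ab.1, ab.2 * a) | ab <- s].
by rewrite big_map mulr_suml; apply: eq_bigr => ab _; rewrite !mulrA.
Qed.
Lemma idealN x : ideal_gen x -> ideal_gen (- x).
Proof. by move=> ix; rewrite -mulN1r; apply: idealMl. Qed.
Lemma idealB x y : ideal_gen x -> ideal_gen y -> ideal_gen (x - y).
Proof. by move=> ix iy; apply/idealD => //; apply: idealN. Qed.

End Ideal.

Section PathQuotient.
Variables (F : fieldType) (k : nat) (Q : quiver k) (r : pathalg F Q).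
Notation A := (pathalg F Q).
Notation I := (ideal_gen r).

Definition ideal_rel : rel A := fun x y => `[< I (x - y) >].

Fact ideal_rel_refl : reflexive ideal_rel.
Proof. by move=> x; apply/asboolP; rewrite subrr; apply: ideal0. Qed.
Fact ideal_rel_sym : symmetric ideal_rel.
Proof.
by move=> x y; apply/asboolP/asboolP => /idealN; rewrite opprB.
Qed.
Fact ideal_rel_trans : transitive ideal_rel.
Proof.
move=> y x z /asboolP xy /asboolP yz; apply/asboolP.
by have := idealD xy yz; rewrite addrA subrK.
Qed.

Canonical ideal_equiv := EquivRel ideal_rel ideal_rel_refl ideal_rel_sym ideal_rel_trans.

Definition pathquot : Type := {eq_quot ideal_rel}%qT.
HB.instance Definition _ := Choice.on pathquot.

Definition qpi (x : A) : pathquot := (\pi_({eq_quot ideal_rel}) x)%qT.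
Definition qrepr (x : pathquot) : A := repr (x : {eq_quot ideal_rel}%qT).

Lemma qreprK x : qpi (qrepr x) = x.
Proof. exact: reprK. Qed.

Lemma qpi_eq x y : qpi x = qpi y <-> I (x - y).
Proof.
split; first by move=> /eqquotP /asboolP.
by move=> h; apply/eqquotP/asboolP.
Qed.

Lemma qrepr_pi x : I (qrepr (qpi x) - x).
Proof. by apply/qpi_eq; rewrite qreprK. Qed.

Definition qadd (x y : pathquot) := qpi (qrepr x + qrepr y).
Definition qopp (x : pathquot) := qpi (- qrepr x).
Definition qmul (x y : pathquot) := qpi (qrepr x * qrepr y).
Definition qscale (c : F) (x : pathquot) := qpi (c *: qrepr x).

Lemma qpiD x y : qadd (qpi x) (qpi y) = qpi (x + y).
Proof.
apply/qpi_eq; rewrite opprD addrACA.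
by apply: idealD; apply: qrepr_pi.
Qed.
Lemma qpiN x : qopp (qpi x) = qpi (- x).
Proof. by apply/qpi_eq; rewrite -opprD; apply/idealN/qrepr_pi. Qed.
Lemma qpiM x y : qmul (qpi x) (qpi y) = qpi (x * y).
Proof.
apply/qpi_eq.
have -> : qrepr (qpi x) * qrepr (qpi y) - x * y =
    (qrepr (qpi x) - x) * qrepr (qpi y) + x * (qrepr (qpi y) - y).
  by rewrite mulrBl mulrBr addrA subrK.
by apply: idealD; [apply: idealMr|apply: idealMl]; apply: qrepr_pi.
Qed.
Lemma idealZ (c : F) x : I x -> I (c *: x).
Proof. by move=> ix; rewrite -[x]mul1r pscalerAl; apply: idealMl. Qed.
Lemma qpiZ c x : qscale c (qpi x) = qpi (c *: x).
Proof.
by apply/qpi_eq; rewrite -scalerBr; apply: idealZ; apply: qrepr_pi.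
Qed.

Lemma qind (P : pathquot -> Prop) : (forall x, P (qpi x)) -> forall x, P x.
Proof. by move=> h x; rewrite -[x]qreprK. Qed.

Fact qaddA : associative qadd.
Proof.
by elim/qind => x; elim/qind => y; elim/qind => z; rewrite !qpiD addrA.
Qed.
Fact qaddC : commutative qadd.
Proof. by elim/qind => x; elim/qind => y; rewrite !qpiD addrC. Qed.
Fact qadd0 : left_id (qpi 0) qadd.
Proof. by elim/qind => x; rewrite qpiD add0r. Qed.
Fact qaddN : left_inverse (qpi 0) qopp qadd.
Proof. by elim/qind => x; rewrite qpiN qpiD addNr. Qed.

HB.instance Definition _ := GRing.isZmodule.Build pathquot qaddA qaddC qadd0 qaddN.

Fact qmulA : associative qmul.
Proof.
by elim/qind => x; elim/qind => y; elim/qind => z; rewrite !qpiM mulrA.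
Qed.
Fact qmul1l : left_id (qpi 1) qmul.
Proof. by elim/qind => x; rewrite qpiM mul1r. Qed.
Fact qmul1r : right_id (qpi 1) qmul.
Proof. by elim/qind => x; rewrite qpiM mulr1. Qed.
Fact qmulDl : left_distributive qmul +%R.
Proof.
elim/qind => x; elim/qind => y; elim/qind => z.
by rewrite -[_ + _]/(qadd _ _) -[_ + _ in RHS]/(qadd _ _) qpiD !qpiM qpiD mulrDl.
Qed.
Fact qmulDr : right_distributive qmul +%R.
Proof.
elim/qind => x; elim/qind => y; elim/qind => z.
by rewrite -[_ + _]/(qadd _ _) -[_ + _ in RHS]/(qadd _ _) qpiD !qpiM qpiD mulrDr.
Qed.

HB.instance Definition _ := GRing.Zmodule_isPzRing.Build pathquot
  qmulA qmul1l qmul1r qmulDl qmulDr.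

Fact qscaleA a b x : qscale a (qscale b x) = qscale (a * b) x.
Proof. by elim/qind: x => x; rewrite !qpiZ scalerA. Qed.
Fact qscale1 : left_id 1 qscale.
Proof. by elim/qind => x; rewrite qpiZ scale1r. Qed.
Fact qscaleDr : right_distributive qscale +%R.
Proof.
move=> a; elim/qind => x; elim/qind => y.
by rewrite -[_ + _]/(qadd _ _) -[_ + _ in RHS]/(qadd _ _) qpiD !qpiZ qpiD scalerDr.
Qed.
Fact qscaleDl x : {morph qscale^~ x : a b / a + b}.
Proof.
elim/qind: x => x a b /=.
by rewrite -[RHS]/(qadd _ _) !qpiZ qpiD scalerDl.
Qed.

HB.instance Definition _ := GRing.Zmodule_isLmodule.Build F pathquot
  qscaleA qscale1 qscaleDr qscaleDl.

Lemma pathquot_mul_bilinear : bilinear_map (fun x y : pathquot => x * y).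
Proof.
split; elim/qind => x a; elim/qind => y; elim/qind => z.
  by rewrite /= mulrDr; congr (_ + _); rewrite -[LHS]/(qmul _ (qscale _ _))
    -[RHS]/(qscale _ (qmul _ _)) qpiZ !qpiM qpiZ pscalerAr.
by rewrite /= mulrDl; congr (_ + _); rewrite -[LHS]/(qmul (qscale _ _) _)
    -[RHS]/(qscale _ (qmul _ _)) qpiZ !qpiM qpiZ pscalerAl.
Qed.

Definition qidem (i : 'I_k) : pathquot := qpi (pbasis F (triv Q i)).

Lemma qidem_mul i j : qidem i * qidem j = if i == j then qidem i else 0.
Proof. by rewrite -[LHS]/(qmul _ _) qpiM triv_mul; case: eqP. Qed.

Lemma qidem_sum : \sum_i qidem i = 1.
Proof.
rewrite -[RHS]/(qpi (pone F Q)) /pone.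
by elim/big_rec2: _ => // i x y _ ->; rewrite -[LHS]/(qadd _ _) qpiD.
Qed.

Section AlgebraObject.
Variables (N : nat) (ax : Vector.axiom N pathquot).

Definition pathquot_vect : vectType F :=
  HB.pack pathquot (Lmodule_hasFinDim.Build F pathquot ax).

Definition pathquot_obj : algobj F k :=
  @alg_obj F k pathquot_vect (fun x y : pathquot => x * y) 1 qidem
    pathquot_mul_bilinear (@mulrA pathquot) (@mul1r pathquot) (@mulr1 pathquot)
    qidem_mul qidem_sum.

End AlgebraObject.
End PathQuotient.

Section Preprojective.
Variables (F : fieldType) (k : nat) (Q : quiver k).

(* [inl a] is the arrow [a], and [inr a] is the reversed arrow [a^*]. *)
Definition double_quiver : quiver k :=
  @Quiver k (arrow Q + arrow Q)%type
    (fun b => match b with inl a => src a | inr a => tgt a end)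
    (fun b => match b with inl a => tgt a | inr a => src a end).

Definition arr (b : arrow double_quiver) : pathalg F double_quiver :=
  pbasis F (apath b).

Definition preproj_relation : pathalg F double_quiver :=
  \sum_(a : arrow Q) (arr (inl a) * arr (inr a) - arr (inr a) * arr (inl a)).

Definition preproj : lmodType F := pathquot preproj_relation.

Definition preproj_obj (N : nat) (ax : Vector.axiom N preproj) : algobj F k :=
  pathquot_obj ax.

End Preprojective.

Section Dynkin.
Variable k : nat.
Implicit Types (Delta : rel 'I_k).

Definition edgeA : rel nat := fun i j => (i.+1 == j) || (j.+1 == i).

(* The path [0 - 1 - ... - k-2], with the vertex [k-1] attached to [b]. *)
Definition edge_branch (b : nat) : rel nat := fun i j =>
  [|| edgeA i j && (maxn i j < k.-1)%N,
      (i == b) && (j == k.-1) | (j == b) && (i == k.-1)].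

Definition labelled_by Delta (e : rel nat) : Prop :=
  exists s : 'S_k, forall i j, Delta i j = e (s i) (s j).

Definition typeA Delta : Prop := labelled_by Delta edgeA.
Definition typeD Delta : Prop := (4 <= k)%N /\ labelled_by Delta (edge_branch (k - 3)).
Definition typeE Delta : Prop := (6 <= k <= 8)%N /\ labelled_by Delta (edge_branch 2).

Definition ADE_graph Delta : Prop := [\/ typeA Delta, typeD Delta | typeE Delta].

(* Every arrow lies on an edge of [Delta], and every edge carries exactly one
   arrow, in one of the two directions. *)
Definition underlying_graph (Q : quiver k) Delta : Prop :=
  (forall a : arrow Q, Delta (src a) (tgt a)) /\
  (forall i j, Delta i j -> exists! a : arrow Q,
     (src a = i /\ tgt a = j) \/ (src a = j /\ tgt a = i)).

End Dynkin.

(* Main.v *)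
From HB Require Import structures.
From mathcomp Require Import all_boot all_order all_algebra.
From mathcomp Require Import finmap perm boolp monalg complex reals zify ring lra.
Require Import Defs.

(** The proof is uniform in the Dynkin type. All it uses of the graph is that it
    is a tree with at least two vertices which carries a positive function [y]
    such that [2 * y i] exceeds the sum of [y] over the neighbours of [i] by a
    positive constant.

    _Finite dimension._ The truncation of the preprojective algebra at a given
    word length is a representation of the double quiver that satisfies the
    relation and is generated by the unit. The relation is a moment map, so the
    tangent space to the orbit of this representation is isotropic, and a
    dimension count bounds the Tits form of its dimension vector by its total
    dimension ([tits_form_bound]). The Tits form being positive in the presence
    of [y], this bounds all truncations at once ([finite_dimensional]).

    _The Nakayama permutation._ The complex [A -> \bigoplus_b A -> A] attached
    to the presentation is exact in the middle ([presentation_exact]), which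
    relates the dimensions of the [e i * A * e j] to those of their socles. With
    the bound above this forces the socle dimensions to form a permutation matrix
    ([socle_permutation]). Degree by degree, the same complex says that the
    dimensions are the entries of the Chebyshev polynomials of the adjacency
    matrix; all socles therefore lie in one degree [m], and the permutation
    [nu] is an involution ([nakayama_data]).

    _The Nakayama automorphism._ Taking coefficients of words of length [m]
    gives a nondegenerate form with an automorphism [beta], where
    [lam (c * a) = lam (a * beta c)], and [beta] multiplies the arrow [b] by a
    scalar [cb b] and permutes the arrows along [nu]. The key point is the sign rule
    [cb b * cb (bar b) = - (eps b * eps (nub b))] ([nakayama_sign]), obtained
    from a sum over contractions of mutually inverse arrows in words of length
    [m.+2], which are zero. Hence the scalars of [beta] squared on opposite
    arrows are inverse to each other, and since the graph is a tree this square
    is conjugation by an invertible element of [S] ([beta_square]). The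
    automorphism [beta] itself is not of this kind ([beta_not_inner]): the
    conjugations fix [x b * x (bar b)], whereas if [nu] is trivial then [beta]
    multiplies it by [-1].

    _Bimodules._ The form takes values in the unit bimodule twisted by [nu], and
    is a Frobenius structure with this invertible target ([form_frobenius],
    [twisted_invertible]). On the generator of [V] the Nakayama morphism
    is [beta] ([nakayamaE]), so trivialising a power of it amounts to writing
    that power of [beta] as a conjugation by an element of [S] ([form_order2]). *)

Set Implicit Arguments.
Unset Strict Implicit.
Unset Printing Implicit Defensive.

Import Order.TTheory GRing.Theory Num.Theory.
Local Open Scope ring_scope.

(** * Linear algebra *)

Lemma pairing_represents (F : fieldType) (A : vectType F) (B : A -> A -> F) :
  (forall b, scalar (B^~ b)) -> (forall a, scalar (B a)) ->
  (forall b, (forall a, B a b = 0) -> b = 0) ->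
  forall f : A -> F, scalar f -> exists b, forall a, f a = B a b.
Proof.
move=> Bl Br nd f lf; pose r b : 'Hom(A, F^o) := linfun (fun a => B a b : F^o).
have rE b a : r b a = B a b by rewrite linfun_linear//; apply: Bl.
have rl : linear r.
  move=> c b b'; apply/lfunP => a; rewrite add_lfunE scale_lfunE !rE.
  exact: Br.
have full : limg (linfun r) = fullv.
  apply/eqP; rewrite eqEdim subvf limg_dim_eq.
    by rewrite !dimvf /dim /= muln1.
  rewrite capfv; apply/eqP; rewrite -subv0; apply/subvP => b.
  rewrite memv_ker memv0 linfun_linear// => /eqP/lfunP r0; apply/eqP/nd => a.
  by rewrite -rE r0 zero_lfunE.
have : (linfun (f : A -> F^o) : 'Hom(A, F^o)) \in limg (linfun r) by rewrite full memvf.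
case/memv_imgP => b _; rewrite linfun_linear// => /lfunP E; exists b => a.
by rewrite -rE -E linfun_linear.
Qed.

Lemma basis_extraction (F : fieldType) (L : lmodType F) (T : finType) (v : T -> L) :
  exists (n : nat) (w : 'I_n -> T),
    (forall c : 'I_n -> F, \sum_p c p *: v (w p) = 0 -> forall p, c p = 0) /\
    (forall t, exists c : 'I_n -> F, v t = \sum_p c p *: v (w p)).
Proof.
pose indep n (w : 'I_n -> T) := forall c : 'I_n -> F, \sum_p c p *: v (w p) = 0 -> forall p, c p = 0.
have iinj n w : @indep n w -> injective w.
  move=> iw p q wpq; apply: contraTeq isT => npq; rewrite /=.
  have : \sum_r ((r == p)%:R - (r == q)%:R : F) *: v (w r) = 0.
    rewrite (bigD1 p)//= (bigD1 q) 1?eq_sym//= big1 => [|r /andP[/negPf -> /negPf ->]].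
      by rewrite !eqxx [q == p]eq_sym (negPf npq) subr0 sub0r scaleN1r scale1r wpq addr0 subrr.
    by rewrite subr0 scale0r.
  by move/iw/(_ p); rewrite eqxx (negPf npq) subr0 => /eqP; rewrite oner_eq0.
pose P n := `[< exists w, @indep n w >].
have P0 : exists n, P n.
  exists 0%N; apply/asboolP; have w0 : 'I_0 -> T by case.
  by exists w0 => c _ [].
have Pmax n : P n -> (n <= #|T|)%N.
  by move=> /asboolP[w /iinj iw]; rewrite -[n in (n <= _)%N]card_ord; apply: leq_card iw.
case: (ex_maxnP P0 Pmax) => n /asboolP[w iw] nmax.
exists n, w; split=> // t; apply: contrapT => nspan.
suff : P n.+1 by move/nmax; rewrite ltnn.
apply/asboolP; exists (fun i => if unlift ord0 i is Some j then w j else t).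
move=> c; rewrite big_ord_recl unlift_none.
under eq_bigr => i _ do rewrite liftK.
have [c0 | c0] := eqVneq (c ord0) 0.
  rewrite c0 scale0r add0r => /iw cl p.
  by case: (unliftP ord0 p) => [j ->|-> //]; apply: cl.
move/eqP; rewrite addr_eq0 => /eqP E; exfalso; apply: nspan.
exists (fun p => - (c ord0)^-1 * c (lift ord0 p)).
rewrite -[LHS]scale1r -(mulVf c0) -scalerA E scalerN -scaleNr scaler_sumr.
by apply: eq_bigr => p _; rewrite scalerA.
Qed.

(** * Isotropic subspaces and orbits of representations *)

Section Isotropic.
Local Open Scope lfun_scope.
Variables (F : fieldType) (T : finType) (tau : T -> T) (sg : T -> F).
Hypotheses (tauK : involutive tau) (sg0 : forall t, sg t != 0).

(** A form whose matrix is an involution with nonzero weights is nondegenerate, so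
    a totally isotropic subspace has at most half the dimension. *)
Lemma isotropic_dim (U : {vspace {ffun T -> F^o}}) :
  (forall g g', g \in U -> g' \in U -> \sum_t sg t * (g t * g' (tau t)) = 0) ->
  (2 * \dim U <= #|T|)%N.
Proof.
move=> iso; pose r := \dim U; pose g (i : 'I_r) := (vbasis U)`_i.
have gU i : g i \in U by apply: vbasis_mem; rewrite mem_nth ?size_tuple.
have fr (c : 'I_r -> F) : (forall t, \sum_i c i * g i t = 0) -> forall i, c i = 0.
  move=> c0; have/freeP := basis_free (vbasisP U); apply.
  apply/ffunP => t; rewrite sum_ffunE [RHS]ffunE -[RHS](c0 t).
  by apply: eq_bigr => i _; rewrite ffunE.
pose M : 'M[F]_(r, #|T|) := \matrix_(i, t) g i (enum_val t).
pose M' : 'M[F]_(#|T|, r) := \matrix_(t, i) (sg (enum_val t) * g i (tau (enum_val t))).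
have MM : M *m M' = 0.
  apply/matrixP => i j; rewrite !mxE -[RHS](iso _ _ (gU i) (gU j)).
  rewrite (reindex (@enum_val _ (pred_of_argType T))) /=; last first.
    by apply: onW_bij; apply: enum_val_bij.
  by apply: eq_bigr => t _; rewrite !mxE mulrCA.
have rM : \rank M = r.
  apply/eqP; rewrite -[_ == _]/(row_free M) -kermx_eq0; apply/rowV0P => v /sub_kermxP vM.
  apply/rowP => i; rewrite [RHS]mxE; apply: (fr (fun i => v 0 i)) => t.
  have /rowP/(_ (enum_rank t)) := vM; rewrite !mxE => E; rewrite -[RHS]E.
  by apply: eq_bigr => j _; rewrite !mxE enum_rankK.
have rM' : \rank M' = r.
  rewrite -mxrank_tr; apply/eqP; rewrite -[_ == _]/(row_free M'^T) -kermx_eq0.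
  apply/rowV0P => v /sub_kermxP vM.
  apply/rowP => i; rewrite [RHS]mxE; apply: (fr (fun i => v 0 i)) => t.
  have /rowP/(_ (enum_rank (tau t))) := vM; rewrite !mxE => E.
  apply: (mulfI (sg0 (tau t))); rewrite mulr0 mulr_sumr -[RHS]E.
  by apply: eq_bigr => j _; rewrite !mxE enum_rankK tauK mulrCA.
by have := mulmx0_rank_max MM; rewrite rM rM' addnn mul2n.
Qed.
End Isotropic.

Section CrawleyBoevey.
Local Open Scope lfun_scope.
Variables (F : fieldType) (I : eqType) (D : finType) (src tgt : D -> I).
Variables (bar : D -> D) (eps : D -> F).
Hypotheses (barK : involutive bar) (src_bar : forall b, src (bar b) = tgt b).
Hypotheses (epsN : forall b, eps (bar b) = - eps b) (eps0 : forall b, eps b != 0).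
Variables (n : nat) (vt : 'I_n -> I) (X : D -> 'M[F]_n) (u : 'cV[F]_n).
Hypothesis Xsupp : forall b p q, X b p q != 0 -> vt p = src b /\ vt q = tgt b.
Hypothesis Xrel : \sum_b eps b *: (X b *m X (bar b)) = 0.
Hypothesis Xcyc : forall f : 'M[F]_n, (forall p q, f p q != 0 -> vt p = vt q) ->
  (forall b, X b *m f = f *m X b) -> f *m u = 0 -> f = 0.

(** The infinitesimal action of the gauge transformation [f] on the
    representation [X]. *)
Let comm (f : 'M[F]_n) b := X b *m f - f *m X b.

(** The relation is the moment map for the symplectic form
    [\sum_b eps b * \tr (Y b *m Y' (bar b))]; at a zero of it the tangent
    directions along the orbit are orthogonal to each other. *)
Lemma trace_comm0 f f' : \sum_b eps b * \tr (comm f b *m comm f' (bar b)) = 0.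
Proof.
have Xrel' : \sum_b eps b *: (X (bar b) *m X b) = 0.
  rewrite (reindex_inj (inv_inj barK)) /= -[RHS]oppr0 -[X in _ = - X]Xrel -sumrN.
  by apply: eq_bigr => b _; rewrite barK epsN scaleNr.
pose a b := \tr (X b *m f *m (X (bar b) *m f')).
pose c b := \tr (f *m X b *m (f' *m X (bar b))).
transitivity (\sum_b eps b * a b + \sum_b eps b * c b
   - \tr ((f *m f') *m \sum_b eps b *: (X (bar b) *m X b))
   - \tr (f *m (\sum_b eps b *: (X b *m X (bar b))) *m f')).
  rewrite mulmx_sumr mulmx_sumr mulmx_suml !(raddf_sum (@mxtrace F n)) -!sumrN -!big_split /=.
  apply: eq_bigr => b _; rewrite /comm mulmxBl !mulmxBr !raddfB /=.
  rewrite -!scalemxAr -!scalemxAl !mxtraceZ.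
  have -> : \tr (X b *m f *m (f' *m X (bar b))) = \tr (f *m f' *m (X (bar b) *m X b)).
    by rewrite -mulmxA mxtrace_mulC !mulmxA.
  have -> : \tr (f *m X b *m (X (bar b) *m f')) = \tr (f *m (X b *m X (bar b)) *m f').
    by rewrite !mulmxA.
  by rewrite /a /c; ring.
rewrite Xrel Xrel' !(mulmx0, mul0mx) !mxtrace0 !subr0.
rewrite [X in _ + X](reindex_inj (inv_inj barK)) /= -big_split big1//= => b _.
rewrite /a /c barK epsN.
have -> : \tr (f *m X (bar b) *m (f' *m X b)) = \tr (X b *m f *m (X (bar b) *m f')).
  by rewrite !mulmxA mxtrace_mulC !mulmxA.
by rewrite mulNr subrr.
Qed.

(** The entries that a gauge transformation, respectively a representation, may
    have: its blocks are indexed by the vertices, respectively by the arrows. *)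
Let S0 := [pred t : 'I_n * 'I_n | vt t.1 == vt t.2].
Let S1 := [pred t : D * ('I_n * 'I_n) | (vt t.2.1 == src t.1) && (vt t.2.2 == tgt t.1)].

Let ext (f : {ffun {t | S0 t} -> F^o}) : 'M[F]_n :=
  \matrix_(p, q) if insub (p, q) is Some t then f t else 0.

Let ext_supp f p q : ext f p q != 0 -> vt p = vt q.
Proof. by rewrite mxE; case: insubP => [t /eqP|]; rewrite ?eqxx. Qed.

Let ext_lin : linear ext.
Proof.
move=> a f g; apply/matrixP => p q; rewrite !mxE.
by case: insubP => [t _ _|_]; rewrite ?ffunE // mulr0 addr0.
Qed.

Let d0 (f : {ffun {t | S0 t} -> F^o}) : {ffun {t | S1 t} -> F^o} :=
  [ffun t => comm (ext f) (val t).1 (val t).2.1 (val t).2.2].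

Let d0_lin : linear d0.
Proof.
move=> a f g; apply/ffunP => t; rewrite !ffunE /comm ext_lin.
rewrite mulmxDl mulmxDr -scalemxAr -scalemxAl !mxE -[X in _ = X + _]/(a * (_ - _)).
 by ring.
Qed.

Let tau (t : {t | S1 t}) : {t | S1 t} :=
  insubd t (bar (val t).1, ((val t).2.2, (val t).2.1)).

Let val_tau t : val (tau t) = (bar (val t).1, ((val t).2.2, (val t).2.1)).
Proof.
rewrite /tau val_insubd; case: t => [[b [p q]] /= /andP[/eqP h1 /eqP h2]].
by rewrite h1 h2 src_bar eqxx -(src_bar (bar b)) barK eqxx.
Qed.

Let comm_supp (f : 'M[F]_n) b p q : (forall p q, f p q != 0 -> vt p = vt q) ->
  comm f b p q != 0 -> (vt p == src b) && (vt q == tgt b).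
Proof.
move=> fs; apply: contraNT => h; rewrite !mxE !big1 ?subrr// => r _;
  apply/eqP; rewrite mulf_eq0; apply: contraNT h; rewrite negb_or => /andP[h1 h2].
  by have [<- ->] := Xsupp h2; rewrite (fs _ _ h1) !eqxx.
by have [-> <-] := Xsupp h1; rewrite (fs _ _ h2) !eqxx.
Qed.

(** The tangent space to the orbit of [X] is isotropic in the space of
    representations. Its codimension in the Lie algebra of gauge transformations
    is the dimension of the endomorphism algebra of [X], and this is at most [n]
    since an endomorphism is determined by the image of the cyclic vector [u]. *)
Lemma tits_form_bound : (2 * #|S0| <= 2 * n + #|S1|)%N.
Proof.
pose L : 'Hom({ffun {t | S0 t} -> F^o}, {ffun {t | S1 t} -> F^o}) := linfun d0.
have LE f : L f = d0 f by rewrite linfun_linear//; apply: d0_lin.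
have dk := limg_ker_dim L fullv.
have dim0 : \dim {: {ffun {t | S0 t} -> F^o}} = #|S0|.
  by rewrite dimvf /dim /= card_sig muln1.
have keru : (\dim (fullv :&: lker L) <= n)%N.
  rewrite capfv.
  pose E : 'Hom({ffun {t | S0 t} -> F^o}, 'cV[F]_n) := linfun (fun f => ext f *m u).
  have EE f : E f = ext f *m u.
    by rewrite linfun_linear// => a g h; rewrite ext_lin mulmxDl -scalemxAl.
  have := limg_ker_dim E (lker L).
  suff -> : (lker L :&: lker E)%VS = 0%VS.
    rewrite dimv0 add0n => <-; apply: leq_trans (dimvS (subvf _)) _.
    by rewrite dimvf /dim /= muln1.
  apply/eqP; rewrite -subv0; apply/subvP => f; rewrite memv_cap !memv_ker LE EE.
  case/andP => /eqP/ffunP d0f /eqP fu; rewrite memv0; apply/eqP.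
  have f0 : ext f = 0.
    apply: Xcyc => //; first exact: ext_supp.
    move=> b; apply/eqP; rewrite -subr_eq0; apply/eqP; apply/matrixP => p q.
    apply/eqP; rewrite [X in _ == X]mxE -[_ == _]negbK; apply/negP => nz.
    have /= h : S1 (b, (p, q)) := comm_supp (@ext_supp f) nz.
    by have := d0f (Sub (b, (p, q)) h); rewrite !ffunE /= => E0; rewrite /comm E0 eqxx in nz.
  apply/ffunP => -[[p q] h]; rewrite [RHS]ffunE.
  have := congr1 (fun M : 'M_n => M p q) f0; rewrite !mxE.
  by case: insubP => [t _ /= tE <-|]; [congr (f _); apply: val_inj|rewrite h].
have iso : (2 * \dim (limg L) <= #|S1|)%N.
  rewrite -card_sig.
  apply: (@isotropic_dim _ _ tau (fun t => eps (val t).1)) => [t|t|].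
  - by apply: val_inj; rewrite !val_tau /= barK; case: (val t) => ? [].
  - exact: eps0.
  move=> _ _ /memv_imgP[f _ ->] /memv_imgP[f' _ ->].
  rewrite !LE -[RHS](trace_comm0 (ext f) (ext f')).
  pose G (t : D * ('I_n * 'I_n)) := eps t.1 *
    (comm (ext f) t.1 t.2.1 t.2.2 * comm (ext f') (bar t.1) t.2.2 t.2.1).
  transitivity (\sum_(t : {t | S1 t}) G (val t)).
    by apply: eq_bigr => t _; rewrite !ffunE val_tau.
  transitivity (\sum_t G t).
    rewrite [RHS](bigID S1) /= [X in _ = _ + X]big1 ?addr0 => [|t nt].
      by rewrite -(big_sub S1 G).
    rewrite /G; case: (eqVneq (comm (ext f) t.1 t.2.1 t.2.2) 0) => [->|nz].
      by rewrite mul0r mulr0.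
    by rewrite (comm_supp (@ext_supp f) nz) in nt.
  rewrite -(pair_bigA _ (fun b t => G (b, t))) /=; apply: eq_bigr => b _.
  rewrite /mxtrace mulr_sumr -(pair_bigA _ (fun p q => G (b, (p, q)))) /=.
  by apply: eq_bigr => p _; rewrite !mxE mulr_sumr.
have := dk; rewrite dim0 => <-.
by lia.
Qed.
End CrawleyBoevey.

(** * The Tits form *)

Section TitsForm.
Variables (k : nat) (D : finType) (src tgt : D -> 'I_k) (bar : D -> D).
Hypotheses (barK : involutive bar) (src_bar : forall b, src (bar b) = tgt b).
Variables (y : 'I_k -> nat) (c : nat).
Hypotheses (y0 : forall i, (0 < y i)%N) (c0 : (0 < c)%N).
Hypothesis yC : forall i, (2 * y i = \sum_(b | src b == i) y (tgt b) + c)%N.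

Let tgt_bar b : tgt (bar b) = src b.
Proof. by rewrite -src_bar barK. Qed.

Let yC' i : \sum_(b | src b == i) (y (tgt b))%:R = 2 * (y i)%:R - c%:R :> rat.
Proof.
rewrite -natr_sum -[2 * _]natrM yC natrD; ring.
Qed.

Let sum_src (G : D -> rat) : \sum_b G b = \sum_i \sum_(b | src b == i) G b.
Proof. exact: (partition_big src xpredT). Qed.

(** The positive vector [y] has positive image under the Cartan matrix, so the
    weighted inequality between arithmetic and geometric means, with weights
    taken from [y], bounds each product [z (src b) * z (tgt b)]. *)
Lemma tits_form_ge0 (z : 'I_k -> rat) :
  0 <= 2 * \sum_i z i ^+ 2 - \sum_b z (src b) * z (tgt b).
Proof.
have yp i : 0 < (y i)%:R :> rat by rewrite ltr0n.
pose G b := (y (tgt b))%:R / (y (src b))%:R * z (src b) ^+ 2.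
have le_edge b : 2 * (z (src b) * z (tgt b)) <= G b + G (bar b).
  rewrite /G src_bar tgt_bar.
  have h1 := yp (src b); have h2 := yp (tgt b).
  have h12 := mulr_gt0 h1 h2; rewrite -subr_ge0.
  have -> : (y (tgt b))%:R / (y (src b))%:R * z (src b) ^+ 2 +
     (y (src b))%:R / (y (tgt b))%:R * z (tgt b) ^+ 2 - 2 * (z (src b) * z (tgt b)) =
     ((y (tgt b))%:R * z (src b) - (y (src b))%:R * z (tgt b)) ^+ 2
       / ((y (src b))%:R * (y (tgt b))%:R).
    by field; rewrite !gt_eqF.
  by apply: divr_ge0; [exact: sqr_ge0|exact: ltW].
have sumG : \sum_b (G b + G (bar b)) = 2 * \sum_b G b.
  rewrite big_split /=.
  have -> : \sum_b G (bar b) = \sum_b G b by rewrite [RHS](reindex_inj (inv_inj barK)).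
  by rewrite mulr2n mulrDl !mul1r.
have le1 : 2 * \sum_b z (src b) * z (tgt b) <= 2 * \sum_b G b.
  by rewrite -sumG mulr_sumr; apply: ler_sum => b _; apply: le_edge.
suff le2 : \sum_b G b <= 2 * \sum_i z i ^+ 2 by lra.
rewrite sum_src mulr_sumr; apply: ler_sum => i _.
have -> : \sum_(b | src b == i) G b = (2 * (y i)%:R - c%:R) / (y i)%:R * z i ^+ 2.
  rewrite -yC' !mulr_suml; apply: eq_bigr => b /eqP sb.
  by rewrite /G sb.
rewrite ler_wpM2r ?sqr_ge0// ler_pdivrMr// -subr_ge0.
by have -> : 2 * (y i)%:R - (2 * (y i)%:R - c%:R) = c%:R :> rat by ring.
Qed.

(** Positivity is used at the vector [c x - 2 y]: the hypothesis cancels its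
    quadratic part in [x] and leaves a linear bound. *)
Lemma bounded_dimension (x : 'I_k -> nat) :
  (2 * \sum_i x i ^ 2 <= 2 * \sum_i x i + \sum_b x (src b) * x (tgt b))%N ->
  (\sum_i x i <= 2 * \sum_i y i)%N.
Proof.
move=> le; pose X i : rat := (x i)%:R; pose Y i : rat := (y i)%:R; pose C : rat := c%:R.
have H := tits_form_ge0 (fun i => C * X i - 2 * Y i).
have cross : \sum_b X (src b) * Y (tgt b) = 2 * \sum_i X i * Y i - C * \sum_i X i.
  rewrite sum_src !mulr_sumr -sumrB; apply: eq_bigr => i _.
  transitivity (X i * \sum_(b | src b == i) (y (tgt b))%:R).
    by rewrite mulr_sumr; apply: eq_bigr => b /eqP ->.
  by rewrite yC' /Y /C; ring.
have cross' : \sum_b Y (src b) * X (tgt b) = 2 * \sum_i X i * Y i - C * \sum_i X i.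
  rewrite -cross [LHS](reindex_inj (inv_inj barK)) /=.
  by apply: eq_bigr => b _; rewrite src_bar tgt_bar mulrC.
have crossY : \sum_b Y (src b) * Y (tgt b) = 2 * \sum_i Y i ^+ 2 - C * \sum_i Y i.
  rewrite sum_src !mulr_sumr -sumrB; apply: eq_bigr => i _.
  transitivity (Y i * \sum_(b | src b == i) (y (tgt b))%:R).
    by rewrite mulr_sumr; apply: eq_bigr => b /eqP ->.
  by rewrite yC' /Y /C; ring.
have E1 : \sum_i (C * X i - 2 * Y i) ^+ 2 =
   C ^+ 2 * \sum_i X i ^+ 2 - 4 * C * \sum_i X i * Y i + 4 * \sum_i Y i ^+ 2.
  by rewrite !mulr_sumr -sumrB -big_split; apply: eq_bigr => i _ /=; ring.
have E2 : \sum_b (C * X (src b) - 2 * Y (src b)) * (C * X (tgt b) - 2 * Y (tgt b)) =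
   C ^+ 2 * (\sum_b X (src b) * X (tgt b)) - 2 * C * (\sum_b X (src b) * Y (tgt b))
   - 2 * C * (\sum_b Y (src b) * X (tgt b)) + 4 * (\sum_b Y (src b) * Y (tgt b)).
  by rewrite !mulr_sumr -!sumrB -big_split; apply: eq_bigr => b _ /=; ring.
move: H; rewrite {}E1 {}E2 cross cross' crossY => H.
have le' : 2 * \sum_i X i ^+ 2 <= 2 * (\sum_i X i) + \sum_b X (src b) * X (tgt b).
  have := le; rewrite -(ler_nat rat) natrM natrD natrM !natr_sum.
  congr (_ <= _); first by congr (_ * _); apply: eq_bigr => i _; rewrite natrX.
  by congr (_ + _); apply: eq_bigr => b _; rewrite natrM.
have Cp : 0 < C by rewrite ltr0n.
have C1 : 1 <= C by rewrite ler1n.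
have sx0 : 0 <= \sum_i X i by apply: sumr_ge0 => i _; apply: ler0n.
rewrite -(ler_nat rat) natrM !natr_sum.
rewrite -[\sum_i (x i)%:R]/(\sum_i X i) -[\sum_i (y i)%:R]/(\sum_i Y i).
move: le' C1 sx0 H.
set sx2 := \sum_i X i ^+ 2; set sx := \sum_i X i; set q := \sum_b _.
set sxy := \sum_i X i * Y i; set sy2 := \sum_i Y i ^+ 2; set sy := \sum_i Y i.
move=> le' C1 sx0 H.
have H1 : 0 <= C ^+ 2 * (2 * sx2 - q) - 4 * C ^+ 2 * sx + 4 * C * sy.
  by apply: le_trans H _; rewrite le_eqVlt; apply/orP; left; apply/eqP; ring.
have H2 : C ^+ 2 * (2 * sx2 - q) <= C ^+ 2 * (2 * sx).
  by rewrite ler_wpM2l ?sqr_ge0//; lra.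
have H3 : 0 <= C * (2 * sy - C * sx) by nra.
have {}H3 : C * sx <= 2 * sy by rewrite pmulr_rge0// in H3; lra.
by apply: le_trans H3; nra.
Qed.
End TitsForm.

Section SocleMatrix.
Variables (k : nat) (D : finType) (src tgt : D -> 'I_k).
Variables P s : 'I_k -> 'I_k -> nat.
Let x i := (\sum_j P i j)%N.
Hypothesis cartan : forall i j,
  (2 * P i j = \sum_(b | src b == i) P (tgt b) j + (i == j) + s i j)%N.
Hypothesis embed : forall l j, (P l j <= \sum_i P i l * s i j)%N.
Hypothesis tits : (2 * \sum_i x i ^ 2 <= 2 * \sum_i x i + \sum_b x (src b) * x (tgt b))%N.
Hypothesis x0 : forall i, (0 < x i)%N.

Let r i := (\sum_j s i j)%N.

Let cartan_sum : (2 * \sum_i x i ^ 2 =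
   \sum_b x (src b) * x (tgt b) + \sum_i x i + \sum_i x i * r i)%N.
Proof.
have cx i : (2 * x i = \sum_(b | src b == i) x (tgt b) + 1 + r i)%N.
  rewrite /x big_distrr /= (eq_bigr _ (fun j _ => cartan i j)) !big_split /=.
  congr (_ + _ + _)%N; first by rewrite exchange_big.
  by rewrite (bigD1 i)//= eqxx big1 ?addn0// => j; rewrite eq_sym => /negPf ->.
rewrite (partition_big src xpredT) //= -!big_split big_distrr /=.
apply: eq_bigr => i _.
have -> : (\sum_(b | src b == i) x (src b) * x (tgt b) = x i * \sum_(b | src b == i) x (tgt b))%N.
  by rewrite big_distrr; apply: eq_bigr => b /eqP ->.
by have := cx i; set w := (\sum_(b | _) _)%N; nia.
Qed.

Let sum_embed : (\sum_l \sum_j \sum_i P i l * s i j = \sum_i x i * r i)%N.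
Proof.
under eq_bigr => l _ do rewrite exchange_big /=.
rewrite exchange_big /=; apply: eq_bigr => i _.
rewrite /x big_distrl; apply: eq_bigr => l _ /=.
by rewrite big_distrr.
Qed.

Let sum_xr : (\sum_i x i * r i = \sum_i x i)%N.
Proof.
apply/eqP; rewrite eqn_leq; apply/andP; split.
  by have := tits; rewrite cartan_sum; lia.
rewrite -sum_embed; apply: leq_sum => l _; apply: leq_sum => j _; exact: embed.
Qed.

Let embed_eq l j : (P l j = \sum_i P i l * s i j)%N.
Proof.
apply/eqP; have := sum_xr; rewrite -sum_embed => /eqP.
rewrite eq_sym pair_bigA [X in _ == X]pair_bigA /=.
rewrite (leqif_sum (E1 := fun p => P p.1 p.2) (C := fun p => P p.1 p.2 == \sum_i P i p.1 * s i p.2)%N).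
  by move=> /forallP/(_ (l, j)).
by move=> p _; split=> //; apply: embed.
Qed.

Let Pm : 'M[rat]_k := \matrix_(i, j) (P i j)%:R.
Let sm : 'M[rat]_k := \matrix_(i, j) (s i j)%:R.

Let sm_unit : sm \in unitmx.
Proof.
rewrite -unitmx_tr -row_free_unit -kermx_eq0; apply/rowV0P => v /sub_kermxP vs.
have sv : sm *m v^T = 0 by rewrite -[LHS]trmxK trmx_mul trmxK vs trmx0.
have Pv : Pm *m v^T = 0.
  have -> : Pm = Pm^T *m sm.
    apply/matrixP => l j; rewrite !mxE embed_eq natr_sum.
    by apply: eq_bigr => i _; rewrite !mxE natrM.
  by rewrite -mulmxA sv mulmx0.
apply/rowP => i; rewrite [RHS]mxE.
have /colP/(_ i) := sv; have /colP PE := Pv; rewrite !mxE => sE.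
have E : \sum_j (2 * P i j)%:R * v 0 j = 0.
  transitivity (2 * (Pm *m v^T) i 0); last by rewrite PE mxE mulr0.
  by rewrite mxE mulr_sumr; apply: eq_bigr => j _; rewrite !mxE natrM mulrA.
rewrite -[RHS]E -[LHS]add0r.
transitivity (\sum_(b | src b == i) (Pm *m v^T) (tgt b) 0 + v 0 i +
   \sum_j sm i j * v^T j 0); first by rewrite sE addr0 big1 // => b _; rewrite PE mxE.
under [X in X + _ + _]eq_bigr => b _ do rewrite mxE.
rewrite exchange_big /=.
have -> : v 0 i = \sum_j (i == j)%:R * v 0 j.
  rewrite (bigD1 i)//= eqxx mul1r big1 ?addr0// => j.
  by rewrite eq_sym => /negPf ->; rewrite mul0r.
rewrite -!big_split; apply: eq_bigr => j _ /=; rewrite cartan !natrD natr_sum !mxE.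
rewrite !mulrDl mulr_suml; congr (_ + _ + _); apply: eq_bigr => b _.
by rewrite !mxE.
Qed.

Let r0 i : (0 < r i)%N.
Proof.
rewrite lt0n; apply/negP => /eqP ri.
have : row i (sm *m invmx sm) = 0.
  rewrite row_mul; suff -> : row i sm = 0 by rewrite mul0mx.
  apply/rowP => j; rewrite !mxE; apply/eqP; rewrite pnatr_eq0 -leqn0 -ri.
  by rewrite /r (bigD1 j)//= leq_addr.
rewrite mulmxV// row1 => /rowP/(_ i); rewrite !mxE !eqxx /= => /eqP.
by rewrite oner_eq0.
Qed.

(** Here [P] stands for the Cartan matrix of the algebra and [s] for the matrix
    of socle dimensions. Summing [cartan] against [x] and comparing with [tits]
    gives [\sum_i x i * r i <= \sum_i x i], and [embed] gives the converse, so
    that [embed] is an equality. Then [cartan] makes [s] injective, no row sum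
    [r i] vanishes, and the positive weights [x] force all of them to be [1]. *)
Lemma socle_permutation :
  exists nu : 'I_k -> 'I_k, forall i j, s i j = (i == nu j).
Proof.
have r1 i : r i = 1%N.
  have /eqP := sum_xr; rewrite eq_sym.
  rewrite (leqif_sum (E1 := x) (C := fun i => x i == x i * r i)%N) => [|j _]; last first.
    by split=> //; rewrite leq_pmulr.
  move=> /forallP/(_ i)/eqP E; have := x0 i; have := r0 i; nia.
have f0 i : {j | s i j != 0%N}.
  apply/sigW/existsP; apply: contraTT (r0 i) => /existsPn h.
  by rewrite -leqNgt leqn0 /r big1// => j _; have := h j; rewrite negbK => /eqP.
pose f i := sval (f0 i).
have sE i j : s i j = (j == f i).
  have := r1 i; rewrite /r (bigD1 (f i))//=; have := svalP (f0 i); rewrite -/(f i).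
  case sa: (s i (f i)) => [|a] // _ /eqP.
  rewrite addSn eqSS addn_eq0 => /andP[/eqP a0 /eqP rest].
  case: (eqVneq j (f i)) => [->|nj]; first by rewrite sa a0.
  by move/eqP: rest; rewrite sum_nat_eq0 => /forallP/(_ j); rewrite nj => /eqP.
have fsurj j : {i | f i == j}.
  apply/sigW/existsP; apply: contraT => /existsPn h; exfalso.
  have : (invmx sm *m sm) j j = 0.
    rewrite mxE big1// => i _; rewrite [sm i j]mxE sE.
    by have := h i; rewrite eq_sym => /negPf ->; rewrite mulr0.
  by rewrite mulVmx// !mxE eqxx => /eqP; rewrite oner_eq0.
pose nu j := sval (fsurj j).
have nuK j : f (nu j) = j by apply/eqP/(svalP (fsurj j)).
have nu_inj : injective nu := can_inj nuK.
exists nu => i j; rewrite sE; congr (nat_of_bool _).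
have fK : cancel f nu by apply/(bij_can_sym (injF_bij nu_inj)).
by apply/eqP/eqP => [->|->]; rewrite ?fK ?nuK.
Qed.
End SocleMatrix.

(** * Algebras presented by a quiver and its relation *)

(** The double of a quiver, in a form that treats an arrow and its reverse alike:
    the orientation survives only in the signs of the relation. *)
Record signed_quiver (F : fieldType) (k : nat) := SignedQuiver {
  sqv :> quiver k;
  bar : arrow sqv -> arrow sqv;
  eps : arrow sqv -> F;
  barK : involutive bar;
  src_bar : forall b, src (bar b) = tgt b;
  epsN : forall b, eps (bar b) = - eps b;
  eps_sq : forall b, eps b * eps b = 1
}.

Section Presentation.
Variables (F : fieldType) (k : nat) (Q : signed_quiver F k).
Notation D := (arrow Q).

Lemma tgt_bar (b : D) : tgt (bar b) = src b.
Proof. by rewrite -src_bar barK. Qed.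

Lemma eps_neq0 (b : D) : eps b != 0.
Proof. by apply/eqP => e0; have /eqP := eps_sq b; rewrite e0 mul0r eq_sym oner_eq0. Qed.

(** The condition for a function on walks to induce a linear map on the quotient
    by the relation. *)
Definition kills_relation (L : lmodType F) (h : 'I_k -> seq D -> L) :=
  forall i s t, walk i s -> walk (walk_end i s) t ->
    \sum_(b | src b == walk_end i s) eps b *: h i (s ++ b :: bar b :: t) = 0.

Section Word.
Variables (A : algType F) (x : D -> A).
Definition word (s : seq D) : A := \prod_(b <- s) x b.
Lemma word_nil : word [::] = 1. Proof. exact: big_nil. Qed.
Lemma word_cons b s : word (b :: s) = x b * word s. Proof. exact: big_cons. Qed.
Lemma word_cat s t : word (s ++ t) = word s * word t. Proof. exact: big_cat. Qed.
End Word.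

(** The preprojective algebra, characterised by what the rest of the argument
    needs: linear maps out of it may be prescribed on walks. *)
Record presents (A : algType F) (e : 'I_k -> A) (x : D -> A) : Prop := Presents {
  e_mul : forall i j, e i * e j = if i == j then e i else 0;
  e_sum : \sum_i e i = 1;
  e_arrow : forall i b, e i * x b = if i == src b then x b else 0;
  arrow_e : forall b i, x b * e i = if tgt b == i then x b else 0;
  relation_sum : \sum_b eps b *: (x b * x (bar b)) = 0;
  span_words : forall P : A -> Prop, P 0 ->
    (forall c i s a, walk i s -> P a -> P (c *: (e i * word x s) + a)) -> forall a, P a;
  universal : forall (L : lmodType F) (h : 'I_k -> seq D -> L), kills_relation h ->
    exists f : {linear A -> L}, forall i s, walk i s -> f (e i * word x s) = h i s
}.

Variables (A : algType F) (e : 'I_k -> A) (x : D -> A).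
Hypothesis pres : presents e x.

Let eM := e_mul pres.
Let e1 := e_sum pres.
Let ex' := e_arrow pres.
Let xe' := arrow_e pres.

Lemma words_ext (L : lmodType F) (f g : A -> L) : linear f -> linear g ->
  (forall i s, walk i s -> f (e i * word x s) = g (e i * word x s)) -> f =1 g.
Proof.
move=> lf lg fg.
pose f' : {linear A -> L} := HB.pack f (GRing.isLinear.Build _ _ _ _ f lf).
pose g' : {linear A -> L} := HB.pack g (GRing.isLinear.Build _ _ _ _ g lg).
move=> a; rewrite -[f a]/(f' a) -[g a]/(g' a); move: a.
apply: (span_words pres); first by rewrite !linear0.
by move=> c i s a ws fa; rewrite !linearP fa; congr (_ *: _ + _); apply: fg.
Qed.

Lemma word_e i s j : walk i s ->
  e i * word x s * e j = if walk_end i s == j then e i * word x s else 0.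
Proof.
elim: s i => [|b s IH] i /=; first by rewrite word_nil mulr1 eM /walk_end /=; case: eqP => [->|].
case/andP => /eqP <- ws; rewrite word_cons.
have xb : x b = x b * e (tgt b) by rewrite xe' eqxx.
have -> : e (src b) * (x b * word x s) = x b * (e (tgt b) * word x s).
  by rewrite mulrA ex' eqxx {1}xb mulrA.
by rewrite -mulrA IH// -[walk_end _ (b :: s)]/(walk_end (tgt b) s); case: eqP; rewrite ?mulr0.
Qed.

Lemma e_word i j s : walk i s -> e j * (e i * word x s) = if j == i then e i * word x s else 0.
Proof. by move=> _; rewrite mulrA eM; case: eqP => [->|_]; rewrite ?mul0r. Qed.

Lemma word_start b s : walk (src b) (b :: s) -> e (src b) * word x (b :: s) = x b * (e (tgt b) * word x s).
Proof. by move=> _; rewrite word_cons !mulrA ex' eqxx xe' eqxx. Qed.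

Lemma xE b : e (src b) * word x [:: b] = x b.
Proof. by rewrite word_cons word_nil mulr1 ex' eqxx. Qed.

Lemma x_word b i s : walk i s ->
  x b * (e i * word x s) = if tgt b == i then e (src b) * word x (b :: s) else 0.
Proof.
by move=> _; rewrite mulrA xe'; case: eqP => [_|]; rewrite ?mul0r// word_cons mulrA ex' eqxx.
Qed.

Lemma word_word i s j t : walk i s -> walk j t ->
  (e i * word x s) * (e j * word x t) =
    if walk_end i s == j then e i * word x (s ++ t) else 0.
Proof.
move=> ws wt; rewrite mulrA word_e//; case: eqP => _; last by rewrite mul0r.
by rewrite word_cat mulrA.
Qed.

Lemma nonwalk0 i s : ~~ walk i s -> e i * word x s = 0.
Proof.
elim: s i => //= b s IH i; rewrite negb_and word_cons; case: eqP => [<- /= ns|sb _].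
  have xb : x b = x b * e (tgt b) by rewrite xe' eqxx.
  by rewrite mulrA ex' eqxx xb -mulrA IH// mulr0.
by rewrite mulrA ex'; case: eqP => [E|_]; [rewrite E in sb|rewrite mul0r].
Qed.

Lemma rel_at i : \sum_(b | src b == i) eps b *: (x b * x (bar b)) = 0.
Proof.
have := congr1 (fun a => e i * a) (relation_sum pres); rewrite /= mulr0 mulr_sumr => E.
rewrite -[RHS]E big_mkcond; apply: eq_bigr => b _.
by rewrite -scalerAr mulrA ex' eq_sym; case: eqP => _; rewrite ?mul0r ?scaler0.
Qed.

(** The relation is homogeneous, so selecting the walks by their length is
    compatible with it. *)
Definition selh (p : pred nat) (i : 'I_k) (s : seq D) : A :=
  if p (size s) then e i * word x s else 0.

Lemma selh_kills p : kills_relation (selh p).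
Proof.
move=> i s t ws wt.
under eq_bigr => b sb do rewrite /selh size_cat /=.
case: (p _); last by rewrite big1 => // b _; rewrite scaler0.
transitivity (e i * word x s * (\sum_(b | src b == walk_end i s) eps b *: (x b * x (bar b))) * word x t).
  rewrite mulr_sumr mulr_suml; apply: eq_bigr => b _.
  by rewrite word_cat !word_cons -scalerAr -scalerAl !mulrA.
by rewrite rel_at mulr0 mul0r.
Qed.

Definition sel p : {linear A -> A} := projT1 (cid (universal pres (selh_kills p))).

Lemma selE p i s : walk i s -> sel p (e i * word x s) = if p (size s) then e i * word x s else 0.
Proof. exact: (projT2 (cid (universal pres (selh_kills p)))). Qed.

Lemma sel_e p i a : sel p (e i * a) = e i * sel p a.
Proof.
move: a; apply: words_ext => [c a b|c a b|j s ws].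
- by rewrite mulrDr -scalerAr linearP.
- by rewrite linearP mulrDr -scalerAr.
rewrite e_word// selE//; case: eqP => [->|ij].
  by rewrite selE//; case: (p _); rewrite ?mulr0// mulrA eM eqxx.
rewrite linear0; case: (p _); rewrite ?mulr0// mulrA eM.
by case: eqP ij => // _; rewrite mul0r.
Qed.

Lemma sel_er p i a : sel p (a * e i) = sel p a * e i.
Proof.
move: a; apply: words_ext => [c a b|c a b|j s ws].
- by rewrite mulrDl -scalerAl linearP.
- by rewrite linearP mulrDl -scalerAl.
rewrite selE// word_e//; case: eqP => we; rewrite ?linear0 ?selE//; case: (p _); rewrite ?mul0r//.
  by rewrite word_e// we eqxx.
by rewrite word_e//; case: eqP.
Qed.

Lemma sel_comp p q a : sel p (sel q a) = sel [pred n | p n && q n] a.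
Proof.
move: a; apply: words_ext => [c a b|c a b|j s ws]; rewrite ?linearP//.
by rewrite !selE//=; case: (q _); rewrite ?linear0 ?andbF ?selE ?andbT.
Qed.

End Presentation.
Arguments sel {F k Q A e x} pres p.

(** * Finite dimension *)

Section WordBasis.
Variables (F : fieldType) (k : nat) (Q : signed_quiver F k).
Notation D := (arrow Q).
Variables (A : algType F) (e : 'I_k -> A) (x : D -> A).

Record word_basis (n : nat) (w : 'I_n -> 'I_k * seq D) (cf : A -> 'I_n -> F) : Prop := WordBasis {
  wb_walk : forall p, walk (w p).1 (w p).2;
  wb_lin : forall p, scalar (cf^~ p);
  wb_span : forall a, a = \sum_p cf a p *: (e (w p).1 * word x (w p).2);
  wb_id : forall p q, cf (e (w p).1 * word x (w p).2) q = (p == q)%:R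
}.

(** [dim] is the dimension vector of the algebra as a module over itself, and
    the inequality bounds its Tits form by its total dimension. *)
Definition tits_bound n (w : 'I_n -> 'I_k * seq D) :=
  let dim i := #|[pred p | (w p).1 == i]| in
  (2 * \sum_i dim i ^ 2 <= 2 * \sum_i dim i + \sum_(b : D) dim (src b) * dim (tgt b))%N.

Hypothesis pres : presents e x.

(** The quotient of the algebra by the words longer than [N] is a representation
    that satisfies the relation, with the unit as a cyclic vector. *)
Section Truncation.
Variable N : nat.
Let tau := sel pres (fun n => (n <= N)%N).

(** A word that is too long stays so when an arrow is put in front of it. *)
Let tau_x b a : tau (x b * tau a) = tau (x b * a).
Proof.
move: a; apply: (words_ext pres) => [c a a'|c a a'|i s ws].
- by rewrite !linearP mulrDr -scalerAr linearP.
- by rewrite mulrDr -scalerAr linearP.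
rewrite /tau selE//; case: leqP => // lt; rewrite mulr0 linear0 (x_word pres)//.
case: eqP => [E|]; rewrite ?linear0// selE /=; last by rewrite eqxx E.
by rewrite leqNgt ltnS ltnW.
Qed.

Let T := {t : 'I_k * {bseq N of D} | walk t.1 t.2}.
Let v (t : T) : A := e (val t).1 * word x (val t).2.

Section Extracted.
Variables (n : nat) (w : 'I_n -> T).
Hypothesis indep : forall c : 'I_n -> F, \sum_p c p *: v (w p) = 0 -> forall p, c p = 0.
Hypothesis span : forall t, exists c : 'I_n -> F, v t = \sum_p c p *: v (w p).

Let tau_v t : tau (v t) = v t.
Proof. by rewrite /tau /v selE ?(valP t)// size_bseq. Qed.

Let tau_span a : exists c : 'I_n -> F, tau a = \sum_p c p *: v (w p).
Proof.
move: a; apply: (span_words pres).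
  by exists (fun=> 0); rewrite linear0 big1// => p _; rewrite scale0r.
move=> c i s a ws [ca Ea].
have [c' E'] : exists c' : 'I_n -> F, tau (e i * word x s) = \sum_p c' p *: v (w p).
  rewrite /tau selE//; case: leqP => lt; last first.
    by exists (fun=> 0); rewrite big1// => p _; rewrite scale0r.
  have h : walk (i, Bseq lt).1 (i, Bseq lt).2 by [].
  exact: (span (Sub (i, Bseq lt) h)).
exists (fun p => c * c' p + ca p); rewrite linearP /= Ea E' scaler_sumr -big_split.
by apply: eq_bigr => p _; rewrite scalerDl scalerA.
Qed.

Let cf a : 'I_n -> F := projT1 (cid (tau_span a)).
Let cfE a : tau a = \sum_p cf a p *: v (w p).
Proof. exact: (projT2 (cid (tau_span a))). Qed.

Let cf_uniq a c : tau a = \sum_p c p *: v (w p) -> cf a =1 c.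
Proof.
move=> E p; apply/eqP; rewrite -subr_eq0; apply/eqP; apply: (indep (c := fun p => cf a p - c p)).
under eq_bigr do rewrite scalerBl.
by rewrite sumrB -E -cfE subrr.
Qed.

Let cf_lin p : scalar (cf^~ p).
Proof.
move=> c a b /=; apply: (cf_uniq (c := fun p => c * cf a p + cf b p)).
rewrite linearP /= !cfE scaler_sumr -big_split; apply: eq_bigr => q _.
by rewrite scalerDl scalerA.
Qed.

Let cf_tau a b : tau a = tau b -> cf a =1 cf b.
Proof. by move=> E; apply: cf_uniq; rewrite E cfE. Qed.

Let cf0 p : cf 0 p = 0.
Proof. by rewrite (cf_uniq (c := fun=> 0)) // linear0 big1// => q _; rewrite scale0r. Qed.

Let cf_v p q : cf (v (w p)) q = (p == q)%:R.
Proof.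
rewrite (cf_uniq (c := fun q => (p == q)%:R))// tau_v (bigD1 p)//= eqxx scale1r.
by rewrite big1 ?addr0// => r; rewrite eq_sym => /negPf ->; rewrite scale0r.
Qed.

Let cf_sum (I : finType) (c : I -> F) (a : I -> A) p :
  cf (\sum_i c i *: a i) p = \sum_i c i * cf (a i) p.
Proof.
elim/big_rec2: _ => [|i z b _ <-]; first exact: cf0.
exact: cf_lin.
Qed.

Let vt p := (val (w p)).1.
Let X b : 'M[F]_n := \matrix_(q, p) cf (x b * v (w p)) q.
Let cv a : 'cV[F]_n := \col_p cf a p.

Let cv_x b a : cv (x b * a) = X b *m cv a.
Proof.
have -> : cv (x b * a) = cv (x b * tau a).
  by apply/colP => p; rewrite !mxE; apply: cf_tau; rewrite tau_x.
apply/colP => q; rewrite !mxE cfE mulr_sumr.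
under eq_bigr => p _ do rewrite -scalerAr.
by rewrite cf_sum; apply: eq_bigr => p _; rewrite !mxE mulrC.
Qed.

Let cf_e i a p : cf (e i * a) p = if vt p == i then cf a p else 0.
Proof.
apply: (cf_uniq (c := fun p => if vt p == i then cf a p else 0)).
rewrite (sel_e pres) cfE mulr_sumr; apply: eq_bigr => q _.
rewrite -scalerAr /v mulrA (e_mul pres) eq_sym -/(vt q).
by case: eqP => [->|_]; rewrite ?mul0r ?scaler0 ?scale0r.
Qed.

Lemma truncated_tits_bound : tits_bound (fun p => ((val (w p)).1, val (val (w p)).2)).
Proof.
have Xs b p q : X b p q != 0 -> vt p = src b /\ vt q = tgt b.
  rewrite mxE => nz; split.
    move: nz; have -> : x b * v (w q) = e (src b) * (x b * v (w q)).
      by rewrite mulrA (e_arrow pres) eqxx.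
    by rewrite cf_e; case: (vt p =P src b) => [-> //|_]; rewrite eqxx.
  move: nz; rewrite /v mulrA (arrow_e pres) -/(vt q).
  by case: (tgt b =P vt q) => [-> //|_]; rewrite mul0r cf0 eqxx.
have XX b a : X b *m cv a = cv (x b * a) by rewrite cv_x.
have Xcol b p : X b *m delta_mx p 0 = cv (x b * v (w p)).
  by rewrite cv_x; congr (_ *m _); apply/colP => q; rewrite !mxE cf_v eqxx andbT eq_sym.
have Xr : \sum_b eps b *: (X b *m X (bar b)) = 0.
  apply/matrixP => q p; rewrite [RHS]mxE -[RHS](cf0 q).
  have -> : 0 = \sum_b eps b *: (x b * (x (bar b) * v (w p))).
    under eq_bigr do rewrite mulrA scalerAl.
    by rewrite -mulr_suml (relation_sum pres) mul0r.
  rewrite cf_sum summxE; apply: eq_bigr => b _; rewrite mxE; congr (_ * _).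
  have -> : cf (x b * (x (bar b) * v (w p))) q = cv (x b * (x (bar b) * v (w p))) q 0 by rewrite mxE.
  rewrite cv_x -Xcol mulmxA [in RHS]mxE (bigD1 p)//= [delta_mx p 0 p 0]mxE !eqxx mulr1 big1 ?addr0// => r /negPf.
  by move=> rp; rewrite [delta_mx p 0 r 0]mxE rp mulr0.
have Xc (f : 'M[F]_n) : (forall p q, f p q != 0 -> vt p = vt q) ->
    (forall b, X b *m f = f *m X b) -> f *m cv 1 = 0 -> f = 0.
  move=> fs fX f1.
  have fword s : f *m cv (word x s) = 0.
    elim: s => [|b s IH]; first by rewrite word_nil.
    by rewrite word_cons cv_x mulmxA -fX -mulmxA IH mulmx0.
  have fv i s : f *m cv (e i * word x s) = 0.
    apply/colP => p; rewrite !mxE.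
    have /colP/(_ p) := fword s; rewrite !mxE => E.
    case: (eqVneq (vt p) i) => ip; last first.
      rewrite big1// => q _; rewrite mxE cf_e; case: eqP => [qi|]; rewrite ?mulr0//.
      have [->|/fs pq] := eqVneq (f p q) 0; rewrite ?mul0r//.
      by rewrite pq qi eqxx in ip.
    rewrite -[RHS]E; apply: eq_bigr => q _; rewrite !mxE cf_e.
    case: eqP => // nq; have [->|/fs pq] := eqVneq (f p q) 0; rewrite ?mul0r//.
    by rewrite -pq ip in nq.
  apply/matrixP => p q; have /colP/(_ p) := fv (val (w q)).1 (val (w q)).2.
  rewrite !mxE => <-; rewrite (bigD1 q)//= !mxE cf_v eqxx mulr1 big1 ?addr0// => r.
  by move=> /negPf rq; rewrite mxE cf_v eq_sym rq mulr0.
have := tits_form_bound (@barK _ _ Q) (@src_bar _ _ Q) (@epsN _ _ Q) (@eps_neq0 _ _ Q) Xs Xr Xc.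
rewrite /tits_bound /=; set dim := fun i => #|[pred p | vt p == i]|.
have -> : #|[pred t : 'I_n * 'I_n | vt t.1 == vt t.2]| = (\sum_i dim i ^ 2)%N.
  rewrite -sum1_card -(pair_big_dep xpredT (fun p q => vt p == vt q) (fun _ _ => 1%N)) /=.
  rewrite (partition_big vt xpredT)//=; apply: eq_bigr => i _.
  rewrite (eq_bigr (fun=> dim i)) => [|p /eqP <-]; last first.
    by rewrite sum1_card; apply: eq_card => q; rewrite !inE eq_sym.
  by rewrite sum_nat_const -mulnn; congr (_ * _)%N; apply: eq_card => q; rewrite !inE.
have -> : #|[pred t : D * ('I_n * 'I_n) | (vt t.2.1 == src t.1) && (vt t.2.2 == tgt t.1)]| =
    (\sum_(b : D) dim (src b) * dim (tgt b))%N.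
  rewrite -sum1_card -(pair_big_dep xpredT (fun b (t : 'I_n * 'I_n) =>
     (vt t.1 == src b) && (vt t.2 == tgt b)) (fun _ _ => 1%N)) /=.
  apply: eq_bigr => b _.
  rewrite -(pair_big (fun p => vt p == src b) (fun p => vt p == tgt b) (fun _ _ => 1%N)) /=.
  rewrite (eq_bigr (fun=> dim (tgt b))) => [|p _]; last by rewrite sum1_card.
  by rewrite sum_nat_const.
suff dn : (\sum_i dim i = n)%N by rewrite dn.
apply: etrans (card_ord n); rewrite -sum1_card (partition_big vt xpredT)//=.
by apply: eq_bigr => i _; rewrite sum1_card.
Qed.

Lemma truncated_word_basis : (forall i s, walk i s -> (N < size s)%N -> e i * word x s = 0) ->
  word_basis (fun p => ((val (w p)).1, val (val (w p)).2)) cf.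
Proof.
move=> van; have tau_id : tau =1 id.
  apply: (words_ext pres) => [? ? ?|//|i s ws]; first exact: linearP.
  by rewrite /tau selE//; case: leqP => // lt; rewrite van.
split=> //=.
- by move=> p; apply: (valP (w p)).
- by move=> a; rewrite -[LHS]tau_id cfE.
Qed.

Lemma nonzero_length i s : walk i s -> (size s <= N)%N -> e i * word x s != 0 ->
  exists p, size (val (w p)).2 = size s.
Proof.
move=> ws sN nz; apply: contrapT => none; move/eqP: nz; apply.
have E := cfE (e i * word x s); rewrite /tau selE// sN in E.
have := congr1 (sel pres (pred1 (size s))) E.
rewrite selE//= eqxx linear_sum => ->; rewrite big1// => p _.
rewrite linearZ /= /v selE ?(valP (w p))//=; case: eqP => // ps; rewrite ?scaler0//.
by case: none; exists p.
Qed.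

End Extracted.

Lemma truncation_basis : exists n (w : 'I_n -> 'I_k * seq D),
  [/\ tits_bound w,
     forall i s, walk i s -> (size s <= N)%N -> e i * word x s != 0 ->
       exists p, size (w p).2 = size s &
     (forall i s, walk i s -> (N < size s)%N -> e i * word x s = 0) ->
       exists cf, word_basis w cf].
Proof.
have [n [w [indep span]]] := basis_extraction v.
exists n, (fun p => ((val (w p)).1, val (val (w p)).2)); split.
- exact: truncated_tits_bound.
- exact: nonzero_length.
- by move=> van; eexists; apply: truncated_word_basis.
Qed.
End Truncation.

Variables (y : 'I_k -> nat) (c : nat).
Hypotheses (y0 : forall i, (0 < y i)%N) (c0 : (0 < c)%N).
Hypothesis yC : forall i, (2 * y i = \sum_(b : D | src b == i) y (tgt b) + c)%N.

(** Every truncation has dimension at most [N], whatever its length. At length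
    [N] there are [N.+1] possible lengths of words but at most [N] words in a
    basis, so some length carries no nonzero word, and neither do longer ones. *)
Theorem finite_dimensional : exists n (w : 'I_n -> 'I_k * seq D) cf d,
  [/\ word_basis w cf, tits_bound w &
      forall i s, walk i s -> (d <= size s)%N -> e i * word x s = 0].
Proof.
pose N := (2 * \sum_i y i)%N.
have [n [w [tb nzl bas]]] := truncation_basis N.
have nN : (n <= N)%N.
  have := bounded_dimension (@barK _ _ Q) (@src_bar _ _ Q) y0 c0 yC tb.
  congr (_ <= _)%N; apply: etrans (card_ord n); rewrite -sum1_card.
  rewrite (partition_big (fun p => (w p).1) xpredT)//=.
  by apply: eq_bigr => i _; rewrite sum1_card.
have [d dN vd] : exists2 d, (d <= N)%N & forall i s, walk i s -> size s = d -> e i * word x s = 0.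
  apply: contrapT => nod.
  have ex (d : 'I_N.+1) : exists p, size (w p).2 = d.
    apply: contrapT => nop; apply: nod; exists d; first by rewrite -ltnS.
    move=> i s ws sd; apply/eqP; apply/negP => /negP nz; apply: nop.
    by rewrite -sd; apply: (nzl i) => //; rewrite sd -ltnS.
  pose f d := projT1 (cid (ex d)); have fE d : size (w (f d)).2 = d := projT2 (cid (ex d)).
  have finj : injective f by move=> a b ab; apply: val_inj; rewrite /= -!fE ab.
  by have := leq_card f finj; rewrite !card_ord ltnNge nN.
have van i s : walk i s -> (d <= size s)%N -> e i * word x s = 0.
  rewrite -{1}(cat_take_drop d s) walk_cat => /andP[wt wd] ds.
  rewrite -[in LHS](cat_take_drop d s) word_cat mulrA vd ?mul0r// size_take.
  by case: ltnP => //; lia.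
have [cf bcf] := bas (fun i s ws lt => van i s ws (leq_trans dN (ltnW lt))).
by exists n, w, cf, d.
Qed.
End WordBasis.

(** * Components and the presentation complex *)

#[short(type="finAlgType")]
HB.structure Definition FinAlg (F : fieldType) := { A of Vector F A & GRing.Algebra F A }.

Section ProductSubspace.
Variables (F : fieldType) (A : vectType F) (D : finType) (V : D -> {vspace A}).

Lemma product_subspace : exists U : {vspace {ffun D -> A}},
  (forall f : {ffun D -> A}, (f \in U) = [forall b, f b \in V b]) /\ \dim U = (\sum_b \dim (V b))%N.
Proof.
pose T := {b : D & 'I_(\dim (V b))}.
pose l (c : {ffun T -> F^o}) : {ffun D -> A} :=
  [ffun b => \sum_(t < \dim (V b)) c (Tagged (fun b => 'I_(\dim (V b))) t) *: (vbasis (V b))`_t].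
have ll : linear l.
  move=> a f g; apply/ffunP => b; rewrite !ffunE scaler_sumr -big_split.
  by apply: eq_bigr => t _; rewrite !ffunE scalerDl scalerA.
pose L : 'Hom({ffun T -> F^o}, {ffun D -> A}) := linfun l.
have LE c : L c = l c by rewrite linfun_linear.
have K0 : lker L = 0%VS.
  apply/eqP; rewrite -subv0; apply/subvP => c; rewrite memv_ker LE memv0 => /eqP/ffunP E.
  apply/eqP/ffunP => -[b t]; rewrite [RHS]ffunE.
  have/freeP/(_ (fun t => c (Tagged (fun b => 'I_(\dim (V b))) t))) := basis_free (vbasisP (V b)).
  by apply; have := E b; rewrite !ffunE.
exists (limg L); split.
  move=> f; apply/memv_imgP/forallP => [[c _ ->] b|fV].
    by rewrite LE ffunE; apply: memv_suml => t _; apply/memvZ/vbasis_mem; rewrite mem_nth ?size_tuple.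
  exists [ffun t : T => coord (vbasis (V (tag t))) (tagged t) (f (tag t))]; first exact: memvf.
  apply/ffunP => b; rewrite LE ffunE [LHS](coord_vbasis (fV b)).
  by apply: eq_bigr => t _; rewrite ffunE.
rewrite limg_dim_eq ?capfv// dimvf /dim /= muln1 card_tagged sumnE big_map big_enum /=.
by apply: eq_bigr => b _; rewrite card_ord.
Qed.
End ProductSubspace.

Section GradedAlgebra.
Variables (F : fieldType) (k : nat) (Q : signed_quiver F k).
Notation D := (arrow Q).
Variables (A : finAlgType F) (e : 'I_k -> A) (x : D -> A).
Hypothesis pres : presents e x.
Variables (n : nat) (w : 'I_n -> 'I_k * seq D) (cf : A -> 'I_n -> F) (d0 : nat).
Hypothesis wb : word_basis e x w cf.
Hypothesis van : forall i s, walk i s -> (d0 <= size s)%N -> e i * word x s = 0.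

Notation gr d := (sel pres (pred1 d)).
Notation len p := (size (w p).2).
Notation start p := (w p).1.
Notation endp p := (walk_end (w p).1 (w p).2).
Notation wv p := (e (w p).1 * word x (w p).2).

Let wbw p : walk (w p).1 (w p).2 := wb_walk wb p.

Lemma cf_sum (c : 'I_n -> F) p : cf (\sum_q c q *: wv q) p = c p.
Proof.
have lin := wb_lin wb p.
have [f fE] : exists f : {scalar A}, forall a, f a = cf a p.
  pose f : {scalar A} := HB.pack (cf^~ p) (GRing.isLinear.Build _ _ _ _ (cf^~ p) lin).
  by exists f.
rewrite -fE linear_sum (bigD1 p)//= linearZ /= fE (wb_id wb) eqxx mulr1.
rewrite big1 ?addr0// => q /negPf qp.
by rewrite linearZ /= fE (wb_id wb) qp mulr0.
Qed.

Lemma cf0 p : cf 0 p = 0.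
Proof.
by rewrite -[RHS](cf_sum (fun=> 0) p); congr cf; rewrite big1// => q _; rewrite scale0r.
Qed.

Lemma cf_gr d a p : cf (gr d a) p = if len p == d then cf a p else 0.
Proof.
rewrite {1}(wb_span wb a) linear_sum -[RHS](cf_sum (fun p => if len p == d then cf a p else 0)).
congr cf; apply: eq_bigr => q _; rewrite linearZ /= selE//=.
by case: eqP; rewrite ?scale0r ?scaler0.
Qed.

Lemma cf_e i a p : cf (e i * a) p = if start p == i then cf a p else 0.
Proof.
rewrite {1}(wb_span wb a) mulr_sumr -[RHS](cf_sum (fun p => if start p == i then cf a p else 0)).
congr cf; apply: eq_bigr => q _; rewrite -scalerAr (e_word pres)// eq_sym.
by case: eqP; rewrite ?scale0r ?scaler0.
Qed.

Lemma cf_er j a p : cf (a * e j) p = if endp p == j then cf a p else 0.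
Proof.
rewrite {1}(wb_span wb a) mulr_suml -[RHS](cf_sum (fun p => if endp p == j then cf a p else 0)).
congr cf; apply: eq_bigr => q _; rewrite -scalerAl (word_e pres)//.
by case: eqP; rewrite ?scale0r ?scaler0.
Qed.

Lemma cf_inj a b : cf a =1 cf b -> a = b.
Proof.
by move=> E; rewrite (wb_span wb a) (wb_span wb b); apply: eq_bigr => p _; rewrite E.
Qed.

Lemma wv_neq0 p : wv p != 0.
Proof.
apply/eqP => E; have := cf_sum (fun=> 0) p; rewrite big1 => [|q _]; last by rewrite scale0r.
by rewrite -E (wb_id wb) eqxx => /eqP; rewrite oner_eq0.
Qed.

Lemma len_lt p : (len p < d0)%N.
Proof. by rewrite ltnNge; apply/negP => h; have := wv_neq0 p; rewrite van// eqxx. Qed.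

Definition gproj d i j a := gr d (e i * a * e j).

Lemma gproj_linear d i j : linear (gproj d i j).
Proof. by move=> c a b; rewrite /gproj mulrDr mulrDl -scalerAr -scalerAl linearP. Qed.

Lemma cf_gproj d i j a p : cf (gproj d i j a) p =
  if [&& len p == d, start p == i & endp p == j] then cf a p else 0.
Proof. by rewrite cf_gr cf_er cf_e; do 3!case: eqP => //=. Qed.

Definition component d i j : {vspace A} := limg (linfun (gproj d i j)).

Notation G := component.

Lemma memG d i j a : (a \in G d i j) = (gproj d i j a == a).
Proof.
apply/memv_imgP/eqP => [[b _ ->]|<-].
  by rewrite linfun_linear; [|exact: gproj_linear]; apply: cf_inj => p; rewrite !cf_gproj; case: [&& _, _ & _].
by exists a; rewrite ?memvf// linfun_linear//; apply: gproj_linear.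
Qed.

Lemma gprojG d i j a : gproj d i j a \in G d i j.
Proof. by rewrite memG; apply/eqP/cf_inj => p; rewrite !cf_gproj; case: [&& _, _ & _]. Qed.

Lemma G_gr d i j a : a \in G d i j -> gr d a = a.
Proof.
by rewrite memG => /eqP <-; apply: cf_inj => p; rewrite cf_gr cf_gproj; do 3!case: eqP => //=.
Qed.
Lemma G_e d i j a : a \in G d i j -> e i * a = a.
Proof.
by rewrite memG => /eqP <-; apply: cf_inj => p; rewrite cf_e cf_gproj; do 3!case: eqP => //=.
Qed.
Lemma G_er d i j a : a \in G d i j -> a * e j = a.
Proof.
by rewrite memG => /eqP <-; apply: cf_inj => p; rewrite cf_er cf_gproj; do 3!case: eqP => //=.
Qed.
Lemma G_intro d i j a : gr d a = a -> e i * a = a -> a * e j = a -> a \in G d i j.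
Proof. by move=> h1 h2 h3; rewrite memG /gproj h2 h3 h1. Qed.

Lemma word_G i s : walk i s -> e i * word x s \in G (size s) i (walk_end i s).
Proof.
move=> ws; apply: G_intro; first by rewrite selE//= eqxx.
  by rewrite (e_word pres)// eqxx.
by rewrite (word_e pres)// eqxx.
Qed.

Definition word_class d i j := [pred p | [&& len p == d, start p == i & endp p == j]].

Lemma dimG d i j : \dim (G d i j) = #|word_class d i j|.
Proof.
pose l (c : {ffun {p | word_class d i j p} -> F^o}) : A := \sum_p (c p : F) *: (wv (val p) : A).
have ll : linear l.
  move=> a f g; rewrite /l scaler_sumr -big_split.
  by apply: eq_bigr => t _; rewrite !ffunE scalerDl scalerA.
pose L : 'Hom({ffun {p | word_class d i j p} -> F^o}, A) := linfun l.
have LE c : L c = l c by rewrite linfun_linear.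
pose ext (c : {ffun {p | word_class d i j p} -> F^o}) p : F := if insub p is Some t then c t else 0.
have lE c : l c = \sum_p ext c p *: wv p.
  rewrite [RHS](bigID (word_class d i j)) /= [X in _ = _ + X]big1 ?addr0 => [|p np]; last first.
    by rewrite /ext insubN ?scale0r.
  rewrite (big_sub (word_class d i j) (fun p => ext c p *: wv p)).
  by apply: eq_bigr => p _; rewrite /ext valK.
have K0 : lker L = 0%VS.
  apply/eqP; rewrite -subv0; apply/subvP => c; rewrite memv_ker LE memv0 => /eqP E.
  apply/eqP/ffunP => p; rewrite [RHS]ffunE.
  have := cf_sum (ext c) (val p); rewrite -lE E /ext valK => <-.
  by rewrite -(cf_sum (fun=> 0) (val p)) big1// => q _; rewrite scale0r.
have <- : limg L = G d i j.
  apply/vspaceP => a; apply/memv_imgP/idP => [[c _ ->]|].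
    rewrite LE; apply: memv_suml => -[p cp] _; apply: memvZ => /=.
    by have /and3P[/eqP <- /eqP <- /eqP <-] := cp; apply: word_G.
  rewrite memG => /eqP aE; exists [ffun p => cf a (val p)]; first exact: memvf.
  rewrite LE lE [LHS](wb_span wb a); apply: eq_bigr => p _; congr (_ *: _).
  rewrite -aE cf_gproj /ext; case: insubP => [t ct tp|/negPf np].
    by rewrite ffunE tp aE; move: ct => /= ->.
  by move: np => /= ->.
by rewrite limg_dim_eq ?K0 ?capv0// dimvf /dim /= muln1 card_sig.
Qed.

Lemma G_out d i j : (d0 <= d)%N -> G d i j = 0%VS.
Proof.
move=> dd; apply/eqP; rewrite -dimv_eq0 dimG; apply/eqP/eq_card0 => p; rewrite !inE.
by apply/negP => /and3P[/eqP E _ _]; have := len_lt p; rewrite E ltnNge dd.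
Qed.

Definition trivial_coef (j i : 'I_k) (s : seq D) : F^o := ((s == [::]) && (i == j))%:R.

(** The coefficient of the trivial walk at [j] is unaffected by the relation. *)
Lemma e_neq0 j : e j != 0.
Proof.
have kr : kills_relation (trivial_coef j).
  by move=> i s t _ _; rewrite big1// => b _; rewrite /trivial_coef; case: s => *; rewrite /= scaler0.
have [f fE] := universal pres kr.
apply/eqP => ej; have := fE j [::] isT.
rewrite ej mul0r linear0 /trivial_coef !eqxx => /esym/eqP; exact/negP/oner_neq0.
Qed.

Lemma gr_x d b a : gr d.+1 (x b * a) = x b * gr d a.
Proof.
move: a; apply: (words_ext pres) => [c a a'|c a a'|i s ws].
- by rewrite mulrDr -scalerAr linearP.
- by rewrite linearP mulrDr -scalerAr.
rewrite selE//= (x_word pres)//; case: (tgt b =P i) => [ti|nti].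
  rewrite selE /=; last by rewrite eqxx ti.
  by rewrite eqSS; case: eqP => _; rewrite ?mulr0// (x_word pres)// ti eqxx.
by rewrite linear0; case: eqP => _; rewrite ?mulr0// (x_word pres)//; case: eqP nti.
Qed.

Lemma gr0_x b a : gr 0%N (x b * a) = 0.
Proof.
move: a; apply: (words_ext pres) => [c a a'|c a a'|i s ws].
- by rewrite mulrDr -scalerAr linearP.
- by rewrite scaler0 addr0.
rewrite (x_word pres)//; case: (tgt b =P i) => [ti|nti]; last exact: linear0.
by rewrite selE /= ?eqxx ?ti.
Qed.

Lemma gr_words d i s a : walk i s ->
  gr (size s + d)%N (e i * word x s * a) = e i * word x s * gr d a.
Proof.
move: a => + ws; apply: (words_ext pres) => [c a a'|c a a'|j t wt].
- by rewrite mulrDr -scalerAr linearP.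
- by rewrite linearP mulrDr -scalerAr.
rewrite (word_word pres)// selE//=; case: (walk_end i s =P j) => [E|E].
  rewrite selE; last by rewrite walk_cat ws E wt.
  rewrite /= size_cat eqn_add2l; case: (size t =P d) => _; rewrite ?mulr0//.
  by rewrite (word_word pres)// E eqxx.
by rewrite linear0; case: (size t =P d) => _; rewrite ?mulr0// (word_word pres)//; case: eqP E.
Qed.

Lemma xG d j b a : a \in G d (tgt b) j -> x b * a \in G d.+1 (src b) j.
Proof.
move=> aG; apply: G_intro; first by rewrite gr_x (G_gr aG).
  by rewrite mulrA (e_arrow pres) eqxx.
by rewrite -mulrA (G_er aG).
Qed.

Let rel_map (q : A) : {ffun D -> A} := [ffun b => eps b *: (x (bar b) * q)].
Let rel_map_linear : linear rel_map.
Proof.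
move=> c a b; apply/ffunP => f; rewrite !ffunE mulrDr -scalerAr scalerDr.
by rewrite !scalerA mulrC.
Qed.
Let U := limg (linfun rel_map).
Let pi_ := quotv_pi U.
Let delta b a : {ffun D -> A} := [ffun b' => if b' == b then a else 0].
(** Removes the first arrow of a walk, recording which one it was. Where the
    relation starts at that arrow, the ambiguity is an element of [U]. *)
Let tail_map (i : 'I_k) (s : seq D) : quotv U :=
  if s is b :: s' then pi_ (delta b (e (tgt b) * word x s')) else 0.

Let delta_linear b : linear (delta b).
Proof.
move=> c a a'; apply/ffunP => f; rewrite !ffunE.
by case: eqP => _; rewrite ?scaler0 ?addr0.
Qed.

Let tail_kills : kills_relation tail_map.
Proof.
move=> i [|b0 s] t ws wt.
  transitivity (pi_ (rel_map (e i * word x t))); last first.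
    apply/eqP; rewrite quotv_pi_eq0 -linfun_linear; first exact: memv_img (memvf _).
    exact: rel_map_linear.
  under eq_bigr => b sb do rewrite /= -linearZ.
  rewrite -linear_sum; congr (pi_ _); apply/ffunP => b; rewrite sum_ffunE !ffunE.
  rewrite [in RHS]mulrA (arrow_e pres) tgt_bar; have [sb|nsb] := eqVneq (src b) i.
    rewrite (bigD1 b)/= ?sb//= !ffunE eqxx big1 ?addr0 => [|b' /andP[_ /negPf bb']].
      by rewrite word_cons mulrA -src_bar (e_arrow pres) eqxx.
    by rewrite !ffunE eq_sym bb' scaler0.
  rewrite mul0r scaler0 big1// => b' /eqP sb'; rewrite !ffunE.
  by case: eqP => [E|]; rewrite ?scaler0//; move: nsb; rewrite E sb' /walk_end /= eqxx.
move: ws => /= /andP[/eqP sb0 ws].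
transitivity (pi_ (\sum_(b | src b == walk_end i (b0 :: s))
    eps b *: delta b0 (e (tgt b0) * word x (s ++ b :: bar b :: t)))).
  by rewrite linear_sum; apply: eq_bigr => b _; rewrite /= linearZ.
rewrite [X in pi_ X](_ : _ = 0) ?linear0//.
apply/ffunP => b; rewrite sum_ffunE !ffunE.
under eq_bigr => b' _ do rewrite !ffunE.
case: (b == b0); last by rewrite big1// => b' _; rewrite scaler0.
transitivity (e (tgt b0) * word x s * (\sum_(b | src b == walk_end i (b0 :: s))
    eps b *: (x b * x (bar b))) * word x t).
  rewrite mulr_sumr mulr_suml; apply: eq_bigr => b' _.
  by rewrite word_cat !word_cons -scalerAr -scalerAl !mulrA.
by rewrite (rel_at pres) mulr0 mul0r.
Qed.

(** The map that removes the first arrow descends to the algebra with values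
    modulo [U]. Applied to the vanishing sum it says that the family [a] lies
    in [U], which consists of the families coming from a single [q]. *)
Lemma presentation_exact (a : D -> A) : (forall b, e (tgt b) * a b = a b) ->
  \sum_b eps b *: (x b * a b) = 0 -> exists q, forall b, a b = x (bar b) * q.
Proof.
move=> ea s0; have [f fE] := universal pres tail_kills.
have fx b c : f (x b * c) = pi_ (delta b (e (tgt b) * c)).
  move: c; apply: (words_ext pres) => [c a1 a2|c a1 a2|i s ws].
  - by rewrite mulrDr -scalerAr linearP.
  - by rewrite mulrDr -scalerAr delta_linear linearP.
  rewrite (x_word pres)// (e_word pres)//; case: eqP => ti.
    by rewrite fE /= ?eqxx ?ti.
  have -> : delta b 0 = 0 by apply/ffunP => b'; rewrite !ffunE; case: ifP.
  by rewrite !linear0.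
have := congr1 f s0; rewrite linear0 linear_sum.
under eq_bigr => b _ do rewrite linearZ /= fx ea -linearZ.
rewrite -linear_sum => /eqP; rewrite quotv_pi_eq0 => /memv_imgP[q _].
rewrite linfun_linear; last exact: rel_map_linear.
move=> /ffunP E; exists q => b; have := E b; rewrite sum_ffunE !ffunE.
rewrite (bigD1 b)//= !ffunE eqxx big1 ?addr0 => [|b' /negPf bb']; last first.
  by rewrite !ffunE eq_sym bb' scaler0.
exact: (@scalerI _ A _ (eps_neq0 b)).
Qed.

Lemma presentation_generates a : exists (c : 'I_k -> F) (t : D -> A),
  a = \sum_i c i *: e i + \sum_b x b * t b.
Proof.
move: a; apply: (span_words pres).
  by exists (fun=> 0), (fun=> 0); rewrite !big1 ?addr0// => *; rewrite ?scale0r ?mulr0.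
move=> c i s a ws [c' [t ->]]; case: s ws => [|b s] /=.
  move=> _; exists (fun j => c * (j == i)%:R + c' j), t.
  rewrite word_nil mulr1 addrA; congr (_ + _).
  under [RHS]eq_bigr do rewrite scalerDl; rewrite big_split /=; congr (_ + _).
  rewrite (bigD1 i)//= eqxx mulr1 big1 ?addr0// => j /negPf ->.
  by rewrite mulr0 scale0r.
case/andP => /eqP <- ws; exists c', (fun b' => (if b' == b then c *: (e (tgt b) * word x s) else 0) + t b').
rewrite addrCA; congr (_ + _).
under [RHS]eq_bigr do rewrite mulrDr; rewrite big_split /=; congr (_ + _).
rewrite (bigD1 b)//= eqxx big1 ?addr0 => [|b' /negPf ->]; last by rewrite mulr0.
by rewrite -scalerAr (word_start pres)//= eqxx.
Qed.

Definition socle : {vspace A} := lker (linfun (fun a : A => [ffun b => x b * a] : {ffun D -> A})).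

Notation soc := socle.

Let mulx_linear : linear (fun a : A => [ffun b => x b * a] : {ffun D -> A}).
Proof. by move=> c a b; apply/ffunP => f; rewrite !ffunE mulrDr -scalerAr. Qed.

Lemma socP a : reflect (forall b, x b * a = 0) (a \in soc).
Proof.
rewrite memv_ker linfun_linear//; apply: (iffP eqP) => [/ffunP E b|E].
  by have := E b; rewrite !ffunE.
by apply/ffunP => b; rewrite !ffunE E.
Qed.

Let d1 (f : {ffun D -> A}) : A := \sum_b eps b *: (x b * f b).
Let d1_linear : linear d1.
Proof.
move=> c f g; rewrite /d1 scaler_sumr -big_split; apply: eq_bigr => b _.
by rewrite !ffunE mulrDr -scalerAr scalerDr !scalerA mulrC.
Qed.

Let d1_image d i j (W : {vspace {ffun D -> A}}) :
  (forall f : {ffun D -> A}, (f \in W) = [forall b, f b \in (if src b == i then G d (tgt b) j else 0%VS)]) ->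
  (linfun d1 @: W)%VS = G d.+1 i j.
Proof.
move=> WP; apply/vspaceP => a; apply/memv_imgP/idP => [[f fW ->]|aG].
  rewrite linfun_linear//; apply: memv_suml => b _; apply: memvZ.
  move: fW; rewrite WP => /forallP/(_ b); case: (src b =P i) => [<-|_]; first exact: xG.
  by rewrite memv0 => /eqP ->; rewrite mulr0 mem0v.
have [c [t at_]] := presentation_generates a.
exists [ffun b => if src b == i then eps b *: gproj d (tgt b) j (t b) else 0].
  rewrite WP; apply/forallP => b; rewrite ffunE; case: ifP => _; last exact: mem0v.
  by apply: memvZ; apply: gprojG.
have aE : gproj d.+1 i j a = a by apply/eqP; rewrite -memG.
rewrite linfun_linear// /d1 -[LHS]aE {1}at_.
rewrite /gproj mulrDr mulrDl linearD /= [X in X + _](_ : _ = 0) ?add0r; last first.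
  rewrite mulr_sumr mulr_suml linear_sum big1// => l _.
  rewrite -scalerAr -scalerAl linearZ /= (e_mul pres); case: eqP => [<-|_]; last first.
    by rewrite mul0r linear0 scaler0.
  rewrite (e_mul pres); case: eqP => _; last by rewrite linear0 scaler0.
  by rewrite -[e i]mulr1 -(word_nil x) selE// scaler0.
rewrite mulr_sumr mulr_suml linear_sum; apply: eq_bigr => b _; rewrite ffunE.
rewrite mulrA (e_arrow pres) eq_sym; case: eqP => sb; last by rewrite !mul0r linear0 mulr0 scaler0.
rewrite -scalerAr scalerA eps_sq scale1r -mulrA gr_x /gproj.
by rewrite -[in RHS]mulrA (sel_e pres) mulrA (arrow_e pres) eqxx.
Qed.

(** The Euler characteristic of [A -> \bigoplus_b A -> A] in a fixed degree. The
    complex is exact in the middle; the kernel of its first map is the socle,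
    and the image of the second one is everything of positive length. *)
Lemma dim_recurrence d i j :
  (\dim (G d.+2 i j) + \dim (G d i j) =
   \sum_(b : D | src b == i) \dim (G d.+1 (tgt b) j) + \dim (G d i j :&: soc))%N.
Proof.
have [W [WP Wdim]] := product_subspace
  (fun b : D => if src b == i then G d.+1 (tgt b) j else 0%VS).
have := limg_ker_dim (linfun d1) W; rewrite Wdim (d1_image WP).
have -> : (\sum_(b : D) \dim (if src b == i then G d.+1 (tgt b) j else 0%VS) =
   \sum_(b : D | src b == i) \dim (G d.+1 (tgt b) j))%N.
  by rewrite [in RHS]big_mkcond; apply: eq_bigr => b _; case: ifP; rewrite ?dimv0.
move=> E1.
pose d2 (q : A) : {ffun D -> A} := [ffun b => x (bar b) * q].
have d2l : linear d2 by move=> c a b; apply/ffunP => f; rewrite !ffunE mulrDr -scalerAr.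
have := limg_ker_dim (linfun d2) (G d i j).
have -> : lker (linfun d2) = soc.
  apply/vspaceP => q; rewrite memv_ker linfun_linear//; apply/eqP/socP => [/ffunP E b|E].
    by have := E (bar b); rewrite !ffunE barK.
  by apply/ffunP => b; rewrite !ffunE E.
have -> : (linfun d2 @: G d i j)%VS = (W :&: lker (linfun d1))%VS.
  apply/vspaceP => f; rewrite memv_cap memv_ker linfun_linear//.
  apply/memv_imgP/andP => [[q qG ->]|[fW /eqP f0]].
    rewrite linfun_linear//; split.
      rewrite WP; apply/forallP => b; rewrite ffunE -(G_e qG) mulrA (arrow_e pres) tgt_bar.
      case: eqP => [sb|_]; last by rewrite mul0r mem0v.
      by rewrite -src_bar; apply: xG; rewrite tgt_bar sb.
    rewrite /d1; under eq_bigr => b _ do rewrite ffunE mulrA scalerAl.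
    by rewrite -mulr_suml (relation_sum pres) mul0r.
  have ef b : e (tgt b) * f b = f b.
    move: fW; rewrite WP => /forallP/(_ b); case: eqP => _; first exact: G_e.
    by rewrite memv0 => /eqP ->; rewrite mulr0.
  have [q fq] := presentation_exact ef f0.
  exists (gproj d i j q); first exact: gprojG.
  apply/ffunP => b; rewrite linfun_linear// ffunE.
  rewrite /gproj -gr_x !mulrA (arrow_e pres) tgt_bar.
  move: fW; rewrite WP => /forallP/(_ b); case: eqP => sb; last first.
    by rewrite memv0 => /eqP ->; rewrite !mul0r linear0.
  by move=> fG; rewrite -fq (G_er fG) (G_gr fG).
by move=> E2; rewrite -E2 -E1 [RHS]addnC addnCA [X in (_ + X)%N = _]addnC.
Qed.

Lemma dim1 i j : \dim (G 1 i j) = (\sum_(b : D | src b == i) \dim (G 0 (tgt b) j))%N.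
Proof.
have [W [WP Wdim]] := product_subspace
  (fun b : D => if src b == i then G 0 (tgt b) j else 0%VS).
have := limg_ker_dim (linfun d1) W; rewrite Wdim (d1_image WP).
have -> : (\sum_(b : D) \dim (if src b == i then G 0 (tgt b) j else 0%VS) =
   \sum_(b : D | src b == i) \dim (G 0 (tgt b) j))%N.
  by rewrite [in RHS]big_mkcond; apply: eq_bigr => b _; case: ifP; rewrite ?dimv0.
suff -> : (W :&: lker (linfun d1))%VS = 0%VS by rewrite dimv0.
apply/eqP; rewrite -subv0; apply/subvP => f; rewrite memv_cap memv_ker linfun_linear//.
case/andP => fW /eqP f0; rewrite memv0; apply/eqP/ffunP => b; rewrite [RHS]ffunE.
have fG b' : e (tgt b') * f b' = f b' /\ gr 0%N (f b') = f b'.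
  move: fW; rewrite WP => /forallP/(_ b'); case: eqP => _.
    by move=> h; rewrite (G_e h) (G_gr h).
  by rewrite memv0 => /eqP ->; rewrite mulr0 linear0.
have [q fq] := presentation_exact (fun b => (fG b).1) f0.
by rewrite -(fG b).2 fq gr0_x.
Qed.

Lemma dim0 i j : \dim (G 0 i j) = (i == j).
Proof.
have [<-|ij] := eqVneq i j.
  suff -> : G 0 i i = <[e i]>%VS by rewrite dim_vline e_neq0.
  apply/eqP; rewrite eqEsubv; apply/andP; split; last first.
    by rewrite -memvE; have := @word_G i [::] isT; rewrite word_nil mulr1.
  apply/subvP => a; rewrite memG => /eqP <-; rewrite {1}(wb_span wb a).
  rewrite /gproj mulr_sumr mulr_suml linear_sum; apply: memv_suml => p _.
  rewrite -scalerAr -scalerAl linearZ; apply: memvZ => /=.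
  rewrite (e_word pres)//; case: eqP => [E|_]; last by rewrite mul0r linear0 mem0v.
  rewrite (word_e pres)//; case: eqP => _; last by rewrite linear0 mem0v.
  rewrite selE//=; case: eqP => [/size0nil->|_]; last exact: mem0v.
  by rewrite word_nil mulr1 -E memv_line.
rewrite dimG; apply: eq_card0 => p; rewrite !inE.
apply/negP => /and3P[/eqP/size0nil E /eqP si]; rewrite E /walk_end /= si.
by rewrite (negPf ij).
Qed.

End GradedAlgebra.

(** * The socle *)

Section Socle.
Variables (F : fieldType) (k : nat) (Q : signed_quiver F k).
Notation D := (arrow Q).
Variables (A : finAlgType F) (e : 'I_k -> A) (x : D -> A).
Hypothesis pres : presents e x.
Variables (n : nat) (w : 'I_n -> 'I_k * seq D) (cf : A -> 'I_n -> F) (d0 : nat).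
Hypothesis wb : word_basis e x w cf.
Hypothesis van : forall i s, walk i s -> (d0 <= size s)%N -> e i * word x s = 0.
Hypothesis tb : tits_bound w.

Notation gr d := (sel pres (pred1 (d : nat))).
Notation len p := (size (w p).2).
Notation start p := (w p).1.
Notation endp p := (walk_end (w p).1 (w p).2).
Notation wv p := (e (w p).1 * word x (w p).2).
Notation G := (component pres).
Notation soc := (socle x).

Let Pn l j := #|[pred p | (start p == l) && (endp p == j)]|.
Let sn i j := (\sum_(d < d0) \dim (G d i j :&: soc))%N.

Let Pn_sum i j : Pn i j = (\sum_(d < d0) \dim (G d i j))%N.
Proof.
rewrite /Pn -sum1_card (partition_big (fun p => Ordinal (len_lt wb van p)) xpredT)//=.
apply: eq_bigr => d _; rewrite sum1_card (dimG pres wb); apply: eq_card => p.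
by rewrite !inE andbC.
Qed.

Let sum_shift (f : nat -> nat) : (\sum_(d < d0) f d.+1 + f 0 = \sum_(d < d0) f d + f d0)%N.
Proof.
transitivity (\sum_(d < d0.+1) f d)%N; first by rewrite big_ord_recl addnC.
by rewrite big_ord_recr.
Qed.

Let dim_out d i j : (d0 <= d)%N -> \dim (G d i j) = 0%N.
Proof. by move=> h; rewrite (G_out pres wb van)// dimv0. Qed.

(** [dim_recurrence], summed over all degrees. *)
Let cartan i j :
  (2 * Pn i j = \sum_(b : D | src b == i) Pn (tgt b) j + (i == j) + sn i j)%N.
Proof.
have E : (\sum_(d < d0) (\dim (G d.+2 i j) + \dim (G d i j)) =
    \sum_(d < d0) (\sum_(b : D | src b == i) \dim (G d.+1 (tgt b) j) + \dim (G d i j :&: soc)))%N.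
  by apply: eq_bigr => d _; apply: (dim_recurrence pres wb).
move: E; rewrite !big_split /= -/(sn i j) -Pn_sum exchange_big /=.
have h1 := sum_shift (fun d => \dim (G d.+1 i j)).
have h2 := sum_shift (fun d => \dim (G d i j)).
have h3 : (\sum_(b : D | src b == i) \sum_(d < d0) \dim (G d.+1 (tgt b) j) +
   \dim (G 1 i j) = \sum_(b : D | src b == i) Pn (tgt b) j)%N.
  rewrite (dim1 pres wb) -big_split; apply: eq_bigr => b _ /=.
  by rewrite Pn_sum (sum_shift (fun d => \dim (G d (tgt b) j))) [\dim (G d0 _ _)]dim_out ?addn0.
rewrite /= -Pn_sum (dim0 pres wb) [\dim (G d0 i j)]dim_out// in h2.
rewrite /= [\dim (G d0.+1 i j)]dim_out// in h1.
move: h1 h2 h3; move: (\dim (G 1 i j)) (\sum_(d < d0) \dim (G d.+2 i j))%N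
  (\sum_(d < d0) \dim (G d.+1 i j))%N (\sum_(b : D | src b == i) _)%N
  (\sum_(b : D | src b == i) Pn (tgt b) j)%N (Pn i j) (sn i j) (nat_of_bool (i == j)).
by lia.
Qed.

Let gr_sum (a : A) : a = \sum_(d < d0) gr d a.
Proof.
apply: (cf_inj wb) => p.
have -> : \sum_(d < d0) gr d a = \sum_q (cf a q) *: wv q; last by rewrite (cf_sum wb).
under eq_bigr => d _ do rewrite {1}(wb_span wb a) linear_sum.
rewrite exchange_big; apply: eq_bigr => q _.
rewrite (bigD1 (Ordinal (len_lt wb van q)))//= big1 ?addr0 => [|d].
  by rewrite linearZ /= selE ?(wb_walk wb)//= eqxx.
rewrite -val_eqE /= eq_sym => /negPf h.
by rewrite linearZ /= selE ?(wb_walk wb)//= h scaler0.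
Qed.

Lemma long_word0 s : (d0 <= size s)%N -> word x s = 0.
Proof.
move=> ds; rewrite -[word x s]mul1r -(e_sum pres) mulr_suml big1// => i _.
by case: (boolP (walk i s)) => ws; [apply: van|apply: (nonwalk0 pres)].
Qed.

(** Left multiplication by arrows is nilpotent, so a longest word that does not
    kill [a] sends it into the socle. *)
Lemma socle_reach (a : A) : a != 0 -> exists s, word x s * a != 0 /\ word x s * a \in soc.
Proof.
move=> a0.
suff H c s : (d0 <= c + size s)%N -> word x s * a != 0 ->
    exists s, word x s * a != 0 /\ word x s * a \in soc.
  by apply: (H d0 [::]); rewrite ?leq_addr// word_nil mul1r.
elim: c s => [|c IH] s; first by rewrite add0n => /long_word0 ->; rewrite mul0r eqxx.
move=> cs nz; case: (boolP [forall b, x b * (word x s * a) == 0]) => [/forallP h|].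
  by exists s; split=> //; apply/socP => b; apply/eqP.
rewrite negb_forall => /existsP[b hb]; apply: (IH (b :: s)); first by rewrite /= addnS -addSn.
by rewrite word_cons -mulrA.
Qed.

Lemma G_gr0 d d' i j a : a \in G d' i j -> d != d' -> gr d a = 0.
Proof.
move=> aG /negPf dd'; rewrite -(G_gr wb aG); apply: (cf_inj wb) => p.
by rewrite !(cf_gr pres wb) (cf0 wb); case: eqP => // ->; rewrite dd'.
Qed.

(** Multiplying by the basis walks that end at [l], and then projecting to the
    socle, is injective on the elements starting at [l], because some word sends
    each of those into the socle without killing it. *)
Let embed l j : (Pn l j <= \sum_i Pn i l * sn i j)%N.
Proof.
pose V (pd : 'I_n * 'I_d0) : {vspace A} :=
  if endp pd.1 == l then (G pd.2 (start pd.1) j :&: soc)%VS else 0%VS.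
have [W [WP Wdim]] := product_subspace V.
have -> : (\sum_i Pn i l * sn i j = \dim W)%N.
  rewrite Wdim -(pair_bigA _ (fun p d => \dim (V (p, d)))) /=.
  transitivity (\sum_(p | endp p == l) sn (start p) j)%N.
    rewrite (partition_big (fun p => start p) xpredT)//=; apply: eq_bigr => i _.
    rewrite (eq_bigr (fun=> sn i j)) => [|p /andP[_ /eqP ->]//].
    by rewrite sum_nat_const; congr (_ * _)%N; apply: eq_card => p; rewrite !inE andbC.
  rewrite big_mkcond; apply: eq_bigr => p _; rewrite /V /=.
  by case: eqP => _; last by rewrite big1// => d _; rewrite dimv0.
pose E : {vspace A} := (\sum_(d < d0) G d l j)%VS.
have EP a : a \in E -> e l * a = a /\ a * e j = a.
  move=> /memv_sumP[t tG ->]; rewrite mulr_sumr mulr_suml.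
  by split; apply: eq_bigr => d _; rewrite ?(G_e wb (tG d isT)) ?(G_er wb (tG d isT)).
have -> : Pn l j = \dim E.
  rewrite Pn_sum /E; apply/esym/eqP.
  suff /directvP-> : directv (\sum_(d < d0) G d l j)%VS by [].
  apply/directv_sum_independent => t tG t0 d _.
  have := congr1 (gr d) t0; rewrite linear0 linear_sum (bigD1 d)//= (G_gr wb (tG d isT)).
  rewrite big1 ?addr0// => d' dd'; apply: (G_gr0 (tG d' isT)).
  by rewrite -val_eqE eq_sym in dd'.
pose phi (a : A) : {ffun 'I_n * 'I_d0 -> A} := [ffun pd => projv (V pd) (gr pd.2 (wv pd.1 * a))].
have phil : linear phi.
  by move=> c a b; apply/ffunP => pd; rewrite !ffunE mulrDr -scalerAr !linearP.
have <- : \dim (linfun phi @: E) = \dim E.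
  apply: limg_dim_eq; apply/eqP; rewrite -subv0; apply/subvP => a.
  rewrite memv_cap memv_ker linfun_linear// memv0 => /andP[aE /eqP/ffunP phi0].
  have [ela aej] := EP a aE.
  apply: contraT => a0; exfalso.
  have [c c0] : exists c : 'I_d0, gr c a != 0.
    apply: contrapT => none; move/eqP: a0; apply; rewrite (gr_sum a) big1// => c _.
    by apply/eqP; apply: contrapT => /negP h; apply: none; exists c.
  have [s [s0 ssoc]] := socle_reach c0.
  have [i i0] : exists i, e i * word x s * gr c a != 0.
    apply: contrapT => none; move/eqP: s0; apply.
    rewrite -[word x s]mul1r -(e_sum pres) !mulr_suml big1// => i _.
    by apply/eqP; apply: contrapT => /negP h; apply: none; exists i.
  have ws : walk i s by apply: contraNT i0 => nw; rewrite (nonwalk0 pres nw) mul0r.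
  pose z := e i * word x s * gr c a.
  have zG : z \in G (size s + c)%N i j.
    apply: (G_intro wb).
    - rewrite /z (gr_words pres)//; congr (_ * _); rewrite (sel_comp pres).
      by apply: (cf_inj wb) => p; rewrite -{1}(sel_comp pres) !(cf_gr pres wb); case: eqP.
    - by rewrite /z -mulrA [e i * (e i * _)]mulrA (e_mul pres) eqxx.
    - by rewrite /z -[LHS]mulrA -(sel_er pres) aej.
  have zsoc : z \in soc.
    apply/socP => b; rewrite /z -!mulrA mulrA (arrow_e pres); case: eqP => _; last by rewrite mul0r.
    by move/socP: ssoc => /(_ b); rewrite mulrA.
  have zd : (size s + c < d0)%N.
    rewrite ltnNge; apply/negP => h; move: zG; rewrite (G_out pres wb van)// memv0.
    by apply/negP.
  have zE : z = \sum_(p | (len p == size s) && (start p == i))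
      cf (e i * word x s) p *: (wv p * gr c a).
    rewrite /z {1}(wb_span wb (e i * word x s)) mulr_suml [RHS]big_mkcond /=.
    apply: eq_bigr => p _; rewrite -scalerAl -[in LHS](_ : gr (size s) (e i * word x s) = e i * word x s).
      by rewrite (cf_gr pres wb) (cf_e pres wb); case: eqP => //= _; rewrite ?scale0r//;
         case: eqP; rewrite ?scale0r// (cf_e pres wb) => ->; rewrite eqxx.
    by rewrite selE//= eqxx.
  pose V0 := (G (size s + c)%N i j :&: soc)%VS.
  have zV : z \in V0 by rewrite memv_cap zG zsoc.
  move: i0; rewrite -/z -(projv_id zV) zE linear_sum big1 ?eqxx// => p /andP[/eqP lp /eqP sp].
  rewrite linearZ /=.
  have [ep|ep] := eqVneq (endp p) l; last first.
    rewrite -ela (sel_e pres) mulrA (word_e pres) ?(wb_walk wb)//.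
    by rewrite (negPf ep) mul0r linear0 scaler0.
  have := phi0 (p, Ordinal zd); rewrite !ffunE /= /V /= ep eqxx.
  by rewrite -lp (gr_words pres) ?(wb_walk wb)// sp lp => ->; rewrite scaler0.
apply: dimvS; apply/subvP => _ /memv_imgP[a _ ->].
rewrite linfun_linear// WP; apply/forallP => pd; rewrite ffunE; exact: memv_proj.
Qed.

Lemma nakayama_permutation : exists nu : 'I_k -> 'I_k,
  forall i j, (\sum_(d < d0) \dim (G d i j :&: soc))%N = (i == nu j).
Proof.
have xE i : (\sum_j Pn i j)%N = #|[pred p | start p == i]|.
  rewrite -sum1_card [RHS](partition_big (fun p => endp p) xpredT)//=.
  by apply: eq_bigr => j _; rewrite sum1_card.
apply: (socle_permutation cartan embed).
  by under eq_bigr do rewrite xE; under [X in (_ <= 2 * X + _)%N]eq_bigr do rewrite xE;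
     under [X in (_ <= _ + X)%N]eq_bigr do rewrite !xE; exact: tb.
move=> i; rewrite (bigD1 i)//= addn_gt0; apply/orP; left.
rewrite Pn_sum; case: (posnP d0) => [d00|dp].
  by have := e_neq0 pres i; rewrite -[e i]mulr1 -(word_nil x) van ?eqxx// d00.
by rewrite (bigD1 (Ordinal dp))//= (dim0 pres wb) eqxx.
Qed.

End Socle.

(** * Socle degrees and Chebyshev matrices *)

Section Chebyshev.
Variables (F : fieldType) (k : nat) (Q : signed_quiver F k).
Notation D := (arrow Q).

Definition adjacency : 'M[int]_k :=
  \matrix_(i, j) #|[pred b : D | (src b == i) && (tgt b == j)]|%:Z.

Fixpoint cheb2 d : 'M[int]_k * 'M[int]_k :=
  if d is d'.+1 then ((cheb2 d').2, adjacency *m (cheb2 d').2 - (cheb2 d').1)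
  else (1%:M, adjacency).
(** The Chebyshev polynomials of the second kind, in the variable [2 cos], at the
    adjacency matrix. *)
Definition cheb d := (cheb2 d).1.

Lemma chebS d : cheb d.+2 = adjacency *m cheb d.+1 - cheb d.
Proof. by []. Qed.

Lemma adjacency_sym i j : adjacency i j = adjacency j i.
Proof.
rewrite !mxE; congr (Posz _); rewrite -[LHS]sum1_card -[RHS]sum1_card.
rewrite (reindex_inj (inv_inj (@barK _ _ Q))) /=; apply: eq_bigl => b.
by rewrite !inE src_bar tgt_bar andbC.
Qed.

Lemma adjacencyl (M : 'M[int]_k) i j :
  (adjacency *m M) i j = \sum_(b : D | src b == i) M (tgt b) j.
Proof.
rewrite mxE (partition_big (fun b : D => tgt b) xpredT)//=; apply: eq_bigr => l _.
rewrite (eq_bigr (fun=> M l j)) => [|b /andP[_ /eqP ->]//].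
rewrite mxE sumr_const -mulr_natl; congr (_ * _).
by rewrite natz; congr (Posz _); apply: eq_card => b.
Qed.

Lemma adjacencyr (M : 'M[int]_k) i j :
  (M *m adjacency) i j = \sum_(b : D | src b == j) M i (tgt b).
Proof.
have := adjacencyl M^T j i; rewrite !mxE => E.
rewrite (eq_bigr (fun l => adjacency j l * M^T l i)) => [|l _].
  by rewrite E; apply: eq_bigr => b _; rewrite mxE.
by rewrite mulrC adjacency_sym [M^T l i]mxE.
Qed.

Lemma cheb_comm d : adjacency *m cheb d = cheb d *m adjacency.
Proof.
suff: adjacency *m cheb d = cheb d *m adjacency /\
      adjacency *m cheb d.+1 = cheb d.+1 *m adjacency by case.
elim: d => [|d [IH1 IH2]]; first by rewrite /cheb /= mul1mx mulmx1.
split=> //; rewrite chebS mulmxBr mulmxBl IH1; congr (_ - _).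
by rewrite -mulmxA -IH2.
Qed.

Lemma cheb_sym d i j : cheb d i j = cheb d j i.
Proof.
suff: (cheb d)^T = cheb d /\ (cheb d.+1)^T = cheb d.+1.
  by case=> /matrixP/(_ j i); rewrite mxE.
have aT : adjacency^T = adjacency by apply/matrixP => a b; rewrite mxE adjacency_sym.
elim: d => [|d [IH1 IH2]]; first by rewrite /cheb /= trmx1 aT.
by split=> //; rewrite chebS linearB /= trmx_mul IH1 IH2 aT cheb_comm.
Qed.

End Chebyshev.
Arguments adjacency {F k} Q.
Arguments cheb {F k} Q d.

Section TopDegree.
Variables (F : fieldType) (k : nat) (Q : signed_quiver F k).
Notation D := (arrow Q).
Variables (A : finAlgType F) (e : 'I_k -> A) (x : D -> A).
Hypothesis pres : presents e x.
Variables (n : nat) (w : 'I_n -> 'I_k * seq D) (cf : A -> 'I_n -> F) (d0 : nat).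
Hypothesis wb : word_basis e x w cf.
Hypothesis van : forall i s, walk i s -> (d0 <= size s)%N -> e i * word x s = 0.
Hypothesis tb : tits_bound w.
Hypothesis conn : forall P : 'I_k -> Prop, (exists j, P j) ->
  (forall b : D, P (src b) -> P (tgt b)) -> forall j, P j.
Hypothesis k0 : (0 < k)%N.

Notation G := (component pres).
Notation soc := (socle x).
Notation cheb := (cheb Q).
Let kappa (d : nat) (i j : 'I_k) : nat := \dim (G d i j :&: soc).

Let dim_soc d i j : (forall l, \dim (G d.+1 l j) = 0%N) -> kappa d i j = \dim (G d i j).
Proof.
move=> h; congr (\dim _); apply/capv_idPl/subvP => a aG; apply/socP => b.
have [ti|ti] := eqVneq (tgt b) i.
  have aG' : a \in G d (tgt b) j by rewrite ti.
  have := xG wb aG'.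
  have /eqP := h (src b); rewrite dimv_eq0 => /eqP ->; rewrite memv0.
  by move/eqP.
by rewrite -(G_e wb aG) mulrA (arrow_e pres) (negPf ti) mul0r.
Qed.

Section WithPermutation.
Variable nu : 'I_k -> 'I_k.
Hypothesis socE : forall i j, (\sum_(d < d0) kappa d i j)%N = (i == nu j).

(** The socle dimensions with fixed [j] add up to [1], so they are concentrated
    in a single degree and a single row. *)
Let kappa_ex j : exists m, forall d i, kappa d i j = (d == m) && (i == nu j).
Proof.
have [m km] : exists m : 'I_d0, kappa m (nu j) j != 0%N.
  apply: contrapT => none; have := socE (nu j) j; rewrite eqxx big1// => d _.
  by apply/eqP; apply: contrapT => /negP h; apply: none; exists d.
exists (m : nat) => d i; case: (leqP d0 d) => dd.
  rewrite /kappa (G_out pres wb van)// cap0v dimv0.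
  by case: eqP dd => // ->; rewrite leqNgt ltn_ord.
have := socE i j; rewrite (bigD1 (Ordinal dd))//=.
case: (i =P nu j) => [->|_]; last by rewrite andbF => /eqP; rewrite addn_eq0 => /andP[/eqP].
rewrite andbT; have := socE (nu j) j; rewrite eqxx (bigD1 m)//=.
case: (d =P m) => [dm|dm]; last first.
  move=> km1; have := km; rewrite -lt0n => kp.
  have /eqP : (\sum_(i0 < d0 | i0 != m) kappa i0 (nu j) j = 0)%N.
    move: km1 kp; set S := (\sum_(_ < _ | _) _)%N; set K := kappa _ _ _.
    by lia.
  rewrite sum_nat_eq0 => /forallP/(_ (Ordinal dd)); rewrite -val_eqE /=.
  by case: eqP dm => // _ _ /eqP ->.
by move=> s1 _; rewrite dm; move: km s1; rewrite -lt0n; lia.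
Qed.

Let mj j := projT1 (cid (kappa_ex j)).
Let kE d i j : kappa d i j = (d == mj j) && (i == nu j).
Proof. exact: (projT2 (cid (kappa_ex j))). Qed.

(** A topmost nonzero component consists of socle elements, and there are none
    above the degree [mj j]. *)
Let G_above d i j : (mj j < d)%N -> \dim (G d i j) = 0%N.
Proof.
suff H c : (d0 <= d + c)%N -> (mj j < d)%N -> forall i, \dim (G d i j) = 0%N.
  by move=> h; apply: (H d0 _ h); rewrite leq_addl.
elim: c d {i} => [|c IH] d; first by rewrite addn0 => h _ i; rewrite (G_out pres wb van)// dimv0.
move=> dc md i; rewrite -dim_soc ?kE; first by rewrite gtn_eqF.
by apply: IH; rewrite ?addSn -?addnS// ltnS ltnW.
Qed.

Let G_top i j : \dim (G (mj j) i j) = (i == nu j).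
Proof. by rewrite -dim_soc ?kE ?eqxx// => l; apply: G_above. Qed.

(** Below its socle degree a column satisfies the recurrence [dim_recurrence]
    without the socle term. *)
Let G_cheb d i j : (d <= (mj j).+1)%N -> (\dim (G d i j))%:Z = cheb d i j.
Proof.
suff H : forall i, ((d <= (mj j).+1)%N -> (\dim (G d i j))%:Z = cheb d i j) /\
     ((d.+1 <= (mj j).+1)%N -> (\dim (G d.+1 i j))%:Z = cheb d.+1 i j).
  by have [] := H i.
elim: d {i} => [|d IH] i.
  split; first by rewrite (dim0 pres wb) mxE; case: eqP.
  rewrite (dim1 pres wb) => _; rewrite -[cheb 1]mulmx1 adjacencyl.
  rewrite (big_morph Posz PoszD (erefl _)); apply: eq_bigr => b _.
  by rewrite (dim0 pres wb) mxE; case: eqP.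
split; first by have [] := IH i.
move=> dm; rewrite chebS mxE adjacencyl [X in _ + X]mxE.
have [Hd _] := IH i; rewrite -Hd; last by rewrite ltnW// ltnW.
have := congr1 Posz (dim_recurrence pres wb d i j).
rewrite -/(kappa d i j) kE ltn_eqF//= addn0 PoszD => /(canRL (addrK _)) ->.
congr (_ - _); rewrite (big_morph Posz PoszD (erefl _)); apply: eq_bigr => b _.
by have [_ ->] := IH (tgt b); last exact: ltnW.
Qed.

(** Let [M] be the least socle degree, attained in the column [src b]. Then
    [cheb M.+1] is nonnegative and its column [src b] vanishes; as it commutes
    with the adjacency matrix, the column [tgt b] vanishes as well, so that the
    socle degree there is [M] too. Connectedness does the rest. *)
Let mj_const : exists m, forall j, mj j = m.
Proof.
case: (arg_minnP (i0 := Ordinal k0) (P := xpredT) mj isT) => j0 _ jmin.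
exists (mj j0); apply: conn; first by exists j0.
move=> b sb; apply/eqP; rewrite eqn_leq jmin// andbT.
set M := mj j0 in sb jmin *.
have z l : cheb M.+1 l (tgt b) = 0.
  have : (adjacency Q *m cheb M.+1) l (src b) = 0.
    by rewrite adjacencyl big1// => b' _; rewrite -G_cheb ?sb// G_above// sb.
  rewrite cheb_comm adjacencyr => /eqP; rewrite psumr_eq0 => [/allP/(_ b)|b' _].
    by rewrite mem_index_enum eqxx => /(_ isT)/eqP.
  by rewrite -G_cheb// ltnS jmin.
rewrite leqNgt; apply/negP => lt.
have zd l : \dim (G M.+1 l (tgt b)) = 0%N.
  by apply/eqP; rewrite -eqz_nat; apply/eqP; rewrite G_cheb ?z// ltnS ltnW.
have GM l : \dim (G M l (tgt b)) = 0%N.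
  by rewrite -dim_soc// kE ltn_eqF.
have step d : (M <= d)%N -> forall l, \dim (G d l (tgt b)) = 0%N.
  move=> /subnK <-; elim: (d - M)%N => [|c IH] l; first exact: GM.
  have [->|cp] := posnP c; first exact: zd.
  move: IH; case: c cp => // c _ IH.
  have := dim_recurrence pres wb (c + M) l (tgt b).
  have -> : (\sum_(b0 : D | src b0 == l) \dim (G (c + M).+1 (tgt b0) (tgt b)) = 0)%N.
    by rewrite big1// => b' _; apply: IH.
  have kg : (\dim (G (c + M) l (tgt b) :&: soc) <= \dim (G (c + M) l (tgt b)))%N.
    exact/dimvS/capvSl.
  by move: kg; rewrite add0n !addSn; lia.
by have := G_top (nu (tgt b)) (tgt b); rewrite step ?eqxx// ltnW.
Qed.

Lemma uniform_top : exists m, [/\ involutive nu,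
  forall d i j, \dim (G d i j :&: soc) = (d == m) && (i == nu j),
  forall i j, \dim (G m i j) = (i == nu j),
  forall d i j, (m < d)%N -> \dim (G d i j) = 0%N &
  (forall i j, cheb m i j = (i == nu j)%:Z) /\ cheb m.+1 = 0].
Proof.
have [m mE] := mj_const; exists m.
have cm i j : cheb m i j = (i == nu j)%:Z.
  by rewrite -(mE j) -G_cheb// G_top.
split=> [j|d i j|i j|d i j md|].
(* The matrix of [nu] is a polynomial in a symmetric matrix. *)
- have := cheb_sym Q m (nu j) j; rewrite !cm eqxx.
  by case: eqP.
- by rewrite -/(kappa d i j) kE mE.
- by rewrite -G_top mE.
- by rewrite G_above// mE.
split=> //; apply/matrixP => i j; rewrite [RHS]mxE -G_cheb ?mE//.
by rewrite G_above// mE.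
Qed.
End WithPermutation.

Theorem nakayama_data : exists (nu : 'I_k -> 'I_k) m, [/\ involutive nu,
  forall d i j, \dim (G d i j :&: soc) = (d == m) && (i == nu j),
  forall i j, \dim (G m i j) = (i == nu j),
  forall d i j, (m < d)%N -> \dim (G d i j) = 0%N &
  (forall i j, cheb m i j = (i == nu j)%:Z) /\ cheb m.+1 = 0].
Proof.
have [nu socE] := nakayama_permutation pres wb van tb.
have [m H] := uniform_top socE.
by exists nu, m.
Qed.
End TopDegree.

(** * The Nakayama automorphism *)

Section Nakayama.
Variables (F : fieldType) (k : nat) (Q : signed_quiver F k).
Notation D := (arrow Q).
Variables (A : finAlgType F) (e : 'I_k -> A) (x : D -> A).
Hypothesis pres : presents e x.
Variables (n : nat) (w : 'I_n -> 'I_k * seq D) (cf : A -> 'I_n -> F) (d0 : nat).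
Hypothesis wb : word_basis e x w cf.
Hypothesis van : forall i s, walk i s -> (d0 <= size s)%N -> e i * word x s = 0.
Hypothesis arrow_inj : forall a b : D, src a = src b -> tgt a = tgt b -> a = b.

Notation gr d := (sel pres (pred1 (d : nat))).
Notation len p := (size (w p).2).
Notation start p := (w p).1.
Notation endp p := (walk_end (w p).1 (w p).2).
Notation wv p := (e (w p).1 * word x (w p).2).
Notation G := (component pres).
Notation soc := (socle x).
Notation cheb := (cheb Q).

Variables (nu : 'I_k -> 'I_k) (m : nat).
Hypothesis nuK : involutive nu.
Hypothesis soc_dim : forall d i j, \dim (G d i j :&: soc) = (d == m) && (i == nu j).
Hypothesis top_dim : forall i j, \dim (G m i j) = (i == nu j).
Hypothesis above : forall d i j, (m < d)%N -> \dim (G d i j) = 0%N.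
Hypothesis cheb_m : forall i j, cheb m i j = (i == nu j)%:Z.
Hypothesis cheb_m1 : cheb m.+1 = 0.

Lemma above0 i s : walk i s -> (m < size s)%N -> e i * word x s = 0.
Proof.
move=> ws ms; have := word_G pres wb ws.
by have /eqP := above i (walk_end i s) ms; rewrite dimv_eq0 => /eqP ->; rewrite memv0 => /eqP.
Qed.

(** The linear form that is [1] on each basis word of the top length. It restricts
    to a coordinate on each of the one-dimensional pieces of the socle. *)
Definition top_form (a : A) : F := \sum_(p | len p == m) cf a p.

Notation lam := top_form.

Lemma lam_linear : scalar lam.
Proof.
move=> c a b; rewrite /top_form mulr_sumr -big_split; apply: eq_bigr => p _.
exact: (wb_lin wb p).
Qed.
HB.instance Definition _ := GRing.isLinear.Build F A F *%R lam lam_linear.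

Lemma lam_gr d a : lam (gr d a) = if d == m then lam a else 0.
Proof.
case: eqP => [->|dm]; first by apply: eq_bigr => p lp; rewrite (cf_gr pres wb) lp.
by apply: big1 => p /eqP lp; rewrite (cf_gr pres wb) lp eq_sym; case: eqP dm.
Qed.

Lemma class_top p : len p = m -> start p = nu (endp p).
Proof.
move=> lp; apply/eqP; have := top_dim (start p) (endp p); case: eqP => // _ /eqP.
rewrite dimv_eq0 => /eqP G0; have := word_G pres wb (wb_walk wb p).
by rewrite lp G0 memv0 => /eqP E; have := wv_neq0 wb p; rewrite E eqxx.
Qed.

Lemma lam_e i a : lam (e i * a) = lam (a * e (nu i)).
Proof.
apply: eq_bigr => p /eqP lp; rewrite (cf_e pres wb) (cf_er pres wb).
by rewrite -(can2_eq nuK nuK) -(class_top lp).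
Qed.

Lemma soc_cf z p : z \in soc -> cf z p != 0 -> len p = m /\ start p = nu (endp p).
Proof.
move=> zs zp; pose y := gproj pres (len p) (start p) (endp p) z.
have ys : y \in soc.
  apply/socP => b; rewrite /y /gproj -(gr_x pres) !mulrA (arrow_e pres).
  by case: eqP => _; rewrite ?(socP _ _ zs) ?mul0r linear0.
have y0 : y != 0.
  apply: contraNneq zp => y0; have := cf_gproj pres wb (len p) (start p) (endp p) z p.
  by rewrite -/y y0 (cf0 wb) !eqxx /= => <-.
have := soc_dim (len p) (start p) (endp p); case: andP => [[/eqP ? /eqP ?] //|_ /eqP].
rewrite dimv_eq0 => /eqP E; move: y0; rewrite -memv0 -E memv_cap ys andbT.
by rewrite (gprojG pres wb).
Qed.

(** Some word sends [a] into the socle, and a nonzero socle element has a nonzero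
    coefficient on a word of the top length, the only one of its class. *)
Lemma lam_nondegenerate a : a != 0 -> exists b, lam (b * a) != 0.
Proof.
move=> /(socle_reach pres van)[s [nz zs]]; set z := word x s * a in nz zs.
have [p zp] : exists p, cf z p != 0.
  apply: contrapT => none; move/eqP: nz; apply; apply: (cf_inj wb) => p; rewrite (cf0 wb).
  by apply/eqP; apply: contrapT => /negP h; apply: none; exists p.
have [lp sp] := soc_cf zs zp.
exists (e (nu (endp p)) * word x s); rewrite -mulrA -/z /top_form (bigD1 p) ?lp//=.
rewrite (cf_e pres wb) -sp eqxx big1 ?addr0// => q /andP[/eqP lq qp].
rewrite (cf_e pres wb); case: eqP => // sq.
apply/eqP; apply: contraNT qp => zq; have [_ eq'] := soc_cf zs zq.
have ep : endp q = endp p by apply: (inv_inj nuK); rewrite -eq' -sp.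
have /card_le1_eqP : (#|word_class w m (start p) (endp p)| <= 1)%N.
  by rewrite -(dimG pres wb) top_dim; case: eqP.
move=> h; apply/eqP; apply: h; rewrite !inE; first by rewrite lp !eqxx.
by apply/and3P; split; apply/eqP.
Qed.

Lemma lam_injr b b' : (forall a, lam (a * b) = lam (a * b')) -> b = b'.
Proof.
move=> E; apply/eqP; rewrite -subr_eq0; apply: contraT => /lam_nondegenerate[a].
by rewrite mulrBr linearB /= E subrr eqxx.
Qed.

Let lam_represents (f : A -> F) : scalar f -> exists b, forall a, f a = lam (a * b).
Proof.
apply: (pairing_represents (B := fun a b => lam (a * b))) => [b c a a'|a c b b'|b h].
- by rewrite mulrDl -scalerAl linearP.
- by rewrite mulrDr -scalerAr linearP.
- by apply: lam_injr => a; rewrite h mulr0 linear0.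
Qed.

Lemma lam_injl b b' : (forall a, lam (b * a) = lam (b' * a)) -> b = b'.
Proof.
move=> E; apply: (cf_inj wb) => p.
by have [c cE] := lam_represents (wb_lin wb p); rewrite !cE E.
Qed.

Lemma beta_ex c : exists b, forall a, lam (c * a) = lam (a * b).
Proof.
by apply: lam_represents => d a a'; rewrite mulrDr -scalerAr linearP.
Qed.

Definition nakayama_aut c := projT1 (cid (beta_ex c)).
Notation beta := nakayama_aut.

Lemma betaE c a : lam (c * a) = lam (a * beta c).
Proof. exact: (projT2 (cid (beta_ex c))). Qed.

Lemma beta_linear : linear beta.
Proof.
move=> c a b; apply: lam_injr => d.
by rewrite -betaE mulrDl mulrDr -scalerAl -scalerAr !linearP /= (betaE a) (betaE b).
Qed.

Lemma betaM a b : beta (a * b) = beta a * beta b.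
Proof.
by apply: lam_injr => c; rewrite -betaE -mulrA betaE -mulrA betaE mulrA.
Qed.

Lemma beta_e i : beta (e i) = e (nu i).
Proof. by apply: lam_injr => a; rewrite -betaE lam_e. Qed.

Lemma beta0 a : beta a = 0 -> a = 0.
Proof.
by move=> b0; apply: lam_injl => c; rewrite betaE b0 mulr0 mul0r.
Qed.

Lemma cf_arrow a p : (forall d, d != 1%N -> gr d a = 0) -> cf a p != 0 -> len p = 1%N.
Proof.
move=> h; have := cf_gr pres wb (len p) a p; rewrite eqxx => <-.
by case: eqP (h (len p)) => // ? ->; rewrite ?(cf0 wb) ?eqxx.
Qed.

Lemma arrow_word p : len p = 1%N -> exists b : D, [/\ src b = start p, tgt b = endp p & wv p = x b].
Proof.
case: (w p) (wb_walk wb p) => i [|b [|? ?]] //= ; rewrite andbT => /eqP sb _.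
by exists b; split=> //; rewrite -sb -[RHS](xE pres).
Qed.

Lemma x_neq0 b : x b != 0.
Proof.
apply/eqP => xb0; have := dim1 pres wb (src b) (tgt b).
rewrite (bigD1 b)//= (dim0 pres wb) eqxx (dimG pres wb) eq_card0// => p; rewrite !inE.
apply/negP => /and3P[/eqP lp /eqP sp /eqP ep].
have [b' [sb tb E]] := arrow_word lp; have := wv_neq0 wb p.
by rewrite E (arrow_inj (a := b') (b := b)) ?xb0 ?eqxx// ?sb ?tb.
Qed.

(** The form vanishes outside degree [m], so [beta] preserves degrees. *)
Lemma beta_homogeneous b d : d != 1%N -> gr d (beta (x b)) = 0.
Proof.
move=> d1; apply: lam_injr; apply: (words_ext pres (L := F^o)) => [c a a'|c a a'|i s ws].
- by rewrite mulrDl -scalerAl linearP.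
- by rewrite mulrDl -scalerAl linearP.
rewrite mulr0 linear0 -(gr_words pres)// lam_gr; case: eqP => // sd.
have xw : x b * (e i * word x s) = gr (size s).+1 (x b * (e i * word x s)).
  by rewrite (gr_x pres) selE//= eqxx.
rewrite -betaE xw lam_gr; case: eqP => // E; move: d1.
by rewrite -(eqn_add2l (size s)) sd -E addn1 eqxx.
Qed.

(** [beta (x b)] has degree one and runs from [nu (src b)] to [nu (tgt b)], where
    there is at most one arrow. *)
Lemma beta_arrow b : exists b' c, [/\ src b' = nu (src b), tgt b' = nu (tgt b) &
  beta (x b) = c *: x b'].
Proof.
have bx0 : beta (x b) != 0 by apply: contraNneq (x_neq0 b) => /beta0 ->.
have el : e (nu (src b)) * beta (x b) = beta (x b).
  by rewrite -beta_e -betaM (e_arrow pres) eqxx.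
have er : beta (x b) * e (nu (tgt b)) = beta (x b).
  by rewrite -beta_e -betaM (arrow_e pres) eqxx.
have sup p : cf (beta (x b)) p != 0 ->
    [/\ len p = 1%N, start p = nu (src b) & endp p = nu (tgt b)].
  move=> nz; split; first by apply: cf_arrow nz => d; apply: beta_homogeneous.
    by apply/eqP; move: nz; rewrite -el (cf_e pres wb); case: ifP; rewrite ?eqxx.
  by apply/eqP; move: nz; rewrite -er (cf_er pres wb); case: ifP; rewrite ?eqxx.
have [p zp] : exists p, cf (beta (x b)) p != 0.
  apply: contrapT => none; move/eqP: bx0; apply; apply: (cf_inj wb) => p; rewrite (cf0 wb).
  by apply/eqP; apply: contrapT => /negP h; apply: none; exists p.
have [lp sp ep] := sup p zp; have [b' [sb tb E]] := arrow_word lp.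
exists b', (cf (beta (x b)) p); split=> //; rewrite ?sb ?tb//.
rewrite [LHS](wb_span wb) (bigD1 p)//= E big1 ?addr0// => q qp.
have [->|/sup[lq sq eq']] := eqVneq (cf (beta (x b)) q) 0; first by rewrite scale0r.
have [b'' [sb' tb' E']] := arrow_word lq.
have bb : b' = b'' by apply: arrow_inj; [rewrite sb sb' sp sq|rewrite tb tb' ep eq'].
have := wb_id wb p q; rewrite E bb -E' (wb_id wb) eqxx eq_sym (negPf qp) => /eqP.
by rewrite oner_eq0.
Qed.

Let nub b := projT1 (cid (beta_arrow b)).
Let cb b := projT1 (cid (projT2 (cid (beta_arrow b)))).
Let nubP b : [/\ src (nub b) = nu (src b), tgt (nub b) = nu (tgt b) &
  beta (x b) = cb b *: x (nub b)].
Proof. exact: (projT2 (cid (projT2 (cid (beta_arrow b))))). Qed.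
Let src_nub b : src (nub b) = nu (src b). Proof. by case: (nubP b). Qed.
Let tgt_nub b : tgt (nub b) = nu (tgt b). Proof. by case: (nubP b). Qed.
Let beta_x b : beta (x b) = cb b *: x (nub b). Proof. by case: (nubP b). Qed.
Let nub_bar b : nub (bar b) = bar (nub b).
Proof. by apply: arrow_inj; rewrite ?src_bar ?tgt_bar ?src_nub ?tgt_nub ?src_bar ?tgt_bar. Qed.
Let nubK b : nub (nub b) = b.
Proof. by apply: arrow_inj; rewrite ?src_nub ?tgt_nub nuK. Qed.

Section Caps.
Variable i0 : 'I_k.
Let lamw s := lam (word x s).
Let N j v : F := (cheb j i0 v)%:~R.

Let term (j : nat) (b b' : D) (rest : seq D) : F := (b' == bar b)%:R * (eps b * N j (tgt b) * lamw rest).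

(** The sum over the ways to remove two consecutive mutually inverse arrows from
    the middle part [s] of the word [pre ++ s ++ suf]. Each is weighted by an
    entry of the Chebyshev matrix whose index is the position in [s], counted
    from [j]: the entry at [i0] and the vertex where the walk turns back. *)
Fixpoint caps (j : nat) (pre s suf : seq D) : F :=
  if s is b :: s' then
    (if s' is b' :: s'' then term j b b' (pre ++ s'' ++ suf) else 0)
    + caps j.+1 (rcons pre b) s' suf
  else 0.

Let lamw_rel u p1 p2 :
  \sum_(b | src b == u) eps b * lamw (p1 ++ b :: bar b :: p2) = 0.
Proof.
transitivity (lam (word x p1 * (\sum_(b | src b == u) eps b *: (x b * x (bar b))) * word x p2)).
  rewrite mulr_sumr mulr_suml linear_sum; apply: eq_bigr => b _.
  by rewrite /lamw word_cat !word_cons -scalerAr -scalerAl linearZ /= !mulrA.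
by rewrite (rel_at pres) mulr0 mul0r linear0.
Qed.

(** Contractions to the right of an inserted relation leave it in place, so they
    contribute nothing. *)
Let caps_after j u p1 p2 t : \sum_(b | src b == u) eps b * caps j (p1 ++ b :: bar b :: p2) t [::] = 0.
Proof.
elim: t j p2 => [|c t IH] j p2 /=; first by rewrite big1// => b _; rewrite mulr0.
under eq_bigr => b _ do rewrite mulrDr.
rewrite big_split /=; under [X in _ + X]eq_bigr => b _ do rewrite rcons_cat /=.
rewrite IH addr0; case: t IH => [|c' t] _; first by rewrite big1// => b _; rewrite mulr0.
transitivity ((c' == bar c)%:R * (eps c * N j (tgt c)) *
    \sum_(b | src b == u) eps b * lamw (p1 ++ b :: bar b :: (p2 ++ t))); last first.
  by rewrite lamw_rel mulr0.
rewrite mulr_sumr; apply: eq_bigr => b _; rewrite /term cats0 -catA /=; ring.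
Qed.

Let Npred j v : F := if j is j'.+1 then N j' v else 0.

Let N_rec j u : \sum_(b : D | src b == u) N j (tgt b) = N j.+1 u + Npred j u.
Proof.
rewrite /N /Npred -(rmorph_sum (intr : int -> F)) /= -adjacencyr -cheb_comm.
case: j => [|j]; first by rewrite mulmx1 addr0.
by rewrite -intrD chebS !mxE subrK.
Qed.

(** When a relation is inserted into a walk, only the contractions that involve
    its arrows survive. Those of the two arrows with each other give
    the sum over the neighbours of a Chebyshev number, and by the recurrence
    this is cancelled by the contractions with the adjacent arrows, except at
    the two ends of the walk. *)
Let caps_cup j pre s i t : walk i s -> walk (walk_end i s) t ->
  \sum_(b | src b == walk_end i s) eps b * caps j pre (s ++ b :: bar b :: t) [::] =
  (if s is [::] then Npred j (walk_end i s) * lamw (pre ++ t) else 0) +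
  (if t is [::] then N (j + size s).+1 (walk_end i s) * lamw (pre ++ s) else 0).
Proof.
elim: s j pre i => [|a s IH] j pre i.
  move=> _; rewrite /walk_end /= => wt; rewrite addn0.
  under eq_bigr => b _ do rewrite mulrDr.
  rewrite big_split /=.
  have -> : \sum_(b | src b == i) eps b * term j b (bar b) (pre ++ t ++ [::]) =
      N j.+1 i * lamw (pre ++ t) + Npred j i * lamw (pre ++ t).
    rewrite -mulrDl -N_rec mulr_suml; apply: eq_bigr => b _.
    by rewrite /term eqxx cats0 mul1r !mulrA eps_sq mul1r.
  case: t wt => [|c t] wt.
    rewrite cats0 /= [X in _ + X = _]big1 => [|b _]; last by rewrite addr0 mulr0.
    by rewrite addr0 addrC.
  rewrite [caps]lock /= -lock; move: wt; rewrite [walk _ _]/=.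
  case/andP => /eqP sc wt.
  under eq_bigr => b _ do rewrite mulrDr.
  rewrite big_split /=.
  under [X in _ + (_ + X) = _]eq_bigr => b _ do rewrite -cats1 -cats1 -!catA /=.
  rewrite (caps_after _ _ _ [::] (c :: t)) addr0.
  rewrite (bigD1 c) ?sc//= big1 ?addr0 => [|b /andP[_ bc]]; last first.
    by rewrite /term barK eq_sym (negPf bc) mul0r mulr0.
  rewrite /term barK eqxx mul1r tgt_bar sc epsN cats0 cat_rcons.
  rewrite addrAC -[RHS]add0r; congr (_ + _).
  rewrite -[RHS](subrr (N j.+1 i * lamw (pre ++ c :: t))); congr (_ + _).
  by rewrite !mulNr mulrN !mulrA eps_sq mul1r.
rewrite [walk _ _]/= => /andP[/eqP sa ws].
rewrite -[walk_end i (a :: s)]/(walk_end (tgt a) s) => wt.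
under eq_bigr => b _ do rewrite cat_cons /= mulrDr.
rewrite big_split /= IH// addSnnS !cat_rcons add0r addrA.

suff -> : \sum_(b | src b == walk_end (tgt a) s) eps b *
   (match s ++ b :: bar b :: t with [::] => 0 | b' :: s'' => term j a b' (pre ++ s'' ++ [::]) end) +
   (if s is [::] then Npred j.+1 (walk_end (tgt a) s) * lamw (pre ++ a :: t) else 0) = 0.
  by rewrite add0r.
case: s ws wt {IH} => [|c s] /= ws wt.
  rewrite /walk_end /= (bigD1 (bar a)) ?src_bar//= big1 => [|b /andP[_ /negPf ba]]; last first.
    by rewrite /term ba mul0r mulr0.
  rewrite /term eqxx barK epsN cats0 mul1r addr0 !mulNr !mulrA eps_sq mul1r.
  exact: addNr.
rewrite addr0; transitivity ((c == bar a)%:R * (eps a * N j (tgt a)) *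
    \sum_(b | src b == walk_end (tgt a) (c :: s)) eps b * lamw ((pre ++ s) ++ b :: bar b :: t)); last first.
  by rewrite lamw_rel mulr0.
rewrite mulr_sumr; apply: eq_bigr => b _; rewrite /term cats0 -catA; ring.
Qed.

Let capf (i : 'I_k) (s : seq D) : F^o := if size s == m.+2 then caps 0 [::] s [::] else 0.

(** The boundary terms left by [caps_cup] vanish too: at the left end because the
    Chebyshev matrix of index [-1] is zero, at the right end because that of index
    [m.+1] is. So [caps] descends to the algebra, where walks of length [m.+2]
    are zero. *)
Lemma caps0 i s : walk i s -> size s = m.+2 -> caps 0 [::] s [::] = 0.
Proof.
have kr : kills_relation capf.
  move=> j r t wr wt; rewrite /capf.
  under eq_bigr => b _ do rewrite size_cat /= !addnS !eqSS.
  case: eqP => [E|_]; last by rewrite big1// => b _; rewrite scaler0.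
  rewrite [LHS](caps_cup 0 [::] wr wt) add0n.
  case: t wt E => [|? ?] wt E; last by case: r wr wt E => *; rewrite ?mul0r ?addr0.
  move: E; rewrite /= addn0 => ->; rewrite /N cheb_m1 mxE mul0r.
  by case: r {wr wt} => *; rewrite ?mul0r ?addr0.
move=> ws sm; have [f fE] := universal pres kr; have := fE i s ws.
by rewrite /capf sm eqxx => <-; rewrite above0 ?sm ?linear0// ltnW.
Qed.

Lemma caps_rcons j pre s z y suf : caps j pre (rcons (rcons s z) y) suf =
  caps j pre (rcons s z) (y :: suf) + term (j + size s) z y (pre ++ s ++ suf).
Proof.
elim: s j pre => [|a s IH] j pre; first by rewrite /= !addr0 add0r addn0.
rewrite [caps _ _ (rcons (rcons _ _) _) _]/= [caps _ _ (rcons (_ :: _) _) _]/= IH.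
rewrite !addrA cat_rcons /= addSnnS; congr (_ + _ + _).
by case: s {IH} => [|b s] //=; rewrite cat_rcons.
Qed.
End Caps.

Let lamw s := lam (word x s).
Let N i0 j v : F := (cheb j i0 v)%:~R.

Let rotate b t : lamw (b :: t) = cb b * lamw (rcons t (nub b)).
Proof.
rewrite /lamw word_cons betaE beta_x -scalerAr linearZ /=; congr (_ * lam _).
by rewrite -cats1 word_cat word_cons word_nil mulr1.
Qed.

Let N_recl i0 j v : \sum_(b : D | src b == i0) N (tgt b) j.+1 v = N i0 j.+2 v + N i0 j v.
Proof.
rewrite /N -(rmorph_sum (intr : int -> F)) /= -adjacencyl -intrD.
by rewrite chebS [in RHS]mxE [X in (_ + X)%R + _]mxE subrK.
Qed.

(** The form is cyclic up to [beta], so a contraction in the middle of a word may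
    be read off after its first one or two arrows have been moved to the end.
    The three positions are weighted by consecutive Chebyshev matrices, which
    the recurrence in the base point balances. *)
Let telescope i0 j (b : D) pre s :
  caps i0 j.+2 (b :: bar b :: pre) s [::]
  - cb b * (\sum_(b' : D | src b' == i0) caps (tgt b') j.+1 (bar b :: pre) s [:: nub b])
  + cb b * cb (bar b) * caps i0 j pre s [:: nub b; nub (bar b)] = 0.
Proof.
elim: s j pre => [|a s IH] j pre /=; first by rewrite big1// !mulr0 subrr addr0.
rewrite big_split /= mulrDr mulrDr opprD.
have -> (a1 a2 b1 b2 c1 c2 : F) : a1 + a2 + (- b1 - b2) + (c1 + c2) =
   (a1 - b1 + c1) + (a2 - b2 + c2) by ring.
rewrite IH addr0; case: s {IH} => [|a' s]; first by rewrite big1// !mulr0 subrr addr0.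
rewrite !cats0 -/(lamw _).
have r1 : lamw (b :: bar b :: pre ++ s) = cb b * lamw (bar b :: pre ++ s ++ [:: nub b]).
  by rewrite rotate -cats1 /= -catA.
have r2 : lamw (bar b :: pre ++ s ++ [:: nub b]) =
    cb (bar b) * lamw (pre ++ s ++ [:: nub b; nub (bar b)]).
  by rewrite rotate -cats1 -!catA.
rewrite -/lamw in r1 r2 *; rewrite -/(N i0 j.+2 _) -/(N i0 j _).
have -> : \sum_(b' : D | src b' == i0) (a' == bar a)%:R *
    (eps a * (cheb j.+1 (tgt b') (tgt a))%:~R * lam (word x (bar b :: pre ++ s ++ [:: nub b]))) =
   (a' == bar a)%:R * (eps a * (N i0 j.+2 (tgt a) + N i0 j (tgt a)) *
     lamw (bar b :: pre ++ s ++ [:: nub b])).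
  rewrite -N_recl -/(lamw (bar b :: pre ++ s ++ [:: nub b])); move: (lamw _) => L.
  by rewrite mulr_sumr mulr_suml mulr_sumr.
rewrite -/(lamw (b :: _)) -/(lamw (pre ++ _)) r1 r2; ring.
Qed.

Let capsE i0 j pre b1 b2 s suf : caps i0 j pre (b1 :: b2 :: s) suf =
  (b2 == bar b1)%:R * (eps b1 * N i0 j (tgt b1) * lamw (pre ++ s ++ suf)) +
  caps i0 j.+1 (rcons pre b1) (b2 :: s) suf.
Proof. by []. Qed.

Let m_gt0 (b : D) : (0 < m)%N.
Proof.
rewrite lt0n; apply/eqP => m0; have /matrixP/(_ (src b) (tgt b)) := cheb_m1.
rewrite m0 !mxE => /eqP; rewrite eqz_nat => /eqP/card0_eq/(_ b).
by rewrite !inE !eqxx.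
Qed.

Let top_word u : exists t, [/\ walk u t, walk_end u t = nu u, size t = m & lam (e u * word x t) = 1].
Proof.
have /card_gt0P[p] : (0 < #|word_class w m u (nu u)|)%N.
  by rewrite -(dimG pres wb) top_dim nuK eqxx.
rewrite !inE => /and3P[/eqP lp /eqP sp /eqP ep]; have wp := wb_walk wb p.
have L : lam (wv p) = 1.
  rewrite /top_form (bigD1 p) ?lp//= (wb_id wb) eqxx big1 ?addr0// => q.
  by case/andP => _ /negPf qp; rewrite (wb_id wb) eq_sym qp.
by exists (w p).2; rewrite sp in wp ep L.
Qed.

(** The elimination of [k0], [k1] and [k2] in [nakayama_sign]: the hypotheses are
    the three contraction identities used there and [telescope]. *)
Lemma contraction_cancel (R : comPzRingType) (eb ey c c' i1 eb' n1 l1 i2 ez n2 l2 k0 k1 k2 : R) :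
  eb * 1 * 1 + (i1 * (eb' * n1 * (c * l1)) + k0) = 0 ->
  i1 * (eb' * n1 * l1) + (k1 + i2 * (ez * n2 * (c' * l2))) = 0 ->
  k2 + i2 * (ez * n2 * l2) + ey * 1 * 1 = 0 ->
  k0 - c * k1 + c * c' * k2 = 0 -> eb + c * c' * ey = 0.
Proof.
move=> h0 h1 h2 h3.
transitivity ((eb * 1 * 1 + (i1 * (eb' * n1 * (c * l1)) + k0))
  - c * (i1 * (eb' * n1 * l1) + (k1 + i2 * (ez * n2 * (c' * l2))))
  + c * c' * (k2 + i2 * (ez * n2 * l2) + ey * 1 * 1)
  - (k0 - c * k1 + c * c' * k2)); first by ring.
by rewrite h0 h1 h2 h3 !mulr0 subr0 addr0 subr0.
Qed.

(** Let [a :: t] be a walk of the top length from [src b]. The contraction sum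
    vanishes on the walk itself extended by [b] and [bar b] in front, on the one
    where [b] has been rotated to the end, and on the one where both have. In
    the combination of the three that [telescope] annihilates, only the
    contractions of the two extra arrows with each other remain, and they give
    [eps b + cb b * cb (bar b) * eps (nub b) = 0]. *)
Lemma nakayama_sign b : cb b * cb (bar b) = - (eps b * eps (nub b)).
Proof.
have [t [wt et st lt]] := top_word (src b).
have m0 := m_gt0 b.
case: t wt et st lt => [_ _ /esym m00|a t wt et st lt]; first by rewrite m00 in m0.
have sa : src a = src b by case/andP: wt => /eqP.
have {}lt : lamw (a :: t) = 1.
  rewrite -lt /lamw -[X in lam X = _]mul1r -(e_sum pres) mulr_suml linear_sum.
  rewrite (bigD1 (src b))//= big1 ?addr0// => i ib.
  by rewrite (nonwalk0 pres) ?linear0//= negb_and sa eq_sym ib.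
have wend : walk_end (src b) (a :: t) = src (nub b) by rewrite et src_nub.
pose i0 := tgt b.
have w0 : walk (src b) [:: b, bar b, a & t].
  by rewrite [walk _ _]/= src_bar tgt_bar !eqxx.
have w1 : walk (src (bar b)) (bar b :: rcons (a :: t) (nub b)).
  rewrite /= eqxx tgt_bar -cats1 walk_cat sa eqxx /=.
  by move: wt wend; rewrite /= => /andP[_ ->]; rewrite /walk_end /= => ->; rewrite eqxx.
have w2 : walk (src b) (rcons (rcons (a :: t) (nub b)) (nub (bar b))).
  rewrite -!cats1 -catA walk_cat wt wend /= eqxx src_nub.
  by rewrite src_bar tgt_nub eqxx.
have s0 : size [:: b, bar b, a & t] = m.+2 by rewrite -st.
have s1 : size (bar b :: rcons (a :: t) (nub b)) = m.+2 by rewrite -st /= size_rcons.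
have s2 : size (rcons (rcons (a :: t) (nub b)) (nub (bar b))) = m.+2.
  by rewrite -st !size_rcons.
have H0 := caps0 i0 w0 s0.
have H1 i := caps0 i w1 s1.
have H2 := caps0 i0 w2 s2.
have [t0 [z tz]] : exists t0 z, a :: t = rcons t0 z.
  by case/lastP: (a :: t) (st) m0 => [<-//|t0 z _ _]; exists t0, z.
have st0 : (size t0).+1 = m by rewrite -st tz size_rcons.
have tel := telescope i0 0 b [::] (a :: t).
(* The three vanishing sums, with the contractions that involve the moving
   arrows split off. *)
have {}H0 : eps b * N i0 0 (tgt b) * lamw (a :: t) +
    ((a == bar (bar b))%:R * (eps (bar b) * N i0 1 (tgt (bar b)) * lamw (b :: t)) +
     caps i0 2 [:: b; bar b] (a :: t) [::]) = 0.
  by rewrite -[RHS]H0 !capsE eqxx mul1r !cats0.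
pose y := nub b; pose y' := nub (bar b).
have {}H1 i : (a == bar (bar b))%:R * (eps (bar b) * N i 0 (tgt (bar b)) * lamw (rcons t y)) +
    (caps i 1 [:: bar b] (a :: t) [:: y] +
     (y == bar z)%:R * (eps z * N i m (tgt z) * lamw (bar b :: t0))) = 0.
  rewrite -[RHS](H1 i) rcons_cons capsE cats0; congr (_ + _).
  by rewrite -[a :: rcons t _]/(rcons (a :: t) _) tz caps_rcons add1n st0 cats0.
have {}H2 : caps i0 0 [::] (a :: t) [:: y; y'] +
    (y == bar z)%:R * (eps z * N i0 (size t0) (tgt z) * lamw (rcons t0 y')) +
    eps y * N i0 m (tgt y) * lamw (a :: t) = 0.
  rewrite -[RHS]H2 tz caps_rcons caps_rcons /= !add0n size_rcons st0 -cats1 cats0.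
  have yy : (y' == bar y) = true by rewrite /y' nub_bar eqxx.
  by rewrite !cats1 -/y -/y' yy mul1r.
have N0 : \sum_(b' : D | src b' == i0) N (tgt b') 0 (tgt (bar b)) = N i0 1 (tgt (bar b)).
  rewrite /N -(rmorph_sum (intr : int -> F)) /= -adjacencyl; congr (_ _)%:~R.
  by rewrite mulmx1.
have Nm : \sum_(b' : D | src b' == i0) N (tgt b') m (tgt z) = N i0 (size t0) (tgt z).
  by rewrite -st0 N_recl st0 {1}/N cheb_m1 mxE add0r.
have S2 : \sum_(b' : D | src b' == i0) (a == bar (bar b))%:R *
      (eps (bar b) * N (tgt b') 0 (tgt (bar b)) * lamw (rcons t y)) =
   (a == bar (bar b))%:R * (eps (bar b) * N i0 1 (tgt (bar b)) * lamw (rcons t y)).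
  by rewrite -N0; move: (lamw _) => L; rewrite mulr_sumr mulr_suml mulr_sumr.
have S3 : \sum_(b' : D | src b' == i0) (y == bar z)%:R * (eps z * N (tgt b') m (tgt z) * lamw (bar b :: t0)) =
   (y == bar z)%:R * (eps z * N i0 (size t0) (tgt z) * lamw (bar b :: t0)).
  by rewrite -Nm; move: (lamw _) => L; rewrite mulr_sumr mulr_suml mulr_sumr.
have S1 : (a == bar (bar b))%:R * (eps (bar b) * N i0 1 (tgt (bar b)) * lamw (rcons t y)) +
    (\sum_(b' : D | src b' == i0) caps (tgt b') 1 [:: bar b] (a :: t) [:: y] +
     (y == bar z)%:R * (eps z * N i0 (size t0) (tgt z) * lamw (bar b :: t0))) = 0.
  by rewrite -S2 -S3 -!big_split; apply: big1 => b' _; apply: H1.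
rewrite (rotate (bar b)) -/y' in S1.
rewrite (rotate b) lt -/y in H0.
rewrite lt in H2.
have n0 : N i0 0 (tgt b) = 1 by rewrite /N mxE eqxx.
have nm : N i0 m (tgt y) = 1 by rewrite /N cheb_m tgt_nub nuK eqxx.
rewrite n0 in H0; rewrite nm in H2.
have E := contraction_cancel H0 S1 H2 tel.
apply/eqP; rewrite -subr_eq0 opprK; apply/eqP.
by rewrite -[X in X + _]mulr1 -(eps_sq y) mulrA -mulrDl addrC E mul0r.
Qed.

Lemma beta_square_word (xi : 'I_k -> F) : (forall i, xi i != 0) ->
  (forall b, cb b * cb (nub b) = xi (src b) / xi (tgt b)) ->
  forall i s, walk i s ->
    beta (beta (e i * word x s)) = (xi i / xi (walk_end i s)) *: (e i * word x s).
Proof.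
move=> xi0 xiE i s; elim: s i => [|b s IH] i.
  by rewrite word_nil mulr1 !beta_e nuK divff// scale1r.
rewrite [walk _ _]/= => /andP[/eqP <- ws].
have betaZ c a : beta (c *: a) = c *: beta a.
  have := beta_linear c a 0; rewrite !addr0 => ->.
  by have := beta_linear (-1) 0 0; rewrite scaler0 addr0 scaleN1r addNr => ->; rewrite addr0.
rewrite (word_start pres)/= ?eqxx//.
rewrite -[walk_end _ (b :: s)]/(walk_end (tgt b) s).
rewrite (betaM (x b)) (betaM (beta (x b))) (IH _ ws) beta_x betaZ beta_x nubK scalerA xiE.
rewrite -scalerAl -scalerAr scalerA; congr (_ *: _).
by field; rewrite !xi0.
Qed.

(** By [nakayama_sign], the scalars by which the square of [beta] acts on the
    arrows [b] and [bar b] are inverse to each other; on a tree such a family of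
    scalars is a coboundary. *)
Lemma beta_square : (forall h : D -> F, (forall b, h b * h (bar b) = 1) ->
    exists xi : 'I_k -> F, (forall i, xi i != 0) /\ forall b, h b = xi (src b) / xi (tgt b)) ->
  exists xi : 'I_k -> F, (forall i, xi i != 0) /\
    forall i j a, e i * beta (beta a) * e j = (xi i / xi j) *: (e i * a * e j).
Proof.
move=> potential; have [b|xi [xi0 xiE]] := potential (fun b => cb b * cb (nub b)).
  rewrite nub_bar mulrACA nakayama_sign nakayama_sign nubK mulrNN mulrACA.
  by rewrite [eps (nub b) * _]mulrC mulrACA !eps_sq mulr1.
exists xi; split=> // i j; apply: (words_ext pres) => [c a a'|c a a'|l s ws].
- by rewrite !beta_linear mulrDr mulrDl -scalerAr -scalerAl.
- by rewrite mulrDr mulrDl -scalerAr -scalerAl scalerDr !scalerA mulrC.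
rewrite (beta_square_word xi0 xiE ws) -scalerAr -scalerAl (e_word pres)//.
case: eqP => [il|_]; last by rewrite mul0r !scaler0.
rewrite -{}il in ws *; rewrite (word_e pres)//.
by case: (walk_end i s =P j) => [<-|_]; rewrite ?scaler0.
Qed.

(** If [nu] is trivial, then [beta] multiplies [x b * x (bar b)] by [-1], while
    conjugation by an invertible element of the semisimple part fixes it. *)
Lemma beta_not_inner (b0 : D) (zeta : 'I_k -> F) : (forall i, nu i = i) ->
  (2%:R : F) != 0 -> (forall i, zeta i != 0) ->
  ~ (forall i j a, e i * beta a * e j = (zeta i / zeta j) *: (e i * a * e j)).
Proof.
move=> nu1 two0 z0 H.
have nub1 b : nub b = b by apply: arrow_inj; rewrite ?src_nub ?tgt_nub nu1.
have cE b : cb b = zeta (src b) / zeta (tgt b).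
  have := H (src b) (tgt b) (x b).
  rewrite beta_x nub1 -scalerAr -scalerAl (e_arrow pres) eqxx (arrow_e pres) eqxx.
  move/eqP; rewrite -subr_eq0 -scalerBl scaler_eq0 (negPf (x_neq0 b)) orbF subr_eq0.
  by move/eqP.
have := nakayama_sign b0; rewrite nub1 eps_sq !cE src_bar tgt_bar.
rewrite mulrA divfK// divff// => /eqP; rewrite -subr_eq0 opprK.
by rewrite (negPf two0).
Qed.

End Nakayama.

(** * Bimodules over S and the twisted unit *)

Section BimoduleMaps.
Local Open Scope lfun_scope.
Variables (F : fieldType) (k : nat).
Notation S := {ffun 'I_k -> F^o}.
Notation bimod := (bimod F k).
Notation unitB := (unitB F k).

Lemma bimod_homP (M N : bimod) (f : 'Hom(M, N)) :
  (forall s x, f (lact s x) = lact s (f x)) -> (forall s x, f (ract s x) = ract s (f x)) ->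
  bimod_hom f.
Proof. by move=> l r; split=> s; apply/lfunP => x; rewrite !comp_lfunE ?l ?r. Qed.

Lemma homl (M N : bimod) (f : 'Hom(M, N)) s x : bimod_hom f -> f (lact s x) = lact s (f x).
Proof. by case=> /(_ s)/lfunP/(_ x); rewrite !comp_lfunE. Qed.
Lemma homr (M N : bimod) (f : 'Hom(M, N)) s x : bimod_hom f -> f (ract s x) = ract s (f x).
Proof. by case=> _ /(_ s)/lfunP/(_ x); rewrite !comp_lfunE. Qed.

Lemma inv_lfunK (U V : vectType F) (f : 'Hom(U, V)) : lker f == 0%VS ->
  (forall y, exists x, f x = y) -> f \o f^-1 = \1.
Proof.
move=> inj surj; apply/lfunP => y; have [x <-] := surj y.
by rewrite comp_lfunE -(comp_lfunE f^-1) lker0_compVf// !id_lfunE.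
Qed.

Lemma bimod_iso_bij (M N : bimod) (f : 'Hom(M, N)) : bimod_hom f -> lker f == 0%VS ->
  (forall y, exists x, f x = y) -> bimod_iso f /\ bimod_hom f^-1.
Proof.
move=> hf inj surj; have KV := lker0_compVf inj; have VK := inv_lfunK inj surj.
have hV : bimod_hom f^-1.
  apply: bimod_homP => s y; have [x <-] := surj y; rewrite -?(homl s x hf) -?(homr s x hf);
    by rewrite -!(comp_lfunE f^-1) KV !id_lfunE.
by split=> //; split=> //; exists f^-1.
Qed.

Lemma bimod_iso_inj (M N : bimod) (f : 'Hom(M, N)) : bimod_iso f -> lker f == 0%VS.
Proof.
case=> _ [g [_ gf _]]; apply/lker0P => x y fxy.
by rewrite -[x](id_lfunE _) -[y](id_lfunE _) -gf !comp_lfunE fxy.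
Qed.

Lemma pure_lact_l (M N : bimod) s (x : M) (y : N) :
  pure (lact s x) y = @lact _ _ (tens M N) s (pure x y).
Proof. by rewrite /= tens_lact_pure. Qed.
Lemma pure_ract_r (M N : bimod) s (x : M) (y : N) :
  pure x (ract s y) = @ract _ _ (tens M N) s (pure x y).
Proof. by rewrite /= tens_ract_pure. Qed.
Lemma pure_mid (M N : bimod) s (x : M) (y : N) :
  pure (ract s x) y = pure x (lact s y).
Proof. by rewrite (pure_balanced M N).2. Qed.

Lemma lunit_hom (M : bimod) : bimod_hom (lunit M).
Proof.
apply: bimod_hom_lift; first exact: lunit_balanced.
  by move=> s t x; rewrite /= unit_actE lact_mul.
by move=> s t x; rewrite lract.
Qed.

Lemma runitV_hom (M : bimod) : bimod_hom (runitV M).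
Proof.
apply: bimod_homP => s x; rewrite !runitVE /= ?tens_lact_pure ?tens_ract_pure//.
by rewrite (pure_balanced M unitB).2 /=; congr pure; rewrite !unit_actE mulr1.
Qed.

Lemma tensm_hom (M N M' N' : bimod) (f : 'Hom(M, M')) (g : 'Hom(N, N')) :
  bimod_hom f -> bimod_hom g -> bimod_hom (tensm f g).
Proof.
move=> hf hg; split=> s; apply: tens_ext => x y; rewrite !comp_lfunE.
  rewrite -pure_lact_l tensm_pure// (homl _ _ hf) pure_lact_l.
  by congr (lact s _); rewrite [RHS]tensm_pure.
rewrite -pure_ract_r tensm_pure// (homr _ _ hg) pure_ract_r.
by congr (ract s _); rewrite [RHS]tensm_pure.
Qed.

Lemma tens_ext_l (M N P : bimod) (V : vectType F) (f g : 'Hom(tens (tens M N) P, V)) :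
  (forall x y p, f (pure (pure x y : tens M N) p) = g (pure (pure x y : tens M N) p)) -> f = g.
Proof.
move=> fg; apply: tens_ext => z p.
have pl := (pure_bilinear (tens M N) P).2 p.
pose r (h : 'Hom(tens (tens M N) P, V)) : 'Hom(tens M N, V) := linfun (fun z => h (pure z p)).
have rE h y : r h y = h (pure y p).
  by rewrite linfun_linear// => c a b; rewrite pl linearP.
by rewrite -!rE; congr (fun_of_lfun _ z); apply: tens_ext => x y; rewrite !rE.
Qed.

Lemma tens_ext_r (M N P : bimod) (V : vectType F) (f g : 'Hom(tens M (tens N P), V)) :
  (forall x y p, f (pure x (pure y p : tens N P)) = g (pure x (pure y p : tens N P))) -> f = g.
Proof.
move=> fg; apply: tens_ext => x z.
have pr := (pure_bilinear M (tens N P)).1 x.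
pose r (h : 'Hom(tens M (tens N P), V)) : 'Hom(tens N P, V) := linfun (fun z => h (pure x z)).
have rE h y : r h y = h (pure x y).
  by rewrite linfun_linear// => c a b; rewrite pr linearP.
by rewrite -!rE; congr (fun_of_lfun _ z); apply: tens_ext => y p; rewrite !rE.
Qed.

Lemma assoc_hom (M N P : bimod) : bimod_hom (assoc M N P).
Proof.
split=> s; apply: tens_ext_l => x y p; rewrite !comp_lfunE.
  by rewrite -!pure_lact_l !assoc_pure -pure_lact_l.
by rewrite -!pure_ract_r !assoc_pure -!pure_ract_r.
Qed.

Lemma assocV_hom (M N P : bimod) : bimod_hom (assocV M N P).
Proof.
split=> s; apply: tens_ext_r => x y p; rewrite !comp_lfunE.
  by rewrite -!pure_lact_l !assocV_pure -!pure_lact_l.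
by rewrite -!pure_ract_r !assocV_pure -pure_ract_r.
Qed.

Lemma eval_balanced (M N : bimod) (x : N) :
  balanced (fun (y : M) (f : ldual N) => ract (dapp f x) y).
Proof.
split; first split=> [y c f g|f c y y'].
- by rewrite val_dualP ract_linear1.
- by rewrite linearP.
- by move=> s y f; rewrite lact_dualE ract_mul.
Qed.

End BimoduleMaps.

Section TwistedUnit.
Local Open Scope lfun_scope.
Variables (F : fieldType) (k : nat) (nu : 'I_k -> 'I_k).
Hypothesis nuK : involutive nu.
Notation S := {ffun 'I_k -> F^o}.
Notation unitB := (unitB F k).

Definition permute (s : S) : S := [ffun j => s (nu j)].
Notation tw := permute.

Lemma tw_linear : linear tw.
Proof. by move=> c s t; apply/ffunP => j; rewrite !ffunE. Qed.
Lemma twM s t : tw (s * t) = tw s * tw t.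
Proof. by apply/ffunP => j; rewrite !ffunE. Qed.
Lemma tw1 : tw 1 = 1.
Proof. by apply/ffunP => j; rewrite !ffunE. Qed.
Lemma twK : involutive tw.
Proof. by move=> s; apply/ffunP => j; rewrite !ffunE nuK. Qed.
Lemma tw_idem i : tw (idem F i) = idem F (nu i).
Proof. by apply/ffunP => j; rewrite !ffunE (can2_eq nuK nuK). Qed.

Definition tw_act (s : S) : 'End(S) := unit_act (tw s).
Fact tw_act_linear : linear tw_act.
Proof. by move=> c s t; rewrite /tw_act tw_linear unit_act_linear. Qed.
Fact tw_act1 : tw_act 1 = \1.
Proof. by rewrite /tw_act tw1 unit_act1. Qed.
Fact tw_actM s t : tw_act (s * t) = tw_act s \o tw_act t.
Proof. by rewrite /tw_act twM unit_actM. Qed.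
Fact tw_actC s t : tw_act s \o unit_act t = unit_act t \o tw_act s.
Proof. exact: unit_actC. Qed.

(** The left action is twisted because [lam (e i * a) = lam (a * e (nu i))], so
    that [lam] induces a bimodule map to this bimodule and not to [S] itself. *)
Definition twisted : bimod F k :=
  @Bimod F k S tw_act (@unit_act F k) tw_act_linear (@unit_act_linear F k) tw_act1 (@unit_act1 F k)
    tw_actM (@unit_actMr F k) tw_actC.
Notation W := twisted.

Lemma lactW s (x : W) : lact s x = (tw s * (x : S) : S).
Proof. exact: unit_actE. Qed.
Lemma ractW s (x : W) : ract s x = (s * (x : S) : S).
Proof. exact: unit_actE. Qed.

Notation V := (ldual W).
(** The identity of [S], which generates the dual of [twisted] from either side. *)
Definition dual_generator : V := mk_dual (id : W -> S).
Notation gen := dual_generator.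
Notation oneW := (1 : S).

Lemma genE x : dapp gen x = x.
Proof. by apply: mk_dualE => // s y; rewrite ractW ffun_mulC. Qed.

Lemma dualW (f : V) : f = lact (dapp f (oneW : W)) gen.
Proof.
apply: dual_ext => x; rewrite lact_dualE genE.
have -> : dapp f x = dapp f (ract (x : S) (oneW : W)) by rewrite ractW mulr1.
exact: dual_ract.
Qed.

Lemma ract_gen s : ract s gen = lact (tw s) gen.
Proof. by apply: dual_ext => x; rewrite ract_dualE lact_dualE !genE lactW. Qed.

Lemma lactW1 (x : W) : x = lact (tw x) (oneW : W).
Proof. by rewrite lactW twK mulr1. Qed.

Lemma twisted_invertible : invertible_obj W.
Proof.
have evK : forall z, z = lact (ev W z : S) (pure gen (oneW : W) : tens V W).
  suff E : \1 = linfun (fun z => lact (ev W z : S) (pure gen (oneW : W) : tens V W)) :> 'End(tens V W).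
    move=> z; rewrite -[LHS](id_lfunE z) E linfun_linear// => c a b.
    by rewrite linearP lact_linear1.
  apply: tens_ext => f x; rewrite id_lfunE linfun_linear; last first.
    by move=> c a b; rewrite linearP lact_linear1.
  rewrite ev_pure -pure_lact_l [in LHS](lactW1 x) -pure_mid; congr pure.
  rewrite [in LHS](dualW f) -lract ract_gen twK -lact_mul; congr (lact _ _).
  have -> : dapp f x = dapp f (ract (x : S) (oneW : W)) by rewrite ractW mulr1.
  by rewrite dual_ract.
split.
  have [] // := bimod_iso_bij (ev_hom W).
    apply/lker0P => z t zt; by rewrite (evK z) (evK t) zt.
  move=> s; exists (lact (s : S) (pure gen (oneW : W) : tens V W)).
  by rewrite (homl _ _ (ev_hom W)) ev_pure genE /= unit_actE mulr1.
have co1 : coev1 W = pure (oneW : W) gen.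
  rewrite [X in pure _ X]dual_basis_dual /coev1.
  rewrite (linear_sum_of ((pure_bilinear W V).1 _)); apply: eq_bigr => a _.
  rewrite (linear_sum_of ((pure_bilinear W V).1 _)); apply: eq_bigr => j _.
  by rewrite -pure_mid genE; congr pure; rewrite [RHS]ractW mulr1.
have cE s : coev W s = lact (s : S) (pure (oneW : W) gen : tens W V).
  by rewrite coevE co1.
have [] // := bimod_iso_bij (coev_hom W).
  pose th : 'Hom(tens W V, W) := tens_lift (fun (x : W) (f : V) => ract (dapp f (oneW : W)) x).
  have bal := eval_balanced W (oneW : W).
  apply/lker0P => s t; rewrite !cE => /(congr1 th).
  rewrite -!pure_lact_l !tens_lift_pure// genE !ractW !mulr1 !mul1r.
  exact: (can_inj twK).
move=> z; exists (tw (tens_lift (fun (x : W) (f : V) => ract (dapp f (oneW : W)) x) z)).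
have bal := eval_balanced W (oneW : W).
rewrite cE.
pose r : 'End(tens W V) := linfun (fun z =>
  lact (tw (tens_lift (fun (x : W) (f : V) => ract (dapp f (oneW : W)) x) z))
       (pure (oneW : W) gen : tens W V)).
have rE y : r y = lact (tw (tens_lift (fun (x : W) (f : V) => ract (dapp f (oneW : W)) x) y))
       (pure (oneW : W) gen : tens W V).
  by rewrite linfun_linear// => c a b; rewrite linearP tw_linear lact_linear1.
rewrite -rE -[RHS](id_lfunE z); congr (fun_of_lfun _ z); apply: tens_ext => x f.
rewrite rE tens_lift_pure// id_lfunE -pure_lact_l -lactW1 pure_mid.
by rewrite -dualW.
Qed.

Lemma tens_gen_r (M : bimod F k) (y : tens M V) : exists x, y = pure x gen.
Proof.
have bal := eval_balanced M (oneW : W).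
pose t : 'Hom(tens M V, M) := tens_lift (fun (x : M) (f : V) => ract (dapp f (oneW : W)) x).
pose r : 'End(tens M V) := linfun (fun z => pure (t z) gen).
have rE z : r z = pure (t z) gen.
  by rewrite linfun_linear// => c a b; rewrite linearP (pure_bilinear M V).2.
exists (t y); rewrite -rE -[LHS](id_lfunE y); congr (fun_of_lfun _ y); apply: tens_ext => x f.
by rewrite rE id_lfunE /t tens_lift_pure// pure_mid -dualW.
Qed.

Lemma tens_gen_l (M : bimod F k) (y : tens V M) : exists x, y = pure gen x.
Proof.
have bal : balanced (fun (f : V) (x : M) => lact (tw (dapp f (oneW : W))) x).
  split; first split=> [f c x x'|x c f g].
  - by rewrite linearP.
  - by rewrite val_dualP tw_linear lact_linear1.
  move=> s f x; rewrite ract_dualE -lact_mul; congr (lact _ x).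
  have -> : lact s (oneW : W) = ract (tw s) (oneW : W) by rewrite [LHS]lactW [RHS]ractW.
  by rewrite dual_ract twM twK.
pose t : 'Hom(tens V M, M) := tens_lift (fun (f : V) (x : M) => lact (tw (dapp f (oneW : W))) x).
pose r : 'End(tens V M) := linfun (fun z => pure gen (t z)).
have rE z : r z = pure gen (t z).
  by rewrite linfun_linear// => c a b; rewrite linearP (pure_bilinear V M).1.
exists (t y); rewrite -rE -[LHS](id_lfunE y); congr (fun_of_lfun _ y); apply: tens_ext => f x.
by rewrite rE id_lfunE /t tens_lift_pure// -pure_mid ract_gen twK -dualW.
Qed.

End TwistedUnit.

(** * Frobenius structures from linear forms *)

Section FrobeniusForm.
Local Open Scope lfun_scope.
Variables (F : fieldType) (k : nat).
Notation S := {ffun 'I_k -> F^o}.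
Notation bimod := (bimod F k).
Notation unitB := (unitB F k).
Variables (U : vectType F) (mu : U -> U -> U) (one : U) (e : 'I_k -> U).
Hypotheses (mu_bilinear : bilinear_map mu) (muA : associative mu).
Hypotheses (mu1l : left_id one mu) (mu1r : right_id one mu).
Hypothesis e_mul : forall i j, mu (e i) (e j) = if i == j then e i else 0.
Hypothesis e_sum : \sum_i e i = one.
Notation A := (alg_obj mu_bilinear muA mu1l mu1r e_mul e_sum).
Notation se := (sembed e).

Variables (nu : 'I_k -> 'I_k) (lam : U -> F) (beta : U -> U).
Hypothesis nuK : involutive nu.
Hypothesis lam_lin : scalar lam.
Hypothesis lam_e : forall i a, lam (mu (e i) a) = lam (mu a (e (nu i))).
Hypothesis ndr : forall b, (forall a, lam (mu a b) = 0) -> b = 0.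
Hypothesis ndl : forall b, (forall a, lam (mu b a) = 0) -> b = 0.
Hypothesis betaE : forall c a, lam (mu c a) = lam (mu a (beta c)).
Hypothesis beta_linear : linear beta.
Hypothesis betaM : forall a b, beta (mu a b) = mu (beta a) (beta b).
Hypothesis beta_e : forall i, beta (e i) = e (nu i).

Notation W := (twisted F nu).
Notation V := (ldual W).
Notation tw := (permute nu).

Let mur x : linear (mu x) := mu_bilinear.1 x.
Let mul_ y : linear (mu^~ y) := mu_bilinear.2 y.
Let lamF : U -> F^o := lam.
Let lamF_lin : linear lamF. Proof. exact: lam_lin. Qed.

Let lam0 : lam 0 = 0.
Proof. by have := lam_lin (-1) 0 0; rewrite scaler0 addr0 mulN1r addNr. Qed.
Let lamZ c y : lam (c *: y) = c * lam y.
Proof. by have := lam_lin c y 0; rewrite lam0 !addr0. Qed.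

Let sum_of (X Y : lmodType F) (f : X -> Y) (lf : linear f) (I : finType) (h : I -> X) :
  f (\sum_i h i) = \sum_i f (h i) := linear_sum_of lf h.

Let se_nu s : se (tw s) = \sum_i (s i : F) *: e (nu i).
Proof.
rewrite /sembed (reindex_inj (inv_inj nuK)) /=.
by apply: eq_bigr => i _; rewrite ffunE nuK.
Qed.

Let lam_se s a : lam (mu (se s) a) = lam (mu a (se (tw s))).
Proof.
rewrite se_nu -![lam _]/(lamF _) /sembed (sum_of (mul_ a)) (sum_of (mur a)).
rewrite !(sum_of lamF_lin); apply: eq_bigr => i _.
by rewrite (muZl mu_bilinear) (muZr mu_bilinear) /lamF !lamZ lam_e.
Qed.

Let beta_se s : beta (se s) = se (tw s).
Proof.
rewrite se_nu /sembed (sum_of beta_linear); apply: eq_bigr => i _.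
have b0 : beta 0 = 0.
  by have := beta_linear (-1) 0 0; rewrite scaler0 addr0 scaleN1r addNr.
by have := beta_linear (s i) (e i) 0; rewrite !addr0 b0 addr0 beta_e.
Qed.

Let lactA s (a : A) : lact s a = mu (se s) a.
Proof. exact: alg_lactE. Qed.
Let ractA s (a : A) : ract s a = mu a (se s).
Proof. exact: alg_ractE. Qed.

Let se_idem i : se (idem F i) = e i.
Proof.
rewrite /sembed (bigD1 i)//= ffunE eqxx scale1r big1 ?addr0// => j.
by rewrite ffunE eq_sym => /negPf ->; rewrite scale0r.
Qed.

Definition form_map : A -> W := fun x => [ffun j => lam (mu x (e j))] : S.
Let form_linear : linear form_map.
Proof.
move=> c a b; apply/ffunP => j; rewrite !ffunE mul_ -[lam _]/(lamF _).
exact: lamF_lin.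
Qed.

(** The [S]-valued form whose coordinates add up to [lam]; it is a bimodule map
    once the left action on the target is twisted by [nu]. *)
Definition twisted_form : 'Hom(A, W) := linfun form_map.
Notation form := twisted_form.

Lemma formE a j : (form a : S) j = lam (mu a (e j)).
Proof. by rewrite linfun_linear ?ffunE. Qed.

Lemma form_hom : bimod_hom form.
Proof.
apply: bimod_homP => s a; apply/ffunP => j; rewrite formE ?lactW ?ractW ffunE formE.
  rewrite ffunE lactA -muA lam_se -muA -se_idem -(sembedM mu_bilinear e_mul).
  rewrite idem_mulr ffunE [sembed e _](_ : _ = s (nu j) *: e j); last first.
    by rewrite -se_idem /sembed scaler_sumr; apply: eq_bigr => i _; rewrite ffunE scalerA.
  by rewrite (muZr mu_bilinear) se_idem lamZ.
rewrite ractA -muA -se_idem -(sembedM mu_bilinear e_mul) ffun_mulC idem_mulr.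
rewrite [sembed e _](_ : _ = s j *: e j); last first.
  by rewrite -se_idem /sembed scaler_sumr; apply: eq_bigr => i _; rewrite ffunE scalerA.
by rewrite (muZr mu_bilinear) se_idem lamZ.
Qed.

Lemma form_ract a s : (form (mu a (se s)) : S) = s * form a.
Proof. by rewrite -ractA (homr _ _ form_hom) ractW. Qed.

(** The value at [x] of the right-linear map that corresponds to an element of
    the tensor product of [W] and the dual of [A]. *)
Let theta (x : A) : 'Hom(tens W (ldual A), W) :=
  tens_lift (fun (w : W) (f : ldual A) => ract (dapp f x) w).
Let theta_pure x w f : theta x (pure w f) = ract (dapp f x) w.
Proof. exact/tens_lift_pure/eval_balanced. Qed.

Let frob_formE a b : frob_form (A := A) form (pure a b) = form (mu a b).
Proof. by rewrite comp_lfunE [amul A _]alg_mul_pure. Qed.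

Let frob_form_hom : bimod_hom (frob_form (A := A) form).
Proof. by apply: bimod_hom_comp; [exact: form_hom|exact: amul_hom]. Qed.

(** The inverse of [theta], written with the coevaluation. *)
Let rebuild (h : A -> W) : tens W (ldual A) :=
  \sum_(a < \dim {:A}) \sum_(j < k) pure (h (dbv (M := A) a j)) (coev_form (M := A) a j).

Lemma frob_mapE a : frob_map (A := A) form a = rebuild (fun x => form (mu a x)).
Proof.
rewrite /frob_map !comp_lfunE runitVE tensm_pure; [|exact: bimod_hom1|exact: coev_hom].
rewrite id_lfunE coevE (@lact_one _ _ (tens A (ldual A))) /coev1.
have [pr _] := pure_bilinear A (tens A (ldual A)).
rewrite (sum_of (pr a)) !linear_sum; apply: eq_bigr => b _.
rewrite (sum_of (pr a)) !linear_sum; apply: eq_bigr => j _ /=.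
rewrite assocV_pure tensm_pure; [|exact: frob_form_hom|exact: bimod_hom1].
by rewrite id_lfunE frob_formE.
Qed.

Let rebuild_theta z : rebuild (fun x => theta x z) = z.
Proof.
pose r : 'End(tens W (ldual A)) := linfun (fun z => rebuild (fun x => theta x z)).
have rE y : r y = rebuild (fun x => theta x y).
  rewrite linfun_linear// => c y1 y2; rewrite /rebuild scaler_sumr -big_split.
  apply: eq_bigr => b _; rewrite scaler_sumr -big_split; apply: eq_bigr => j _ /=.
  by rewrite linearP (pure_bilinear W (ldual A)).2.
rewrite -rE -[RHS](id_lfunE z); congr (fun_of_lfun _ z); apply: tens_ext => w f.
rewrite rE id_lfunE [X in _ = pure _ X]dual_basis_dual /rebuild.
rewrite (sum_of ((pure_bilinear W (ldual A)).1 w)); apply: eq_bigr => b _.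
rewrite (sum_of ((pure_bilinear W (ldual A)).1 w)); apply: eq_bigr => j _.
by rewrite theta_pure pure_mid.
Qed.

Let theta_ract x s z : theta (ract s x) z = ract s (theta x z).
Proof.
rewrite -!comp_lfunE; congr (fun_of_lfun _ z); apply: tens_ext => w f.
by rewrite comp_lfunE !theta_pure dual_ract ract_mul.
Qed.

Let theta_lact x s z : theta x (lact s z) = lact s (theta x z).
Proof.
rewrite -!comp_lfunE; congr (fun_of_lfun _ z); apply: tens_ext => w f.
by rewrite !comp_lfunE -pure_lact_l !theta_pure lract.
Qed.

Let theta_ractr x s z : theta x (ract s z) = theta (lact s x) z.
Proof.
rewrite -!comp_lfunE; congr (fun_of_lfun _ z); apply: tens_ext => w f.
by rewrite !comp_lfunE -pure_ract_r !theta_pure ract_dualE.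
Qed.

(** In terms of right-linear maps from [A] to [W], the Frobenius map is
    [a |-> (x |-> form (mu a x))]. *)
Let theta_frob x a : theta x (frob_map (A := A) form a) = form (mu a x).
Proof.
rewrite frob_mapE /rebuild linear_sum [in RHS](dual_basis (M := A) x).
rewrite (sum_of (mur a)) linear_sum; apply: eq_bigr => b _.
rewrite linear_sum (sum_of (mur a)) linear_sum; apply: eq_bigr => j _ /=.
by rewrite theta_pure ractA muA form_ract ractW.
Qed.

Let theta_inj y z : (forall x, theta x y = theta x z) -> y = z.
Proof.
move=> E; rewrite -(rebuild_theta y) -(rebuild_theta z) /rebuild.
by apply: eq_bigr => b _; apply: eq_bigr => j _; rewrite E.
Qed.

Let form_sum a : \sum_j (form a : S) j = lam a.
Proof.
have aE : a = \sum_j mu a (e j) by rewrite -(sum_of (mur a)) e_sum mu1r.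
rewrite -[RHS]/(lamF _) [in RHS]aE (sum_of lamF_lin).
by apply: eq_bigr => j _; rewrite formE.
Qed.

Let tr_linear (X : lmodType F) (f : X -> S) : linear f -> scalar (fun x => \sum_j (f x) j : F).
Proof.
move=> lf c a b; rewrite lf mulr_sumr -big_split; apply: eq_bigr => j _.
by rewrite !ffunE.
Qed.

(** A right-linear map into [S] is recovered from the sum of its coordinates. *)
Let coord_form (f : A -> S) : (forall s x, f (ract s x) = f x * s) ->
  forall x j, f x j = \sum_l f (mu x (e j)) l.
Proof.
move=> fs x j; rewrite -se_idem -ractA fs (bigD1 j)//= big1 ?addr0 => [|l lj].
  by rewrite !ffunE eqxx [RHS]mulr1.
by rewrite !ffunE eq_sym (negPf lj) [LHS]mulr0.
Qed.

Let lam_reprl (f : U -> F) : scalar f -> exists b, forall a, f a = lam (mu b a).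
Proof.
apply: (pairing_represents (B := fun a b => lam (mu b a))) => [b|a|b] //.
- by move=> c a a'; rewrite mur; apply: lam_lin.
- by move=> c b b'; rewrite mul_; apply: lam_lin.
- exact: ndl.
Qed.
Let lam_reprr (f : U -> F) : scalar f -> exists b, forall a, f a = lam (mu a b).
Proof.
apply: (pairing_represents (B := fun a b => lam (mu a b))) => [b|a|b] //.
- by move=> c a a'; rewrite mul_; apply: lam_lin.
- by move=> c b b'; rewrite mur; apply: lam_lin.
- exact: ndr.
Qed.

(** By [theta_frob] bijectivity of the Frobenius map is the statement that each
    functional on [A] has the form [lam (mu a _)] for a unique [a]. *)
Lemma form_frobenius : frobenius_structure (A := A) form.
Proof.
have hom : bimod_hom (frob_map (A := A) form).
  apply: bimod_homP => s a; apply: theta_inj => x.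
    rewrite (theta_lact x) (theta_frob x (lact s a)) (theta_frob x a).
    by rewrite lactA -muA -lactA (homl _ _ form_hom).
  rewrite (theta_ractr x) (theta_frob x (ract s a)) (theta_frob _ a).
  by rewrite ractA lactA muA.
split; first exact: form_hom.
have [] // := bimod_iso_bij hom.
  rewrite -subv0; apply/subvP => a; rewrite memv_ker memv0 => /eqP a0.
  apply/eqP/ndl => x; rewrite -form_sum -theta_frob a0.
  by rewrite big1// => j _; rewrite linear0 ffunE.
move=> z.
have [a aE] : exists a, forall x, \sum_j (theta x z : S) j = lam (mu a x).
  apply: lam_reprl; apply: tr_linear => c x y.
  rewrite -scale_lfunE -add_lfunE; congr (fun_of_lfun _ z); apply: tens_ext => w f.
  rewrite add_lfunE scale_lfunE !theta_pure linearP.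
  by rewrite ract_linear add_lfunE scale_lfunE.
exists a; apply: theta_inj => x; rewrite theta_frob; apply/ffunP => j.
rewrite formE -muA -aE [RHS](coord_form (f := fun x => theta x z : S))// => s y.
by rewrite theta_ract ractW ffun_mulC.
Qed.

Let frob_hom : bimod_hom (frob_map (A := A) form) := form_frobenius.2.1.

Let slice (x : A) : ldual A := mk_dual (fun y : A => form (mu x y) : S).
Let sliceE x y : dapp (slice x) y = form (mu x y).
Proof.
apply: mk_dualE => [c a b|s a]; first by rewrite mur linearP.
by rewrite ractA muA form_ract ffun_mulC.
Qed.

Let frob_slice x : frob_map (A := A) form x =
  \sum_(a < \dim {:A}) \sum_(j < k) pure (dapp (slice x) (dbv (M := A) a j)) (coev_form (M := A) a j).
Proof.
by rewrite frob_mapE /rebuild; apply: eq_bigr => a _; apply: eq_bigr => j _; rewrite sliceE.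
Qed.

Lemma dual_tens_pure (M N : bimod) (g : ldual N) (f : ldual M) z :
  dapp (dual_tens M N (pure g f)) z = tens_lift (fun x y => dapp g (lact (dapp f x) y) : unitB) z.
Proof.
rewrite /dual_tens tens_lift_pure ?mk_dual_tensE//.
have eqlift (f1 f2 : 'Hom(tens M N, unitB)) : f1 = f2 -> f1 =1 f2 by move=> ->.
split; first split=> [g' c f1 f2|f' c g1 g2]; last move=> s g' f'.
- apply: dual_ext => y; rewrite val_dualP !mk_dual_tensE -scale_lfunE -add_lfunE; apply: eqlift.
  apply: tens_ext => a b; rewrite add_lfunE scale_lfunE !tens_lift_pure; try exact: dual_tens_balanced1.
  by rewrite val_dualP lact_linear1 linearP.
- apply: dual_ext => y; rewrite val_dualP !mk_dual_tensE -scale_lfunE -add_lfunE; apply: eqlift.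
  apply: tens_ext => a b; rewrite add_lfunE scale_lfunE !tens_lift_pure; try exact: dual_tens_balanced1.
  exact: val_dualP.
apply: dual_ext => y; rewrite !mk_dual_tensE; apply: eqlift.
apply: tens_ext => a b; rewrite !tens_lift_pure; try exact: dual_tens_balanced1.
by rewrite ract_dualE lact_dualE lact_mul.
Qed.

Notation gen := (dual_generator F nu).
Notation DDA := (ldual (ldual A)).
Notation Phi := (frob_map_dual (A := A) form).

(** After the identification of [A] with its double dual, the dual of the
    Frobenius map is [z |-> lam (mu _ z)], the mirror image of [theta_frob]. The
    comparison of the two is the automorphism [beta]. *)
Lemma PhiE z x i : (dapp (Phi (pure (pivot A z) gen)) x : S) i = lam (mu (mu x (e i)) z).
Proof.
rewrite /frob_map_dual comp_lfunE dualmE; last exact: frob_hom.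
rewrite dual_tens_pure frob_slice.
have -> : tens_lift (fun (w : W) (y : ldual A) => dapp (pivot A z) (lact (dapp gen w) y) : unitB)
    (\sum_(a < \dim {:A}) \sum_(j < k) pure (dapp (slice x) (dbv (M := A) a j)) (coev_form (M := A) a j)) =
  dapp (pivot A z) (slice x).
  rewrite linear_sum [in RHS](dual_basis_dual (slice x)) linear_sum; apply: eq_bigr => a _.
  rewrite linear_sum [in RHS]linear_sum; apply: eq_bigr => j _ /=.
  rewrite tens_lift_pure; last exact: dual_tens_balanced1.
  by rewrite genE.
by rewrite pivotE sliceE form_sum lactA se_idem muA.
Qed.

Let piv_surj (p : DDA) : exists z, pivot A z = p := pivot_surj p.

Let DDV_gen (y : tens DDA V) : exists z, y = pure (pivot A z) gen.
Proof. by have [p ->] := tens_gen_r y; have [z <-] := piv_surj p; exists z. Qed.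

Let Phi_inj : lker Phi == 0%VS.
Proof.
rewrite -subv0; apply/subvP => y; have [z ->] := DDV_gen y.
rewrite memv_ker => /eqP E; suff -> : z = 0.
  have := (pure_bilinear DDA V).2 gen (-1) 0 0.
  by rewrite scaler0 addr0 scaleN1r addNr linear0 => ->; rewrite mem0v.
apply: ndr => x; have -> : x = \sum_i mu x (e i) by rewrite -(sum_of (mur x)) e_sum mu1r.
rewrite (sum_of (mul_ z)) -[lam _]/(lamF _) (sum_of lamF_lin) big1// => i _.
by rewrite -[lamF _]/(lam _) -PhiE E /dapp linear0 zero_lfunE ffunE.
Qed.

Let Phi_surj (h : ldual A) : exists y, Phi y = h.
Proof.
have [z zE] : exists z, forall x, \sum_i (dapp h x : S) i = lam (mu x z).
  by apply: lam_reprr; apply: tr_linear => c x y; rewrite linearP.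
exists (pure (pivot A z) gen); apply: dual_ext => x; apply/ffunP => i.
rewrite PhiE -zE [RHS](coord_form (f := dapp h))// => s y.
exact: dual_ract.
Qed.

Let Phi_hom : bimod_hom Phi.
Proof.
apply: bimod_homP => s y; have [z ->] := DDV_gen y; apply: dual_ext => x; apply/ffunP => i.
  rewrite -pure_lact_l -(homl _ _ (pivot_hom A)) PhiE lact_dualE ffunE PhiE lactA.
  rewrite -!muA (muA (e i)) -se_idem -(sembedM mu_bilinear e_mul) idem_mulr.
  rewrite [sembed e _](_ : _ = s i *: e i); last first.
    by rewrite -se_idem /sembed scaler_sumr; apply: eq_bigr => j _; rewrite ffunE scalerA.
  by rewrite (muZl mu_bilinear) (muZr mu_bilinear) lamZ se_idem.
rewrite -pure_ract_r ract_gen -pure_mid -(homr _ _ (pivot_hom A)) PhiE ract_dualE PhiE.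
by rewrite ractA lactA -(muA (se s)) -(muA (se s)) lam_se muA.
Qed.

Let PhiV_hom : bimod_hom Phi^-1 := (bimod_iso_bij Phi_hom Phi_inj Phi_surj).2.
Let pivV_hom : bimod_hom (pivot A)^-1 := (bimod_iso_bij (pivot_hom A) (pivot_inj A) (@pivot_surj _ _ A)).2.

Notation alpha := (nakayama (A := A) form).

Lemma nakayamaE a : alpha (pure gen a) = pure (beta a : A) gen.
Proof.
have h1 (M : bimod) := bimod_hom1 M.
rewrite /nakayama !comp_lfunE tensm_pure//.
rewrite id_lfunE frob_slice.
have [pr _] := pure_bilinear V (tens W (ldual A)).
transitivity (tensm (pivot A)^-1 \1 (Phi^-1 (slice a))).
  congr (fun_of_lfun _ _); rewrite [in RHS](dual_basis_dual (slice a)).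
  rewrite (sum_of (pr gen)) !linear_sum; apply: eq_bigr => b _.
  rewrite (sum_of (pr gen)) !linear_sum; apply: eq_bigr => j _ /=.
  rewrite assocV_pure tensm_pure; [|exact: ev_hom|exact: PhiV_hom].
  by rewrite ev_pure genE lunit_pure -(homl _ _ PhiV_hom).
have -> : slice a = Phi (pure (pivot A (beta a)) gen).
  apply: dual_ext => x; apply/ffunP => i.
  by rewrite PhiE sliceE formE -betaE muA.
rewrite lker0_lfunK// tensm_pure//.
by rewrite lker0_lfunK ?pivot_inj// id_lfunE.
Qed.

Lemma nakayama_hom : bimod_hom alpha.
Proof.
apply: bimod_homP => s y; have [a ->] := tens_gen_l nuK y.
  rewrite -pure_lact_l -[s](twK nuK) -ract_gen pure_mid !nakayamaE lactA betaM beta_se.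
  by rewrite -pure_lact_l lactA twK.
rewrite -pure_ract_r !nakayamaE ractA betaM beta_se -ractA pure_mid -ract_gen.
by rewrite pure_ract_r.
Qed.

Fixpoint pow_gen n : tens_pow V n :=
  if n is n'.+1 then pure gen (pow_gen n') else (1 : S).

Lemma nakayama_pow_hom n : bimod_hom (nakayama_pow alpha n).
Proof.
elim: n => [|n IH] /=.
  exact: (bimod_hom_comp (runitV_hom A) (lunit_hom A)).
have tn := tensm_hom nakayama_hom (bimod_hom1 (tens_pow V n)).
have tp := tensm_hom (bimod_hom1 V) IH.
exact: (bimod_hom_comp (assoc_hom _ _ _) (bimod_hom_comp tn (bimod_hom_comp
  (assocV_hom _ _ _) (bimod_hom_comp tp (assoc_hom _ _ _))))).
Qed.

Lemma nakayama_powE n a : nakayama_pow alpha n (pure (pow_gen n) a) = pure (iter n beta a : A) (pow_gen n).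
Proof.
elim: n a => [|n IH] a /=.
  by rewrite comp_lfunE lunit_pure lact_one; exact: runitVE.
have h1 (M : bimod) := bimod_hom1 M.
rewrite !comp_lfunE assoc_pure tensm_pure//; last exact: nakayama_pow_hom.
rewrite id_lfunE IH assocV_pure tensm_pure//; last exact: nakayama_hom.
by rewrite nakayamaE id_lfunE assoc_pure -iterS.
Qed.

Let pow_tw n (s : S) : ract s (pow_gen n) = lact (iter n tw s) (pow_gen n).
Proof.
elim: n s => [|n IH] s //=.
by rewrite -pure_ract_r -[RHS]pure_lact_l IH -pure_mid ract_gen -iterS.
Qed.

Let pow_gen_all n (y : tens_pow V n) : exists s, y = lact s (pow_gen n).
Proof.
elim: n y => [|n IH] y; first by exists y; rewrite /= unit_actE mulr1.
have [z ->] := tens_gen_l nuK y; have [s ->] := IH z.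
by exists (tw s); rewrite -pure_mid ract_gen -pure_lact_l.
Qed.

Section Trivialisation.
Variables (n : nat) (xi : 'Hom(tens_pow V n, unitB)).
Hypothesis xi_iso : bimod_iso xi.
Let u : S := xi (pow_gen n).

Let xiE s : xi (lact s (pow_gen n)) = s * u :> S.
Proof. by rewrite (homl _ _ xi_iso.1) /= unit_actE. Qed.

Lemma trivialisation_unit i : u i != 0.
Proof.
have [_ [g [_ _ /lfunP/(_ (1 : S))]]] := xi_iso; rewrite comp_lfunE id_lfunE.
have [s ->] := pow_gen_all (g (1 : S)); rewrite xiE => /ffunP/(_ i); rewrite !ffunE => E.
by apply/eqP => u0; move: E; rewrite u0 mulr0 => /eqP; rewrite eq_sym oner_eq0.
Qed.

Lemma trivialisation_twist (s : S) : iter n tw s = s.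
Proof.
have := homr s (pow_gen n) xi_iso.1; rewrite pow_tw xiE /= unit_actE -/u => /ffunP E.
apply/ffunP => i; have := E i; rewrite !ffunE.
exact: (@mulIf F (u i) (trivialisation_unit i)).
Qed.

Let v : S := [ffun i => (u i)^-1%R].
Let vu : v * u = 1.
Proof. by apply/ffunP => i; rewrite !ffunE; apply: mulVf; apply: trivialisation_unit. Qed.

(** A trivialisation of a power of [V] is determined by the image [u] of the
    generator, and it turns the Nakayama morphism into a power of [beta]
    followed by conjugation by [u]. *)
Lemma trivialisationE a :
  (runit A \o (tensm \1 xi \o (nakayama_pow alpha n \o (tensm xi^-1 \1 \o lunitV A)))) a =
  mu (se v) (mu (iter n beta a) (se u)).
Proof.
have xinj := bimod_iso_inj xi_iso.
have xsurj y : exists x, xi x = y.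
  by have [_ [g [_ _ gx]]] := xi_iso; exists (g y); rewrite -comp_lfunE gx id_lfunE.
have xVhom := (bimod_iso_bij xi_iso.1 xinj xsurj).2.
rewrite !comp_lfunE lunitVE tensm_pure//; last exact: bimod_hom1.
have -> : xi^-1 (1 : S) = lact v (pow_gen n).
  by rewrite -[RHS](lker0_lfunK xinj) xiE vu.
rewrite id_lfunE pure_lact_l (homl _ _ (nakayama_pow_hom n)) nakayama_powE -pure_lact_l.
rewrite tensm_pure ?id_lfunE; [|exact: bimod_hom1|exact: xi_iso.1].
by rewrite runit_pure ractA lactA -/u muA.
Qed.
End Trivialisation.

Lemma pow_coordinate n : exists c : 'Hom(tens_pow V n, unitB),
  (forall s y, c (lact s y) = s * (c y : S) :> S) /\ c (pow_gen n) = (1 : S).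
Proof.
elim: n => [|n [c [cl cg]]].
  by exists \1; split=> [s y|]; rewrite !id_lfunE //= unit_actE.
have bal : balanced (fun (f : V) (y : tens_pow V n) => dapp f (1 : S) * tw (c y) : unitB).
  split; first split=> [f b x x'|x b f g].
  - by rewrite linearP tw_linear mulS_linear.
  - by rewrite val_dualP mulS_linearr.
  move=> s f x; rewrite ract_dualE cl twM mulrA; congr (_ * _).
  have -> : lact s ((1 : S) : W) = ract (tw s) ((1 : S) : W) by rewrite [LHS]lactW [RHS]ractW.
  exact: dual_ract.
exists (tens_lift (fun (f : V) (y : tens_pow V n) => dapp f (1 : S) * tw (c y) : unitB)).
split; last by rewrite tens_lift_pure// genE cg tw1 mulr1.
move=> s y; rewrite -comp_lfunE -[RHS]unit_actE -[unit_act s _]comp_lfunE.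
congr (fun_of_lfun _ y); apply: tens_ext => f x.
rewrite !comp_lfunE unit_actE -pure_lact_l !tens_lift_pure//.
by rewrite lact_dualE mulrA.
Qed.

Lemma trivialisation_exists n (u : S) : (forall s : S, iter n tw s = s) -> (forall i, u i != 0) ->
  exists2 xi : 'Hom(tens_pow V n, unitB), bimod_iso xi & xi (pow_gen n) = u.
Proof.
move=> twn u0; have [c [cl cg]] := pow_coordinate n.
pose v : S := [ffun i => (u i)^-1%R].
have uv : u * v = 1 by apply/ffunP => i; rewrite !ffunE; apply: mulfV.
pose r : 'Hom(unitB, tens_pow V n) := linfun (fun s : unitB => lact ((s : S) * v) (pow_gen n)).
have rE s : r s = lact ((s : S) * v) (pow_gen n).
  by rewrite linfun_linear// => b x y; rewrite mulS_linearr lact_linear1.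
have rhom : bimod_hom r.
  apply: bimod_homP => s t; rewrite !rE /= unit_actE.
    by rewrite -mulrA lact_mul.
  by rewrite -lract pow_tw twn -lact_mul -mulrA ffun_mulC -mulrA ffun_mulC.
have rinj : lker r == 0%VS.
  apply/lker0P => s t; rewrite !rE => /(congr1 c); rewrite !cl cg !mulr1.
  move=> /(congr1 (fun x : S => x * u)); rewrite -!mulrA [v * u]ffun_mulC uv !mulr1.
  by [].
have rsurj y : exists s, r s = y.
  have [s ->] := pow_gen_all y; exists (s * u).
  by rewrite rE -mulrA uv mulr1.
have [[_ [g [hg gr rg]]] rVhom] := bimod_iso_bij rhom rinj rsurj.
exists r^-1.
  split=> //; exists r; split=> //; last exact: lker0_compVf.
  exact: inv_lfunK.
by rewrite -[RHS](lker0_lfunK rinj) rE uv lact_one.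
Qed.

Let corner (u v : S) b i j :
  mu (mu (e i) (mu (se v) (mu b (se u)))) (e j) = (v i * u j) *: mu (mu (e i) b) (e j).
Proof.
have el s : mu (e i) (se s) = s i *: e i.
  rewrite -{1}se_idem -(sembedM mu_bilinear e_mul) idem_mulr -se_idem.
  by rewrite /sembed scaler_sumr; apply: eq_bigr => l _; rewrite ffunE scalerA.
have er s : mu (se s) (e j) = s j *: e j.
  rewrite -{1}se_idem -(sembedM mu_bilinear e_mul) ffun_mulC idem_mulr -se_idem.
  by rewrite /sembed scaler_sumr; apply: eq_bigr => l _; rewrite ffunE scalerA.
rewrite !muA el (muZl mu_bilinear) !(muZl mu_bilinear) -[mu (mu _ (se u)) _]muA er.
by rewrite (muZr mu_bilinear) scalerA.
Qed.

Let corners_eq a b : (forall i j, mu (mu (e i) a) (e j) = mu (mu (e i) b) (e j)) -> a = b.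
Proof.
have exp x : x = \sum_i \sum_j mu (mu (e i) x) (e j).
  rewrite -[LHS]mu1l -e_sum (sum_of (mul_ x)); apply: eq_bigr => i _.
  by rewrite -(sum_of (mur (mu (e i) x))) e_sum mu1r.
by move=> E; rewrite (exp a) (exp b); apply: eq_bigr => i _; apply: eq_bigr => j _.
Qed.

Hypothesis beta_square : exists xi : 'I_k -> F, (forall i, xi i != 0) /\
  forall i j a, mu (mu (e i) (beta (beta a))) (e j) = (xi i / xi j) *: mu (mu (e i) a) (e j).
Hypothesis beta_not_inner : forall zeta : 'I_k -> F, (forall i, nu i = i) ->
  (forall i, zeta i != 0) ->
  ~ (forall i j a, mu (mu (e i) (beta a)) (e j) = (zeta i / zeta j) *: mu (mu (e i) a) (e j)).

(** A trivialisation of [V] itself would force [nu] to be the identity and [beta]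
    to be conjugation by an element of [S]; for the square of [V] such an
    element is provided by [beta_square]. *)
Theorem form_order2 : nakayama_order alpha 2.
Proof.
split=> // [|[|[|//]] // _ [xi xi_iso E]].
  have [xi [xi0 xiE]] := beta_square.
  have [|i|x x_iso xg] := @trivialisation_exists 2 [ffun i => xi i].
  - by move=> s; apply: twK.
  - by rewrite ffunE.
  exists x => //; apply/lfunP => a; rewrite (trivialisationE x_iso) id_lfunE.
  apply: corners_eq => i j; rewrite corner xiE scalerA xg !ffunE.
  rewrite [X in X *: _](_ : _ = 1) ?scale1r//.
  by field; rewrite !xi0.
have nu1 i : nu i = i.
  have := trivialisation_twist xi_iso (idem F i); rewrite /= tw_idem// => /ffunP/(_ i).
  by rewrite !ffunE eqxx; case: eqP => // _ /eqP; rewrite eq_sym oner_eq0.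
apply: (beta_not_inner nu1 (trivialisation_unit xi_iso)) => i j a.
have := congr1 (fun f : 'End(A) => f a) E; rewrite (trivialisationE xi_iso) id_lfunE /= => aE.
rewrite -{2}aE corner scalerA ffunE [X in X *: _](_ : _ = 1) ?scale1r//.
have cancel (p q : F) : p != 0 -> q != 0 -> p / q * (p^-1 * q) = 1.
  by move=> p0 q0; field; rewrite p0 q0.
have tu := trivialisation_unit xi_iso.
exact: (cancel _ _ (tu i) (tu j)).
Qed.

End FrobeniusForm.

(** * The preprojective algebra by generators and relations *)

Section DoubleQuiver.
Variables (F : fieldType) (k : nat) (Q : quiver k).

Definition dbar (b : arrow (double_quiver Q)) : arrow (double_quiver Q) :=
  match b with inl a => inr a | inr a => inl a end.
Definition deps (b : arrow (double_quiver Q)) : F := if b is inl _ then 1 else -1.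

Fact dbarK : involutive dbar. Proof. by case. Qed.
Fact src_dbar b : src (dbar b) = tgt b. Proof. by case: b. Qed.
Fact depsN b : deps (dbar b) = - deps b. Proof. by case: b => a; rewrite /= ?opprK. Qed.
Fact deps_sq b : deps b * deps b = 1. Proof. by case: b => a; rewrite /= ?mulrNN mulr1. Qed.

Definition signed_double : signed_quiver F k :=
  SignedQuiver dbarK src_dbar depsN deps_sq.

End DoubleQuiver.

Lemma linear_scale (F : fieldType) (U V : lmodType F) (f : U -> V) :
  linear f -> forall c x, f (c *: x) = c *: f x.
Proof.
move=> lf c x; have f0 : f 0 = 0 by have := lf (-1) 0 0; rewrite scaler0 addr0 scaleN1r addNr.
by have := lf c x 0; rewrite !addr0 f0 addr0.
Qed.

Section PathQuotientPresentation.
Variables (F : fieldType) (k : nat) (Q0 : quiver k).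
Notation Q := (double_quiver Q0).
Notation SQ := (signed_double F Q0).
Notation D := (arrow Q).
Notation r := (preproj_relation F Q0).
Notation Pi := (pathquot r).
Notation PA := (pathalg F Q).

Lemma basis_mul (p q : qpath Q) : pend p = pstart q ->
  exists2 t, pbasis F p * pbasis F q = pbasis F t & val t = (pstart p, (val p).2 ++ (val q).2).
Proof.
move=> pq; have [t tE vt] := pcat_some pq; exists t => //.
by rewrite [LHS]pmul_basisE /pmul_basis tE.
Qed.

Lemma basis_mul0 (p q : qpath Q) : pend p != pstart q -> pbasis F p * pbasis F q = 0.
Proof. by move=> pq; rewrite [LHS]pmul_basisE /pmul_basis pcat_none. Qed.

Lemma relationE : r = \sum_(b : D) deps F b *: (arr F b * arr F (dbar b)).
Proof.
rewrite big_sumType /= -big_split; apply: eq_bigr => a _ /=.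
by rewrite scale1r scaleN1r.
Qed.

Lemma qpi_mul a b : qpi r a * qpi r b = qpi r (a * b).
Proof. exact: qpiM. Qed.
Lemma qpi_linear : linear (qpi r).
Proof.
by move=> c a b; rewrite -[RHS]/(qadd (qscale c _) _) qpiZ qpiD.
Qed.

Lemma qpi_relation : qpi r r = 0.
Proof.
apply/qpi_eq; rewrite subr0; exists [:: (1, 1)].
by rewrite big_seq1 mul1r mulr1.
Qed.

Definition qarr (b : D) : Pi := qpi r (arr F b).
Notation qe := (@qidem F k Q r).

Lemma qe_qarr i b : qe i * qarr b = if i == src b then qarr b else 0.
Proof.
rewrite qpi_mul /arr [_ * _]pmul_basisE /pmul_basis pcat_triv.
by case: eqP => // _.
Qed.

Lemma qarr_qe b i : qarr b * qe i = if tgt b == i then qarr b else 0.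
Proof.
rewrite qpi_mul /arr [_ * _]pmul_basisE /pmul_basis pcat_trivr.
by case: eqP => // _.
Qed.

Lemma qpi_basis (p : qpath Q) :
  qpi r (pbasis F p) = qe (pstart p) * \prod_(b <- (val p).2) qarr b.
Proof.
have gen (i : 'I_k) (s : seq D) (q : qpath Q) : walk i s -> val q = (i, s) ->
    qpi r (pbasis F q) = qe i * \prod_(b <- s) qarr b.
  2: by apply: gen; [exact: (valP p)|rewrite /pstart -surjective_pairing].
elim: s i q => [|b s IH] i q /= ws vp.
  rewrite big_nil mulr1; congr (qpi r (pbasis F _)); exact: val_inj.
have [/eqP sb ws'] := andP ws.
have ep : pend (apath b) = pstart (@QPath _ _ (tgt b, s) ws') by [].
have [t tE vt] := basis_mul ep.
have -> : q = t by apply: val_inj; rewrite [LHS]vp vt /pstart /= sb.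
have h : qpi r (pbasis F t) = qarr b * (qe (tgt b) * \prod_(b <- s) qarr b).
  rewrite -tE -[LHS]qpi_mul; congr (_ * _).
  exact: (IH _ (@QPath _ _ (tgt b, s) ws') ws' erefl).
have e1 : qarr b * qe (tgt b) = qarr b by rewrite (qarr_qe b (tgt b)) eqxx.
have e2 : qe i * qarr b = qarr b by rewrite (qe_qarr i b) [src _]sb eqxx.
rewrite big_cons; move: (\prod_(b <- s) qarr b) h => P h; apply: (etrans h).
move: (qarr b) (qe (tgt b)) (qe i) e1 e2 {h} => u v z e1 e2.
by rewrite mulrA e1 mulrA e2.
Qed.

Lemma sum_sandwich (B : pzRingType) (I : finType) (u v : B) (f : I -> B) :
  u * (\sum_i f i) * v = \sum_i u * f i * v.
Proof. by rewrite mulr_sumr mulr_suml. Qed.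

Lemma mul_assoc_eq (B : pzRingType) (p b b' q t1 t2 t3 : B) :
  b' * q = t1 -> b * t1 = t2 -> p * t2 = t3 -> p * (b * b' * q) = t3.
Proof. by move=> <- <- <-; rewrite -mulrA. Qed.

Lemma mul_left0 (B : pzRingType) (p b b' q : B) : p * b = 0 -> p * (b * b' * q) = 0.
Proof. by move=> pb; rewrite -mulrA mulrA pb mul0r. Qed.

Lemma mul_right0 (B : pzRingType) (p b b' q : B) : b' * q = 0 -> p * (b * b' * q) = 0.
Proof. by move=> pb; rewrite -mulrA pb !mulr0. Qed.

Local Opaque pbasis pmul.
(** A linear map on the path algebra that kills the products of the relation with
    paths on both sides kills the ideal. *)
Lemma pathquot_universal (L : lmodType F) (h : 'I_k -> seq D -> L) :
  kills_relation (Q := SQ) h ->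
  exists f : Pi -> L, linear f /\ forall p : qpath Q, f (qpi r (pbasis F p)) = h (pstart p) (val p).2.
Proof.
move=> kh; pose H (p : qpath Q) := h (pstart p) (val p).2.
have Hl := pext_linear H.
have H0 : pext H 0 = 0 by have := Hl (-1) 0 0; rewrite scaler0 addr0 scaleN1r addNr.
have HD a b : pext H (a + b) = pext H a + pext H b.
  by have := Hl 1 a b; rewrite !scale1r.
have HZ c a : pext H (c *: a) = c *: pext H a.
  by have := Hl c a 0; rewrite !addr0 H0 addr0.
have Hpq p q : pext H (pbasis F p * r * pbasis F q) = 0.
  have -> : pbasis F p * r * pbasis F q = \sum_(b : D) deps F b *:
      (pbasis F p * (arr F b * arr F (dbar b) * pbasis F q)).
    rewrite relationE [LHS]sum_sandwich; apply: eq_bigr => b _.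
    apply: etrans (congr1 (fun z => z * _) (esym (pscalerAr _ _ _))) _.
    apply: etrans (esym (pscalerAl _ _ _)) (congr1 _ _).
    exact: esym (mulrA _ _ _).
  rewrite (linear_sum_of Hl).
  have [pq|pq] := eqVneq (pend p) (pstart q); last first.
    rewrite big1// => b _; have [pb|pb] := eqVneq (pend p) (src b); last first.
      by rewrite mul_left0 ?scaler0//; apply: (basis_mul0 (q := apath b)).
    rewrite mul_right0 ?scaler0//; apply: (basis_mul0 (p := apath (dbar b))).
    apply: contraNneq pq => <-; rewrite pb /pend /= /walk_end /=.
    by case: b {pb}.
  have wp : walk (pstart p) (val p).2 by case: p {pq} => -[].
  have wq : walk (walk_end (pstart p) (val p).2) (val q).2.
    by rewrite -/(pend p) pq; case: q {pq} => -[].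
  rewrite -[RHS](kh _ _ _ wp wq) [RHS]big_mkcond /=; apply: eq_bigr => b _.
  rewrite HZ -/(pend p); case: eqP => [sb|/eqP sb]; last first.
    rewrite mul_left0 ?H0 ?scaler0//.
    by apply: (@basis_mul0 p (@apath _ Q b)); rewrite eq_sym.
  congr (_ *: _).
  have e1 : pend (apath (dbar b)) = pstart q by rewrite -pq -sb /pend /walk_end /=; case: b {sb}.
  have [t1 t1E vt1] := basis_mul e1.
  have e2 : pend (@apath _ Q b) = pstart t1 by rewrite /pstart vt1 /pend /walk_end /=; case: b {sb e1 t1E vt1}.
  have [t2 t2E vt2] := basis_mul e2.
  have e3 : pend p = pstart t2 by rewrite /pstart vt2.
  have [t3 t3E vt3] := basis_mul e3.
  rewrite (mul_assoc_eq t1E t2E t3E) pext_basis /H {1}/pstart vt3 vt2 vt1.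
  by [].
have Hideal a : ideal_gen r a -> pext H a = 0.
  case=> s ->; elim: s => [|[a1 a2] s IH]; first by rewrite big_nil.
  rewrite big_cons HD IH addr0 /=.
  have L1 (b : PA) : linear (fun a : PA => pext H (a * r * b)).
    by move=> c x y; rewrite !mulrDl HD -!pscalerAl HZ.
  have L2 (d : PA) : linear (fun b : PA => pext H (d * r * b)).
    by move=> c x y; rewrite !mulrDr HD -!pscalerAr HZ.
  have L0 : linear (fun _ : PA => 0 : L) by move=> c x y /=; rewrite scaler0 addr0.
  apply: (pathalg_ext (f := fun a : PA => pext H (a * r * a2)) (g := fun=> 0) (L1 a2) L0) => p.
  apply: (pathalg_ext (f := fun b : PA => pext H (pbasis F p * r * b)) (g := fun=> 0) (L2 _) L0) => q.
  exact: Hpq.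
exists (fun a => pext H (qrepr a)).
have fq a : pext H (qrepr (qpi r a)) = pext H a.
  apply/eqP; rewrite -subr_eq0 -scaleN1r -HZ -HD scaleN1r; apply/eqP/Hideal.
  exact: qrepr_pi.
split=> [c|p]; last by rewrite fq pext_basis.
elim/qind => a; elim/qind => b; rewrite -qpi_linear !fq.
exact: Hl.
Qed.

Lemma pathquot_spans (P : Pi -> Prop) : P 0 ->
  (forall c (p : qpath Q) a, P a -> P (c *: qpi r (pbasis F p) + a)) -> forall a, P a.
Proof.
move=> P0 Pc; elim/qind => a; rewrite (pathalgE a).
have l := qpi_linear; elim: (enum_fset (msupp a)) => [|p s IH]; first by rewrite big_nil.
by rewrite big_cons l; apply: Pc.
Qed.

Lemma pathquot_neq0 (i : 'I_k) : (1 : Pi) != 0.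
Proof.
pose h (j : 'I_k) (s : seq D) : F^o := ((s == [::]) && (j == i))%:R.
have kr : kills_relation (Q := SQ) h.
  by move=> j s t _ _; rewrite big1// => b _; rewrite /h; case: s => *; rewrite /= scaler0.
have [f [lf fE]] := pathquot_universal kr.
have f0 : f 0 = 0 by have := lf (-1) 0 0; rewrite scaler0 addr0 scaleN1r addNr.
apply/eqP => one0; have := fE (triv Q i); rewrite /h /= eqxx.
have -> : qpi r (pbasis F (triv Q i)) = 0.
  by rewrite -[LHS]mulr1 one0 mulr0.
by rewrite f0 => /esym/eqP; rewrite oner_eq0.
Qed.

Lemma qpi_relation_sum : \sum_(b : D) deps F b *: (qarr b * qarr (dbar b)) = 0 :> Pi.
Proof.
transitivity (qpi r (\sum_(b : D) deps F b *: (arr F b * arr F (dbar b)))).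
  rewrite (linear_sum_of qpi_linear); apply: eq_bigr => b _.
  exact: etrans (congr1 (fun z : Pi => deps F b *: z) (qpi_mul _ _))
    (esym (linear_scale qpi_linear _ _)).
by apply: etrans qpi_relation; congr (qpi r _); apply: esym relationE.
Qed.

End PathQuotientPresentation.

Section Alias.
Variables (F : fieldType) (k : nat) (Q0 : quiver k).
Notation Q := (double_quiver Q0).
Notation SQ := (signed_double F Q0).
Notation D := (arrow Q).
Notation r := (preproj_relation F Q0).
Notation Pi := (pathquot r).
Variable ne : (1 : Pi) != 0.

(** Aliases of the carrier: it is a nontrivial algebra only in view of [ne], and a
    finite-dimensional space only in view of [ax]. *)
Definition preproj_alg of (1 : Pi) != 0 : Type := Pi.
Notation PA := (preproj_alg ne).
HB.instance Definition _ := GRing.PzRing.copy PA Pi.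
HB.instance Definition _ := GRing.Lmodule.copy PA Pi.
HB.instance Definition _ := GRing.PzSemiRing_isNonZero.Build PA ne.
Fact preproj_scalerAl (c : F) (x y : Pi) : c *: (x * y) = (c *: x) * y.
Proof. exact: esym (linear_scale ((pathquot_mul_bilinear r).2 y) c x). Qed.
Fact preproj_scalerAr (c : F) (x y : Pi) : c *: (x * y) = x * (c *: y).
Proof. exact: esym (linear_scale ((pathquot_mul_bilinear r).1 x) c y). Qed.
HB.instance Definition _ := GRing.Lmodule_isLalgebra.Build F PA preproj_scalerAl.
HB.instance Definition _ := GRing.Lalgebra_isAlgebra.Build F PA preproj_scalerAr.

Variables (N : nat) (ax : Vector.axiom N Pi).
Definition preproj_finalg of Vector.axiom N Pi & (1 : Pi) != 0 : Type := Pi.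
Notation PF := (preproj_finalg ax ne).
HB.instance Definition _ := GRing.Algebra.copy PF PA.
HB.instance Definition _ := Lmodule_hasFinDim.Build F PF ax.

Lemma preproj_presents : presents (A := PA) (Q := SQ) (@qidem F k Q r) (@qarr F k Q0).
Proof.
split.
- exact: qidem_mul.
- exact: qidem_sum.
- exact: qe_qarr.
- exact: qarr_qe.
- exact: qpi_relation_sum.
- move=> P P0 Pc; apply: pathquot_spans => // c p a Pa.
  have wp : walk (pstart p) (val p).2 by case: p => -[].
  by have := Pc c _ _ _ wp Pa; rewrite [in X in P X -> _](esym (qpi_basis F p)).
move=> L h kh; have [f [lf fE]] := pathquot_universal kh.
pose f' : {linear PA -> L} := HB.pack f (GRing.isLinear.Build F PA L _ f lf).
exists f' => i s ws; apply: etrans (fE (@QPath _ _ (i, s) ws)).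
by congr f; apply: esym (qpi_basis F (@QPath _ _ (i, s) ws)).
Qed.

Lemma preproj_fin_presents : presents (A := PF) (Q := SQ) (@qidem F k Q r) (@qarr F k Q0).
Proof. exact: preproj_presents. Qed.

End Alias.

(** * Dynkin graphs as trees *)

(** The tree on the natural numbers rooted at [0] in which [par] sends a vertex to
    its parent. *)
Definition tree_edge (par : nat -> nat) : rel nat := fun i j =>
  ((0 < j)%N && (i == par j)) || ((0 < i)%N && (j == par i)).

Section Tree.
Local Open Scope nat_scope.
Local Unset Implicit Arguments.

Lemma sum_over_list k (P : pred nat) (y : nat -> nat) (L : seq nat) :
  uniq L -> (forall v, (v < k) && P v = (v \in L)) ->
  \sum_(v < k | P v) y v = \sum_(v <- L) y v.
Proof.
move=> uL PL; rewrite -(big_mkord P y) -big_filter; apply: perm_big.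
apply: uniq_perm => // [|v]; first exact/filter_uniq/iota_uniq.
by rewrite mem_filter mem_index_iota leq0n andTb andbC PL.
Qed.

(** For [c = 2] and the Dynkin graphs, [y] lists the coefficients of the sum of the
    positive roots in terms of the simple roots. *)
Definition harmonic k par (y : nat -> nat) c := forall u, u < k ->
  2 * y u = \sum_(v < k | tree_edge par u v) y v + c.

Definition weightA k v := v.+1 * (k - v).

Lemma harmonicA k : 1 < k -> harmonic k predn (weightA k) 2.
Proof.
move=> k1 u uk; pose y := weightA k; rewrite -/y; have [->|u0] := posnP u.
  rewrite (sum_over_list k _ y [:: 1]) ?big_seq1 => //.
    by rewrite /y /weightA; nia.
  by move=> v; rewrite /tree_edge !inE; lia.
have [uk'|ku] := ltnP u.+1 k.
  rewrite (sum_over_list k _ y [:: u.-1; u.+1]) ?big_cons ?big_nil; last first.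
  - by move=> v; rewrite /tree_edge !inE; lia.
  - by rewrite /= !inE; lia.
  have [d dE] : exists d, k = u.-1 + d + 3 by exists (k - u.-1 - 3); lia.
  by rewrite /y /weightA dE; move: u0; case: u uk uk' dE => // u _ _ _ _ /=; nia.
rewrite (sum_over_list k _ y [:: u.-1]) ?big_seq1 => //.
  rewrite /y /weightA; have -> : k = u.+1 by lia.
  by case: u u0 {uk ku} => // u _ /=; nia.
by move=> v; rewrite /tree_edge !inE; lia.
Qed.

Definition branch_par k b j := if j == k.-1 then b else j.-1.

Lemma edge_branchE k b i j : b < k.-1 -> i < k -> j < k ->
  edge_branch k b i j = tree_edge (branch_par k b) i j.
Proof.
move=> bk ik jk; rewrite /edge_branch /edgeA /tree_edge /branch_par.
by case: (eqVneq i k.-1) => [ei|ni]; case: (eqVneq j k.-1) => [ej|nj]; lia.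
Qed.

(** Twice the coefficients of the sum of the positive roots. *)
Definition weightD k v := if v < k - 2 then 2 * v.+1 * (2 * k - v - 2) else k * k.-1.

Lemma harmonicD k : 4 <= k -> harmonic k (branch_par k (k - 3)) (weightD k) 4.
Proof.
move=> k4 u uk; pose y := weightD k; rewrite -/y.
have [n kE] : exists n, k = n + 4 by exists (k - 4); lia.
have mem L : (forall v, v < k -> tree_edge (branch_par k (k - 3)) u v = (v \in L)) ->
    (forall v, v \in L -> v < k) ->
    forall v, (v < k) && tree_edge (branch_par k (k - 3)) u v = (v \in L).
  by move=> h1 h2 v; have [/h1->//|vk] := boolP (v < k); apply/esym/negbTE; apply: contra vk; apply: h2.
have [uk3|] := ltnP u (k - 3).
  have [u0|u0] := posnP u.
    rewrite (sum_over_list k _ y [:: 1]) ?big_seq1 => //.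
      by rewrite u0 /y /weightD kE; case: ifP; case: ifP => ? ?; try lia; nia.
    apply: mem => v; rewrite !inE /tree_edge /branch_par; last by lia.
    by case: (eqVneq v k.-1) => ?; case: (eqVneq u k.-1) => ?; lia.
  rewrite (sum_over_list k _ y [:: u.-1; u.+1]) ?big_cons ?big_nil; last first.
  - apply: mem => v; rewrite !inE /tree_edge /branch_par; last by lia.
    by case: (eqVneq v k.-1) => ?; case: (eqVneq u k.-1) => ?; lia.
  - by rewrite /= !inE; lia.
  rewrite /y /weightD !ifT; try lia.
  have [d dE] : exists d, k = u.-1 + d + 5 by exists (k - u.-1 - 5); lia.
  by rewrite dE; move: u0; case: u uk uk3 dE {mem} => // u _ _ _ _ /=; nia.
rewrite leq_eqVlt => /orP[/eqP uE|uk3].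
  rewrite (sum_over_list k _ y [:: u.-1; u.+1; u.+2]) ?big_cons ?big_nil; last first.
  - apply: mem => v; rewrite !inE /tree_edge /branch_par; last by lia.
    by case: (eqVneq v k.-1) => ?; case: (eqVneq u k.-1) => ?; lia.
  - by rewrite /= !inE; lia.
  have -> : u = n.+1 by lia.
  rewrite /y /weightD kE ifT; last by lia.
  rewrite ifT; last by lia.
  rewrite ifF; last by lia.
  rewrite ifF; last by lia.
  by rewrite /= addn4 /=; nia.
rewrite (sum_over_list k _ y [:: k - 3]) ?big_seq1 => //.
  rewrite /y /weightD ifF; last by lia.
  rewrite ifT; last by lia.
  by rewrite kE addn4 /=; nia.
apply: mem => v; rewrite !inE /tree_edge /branch_par; last by lia.
by case: (eqVneq v k.-1) => ?; case: (eqVneq u k.-1) => ?; lia.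
Qed.

Definition weightE k v : nat := nth 0
  (if k == 6 then [:: 16; 30; 42; 30; 16; 22]
   else if k == 7 then [:: 34; 66; 96; 75; 52; 27; 49]
   else [:: 92; 182; 270; 220; 168; 114; 58; 136]) v.

Lemma E_cases k : 6 <= k <= 8 -> [\/ k = 6, k = 7 | k = 8].
Proof.
move=> k68; have : k = 6 \/ k = 7 \/ k = 8 by lia.
by case=> [|[]]; [constructor 1|constructor 2|constructor 3].
Qed.

Lemma harmonicE k : 6 <= k <= 8 -> harmonic k (branch_par k 2) (weightE k) 2.
Proof.
by move=> /(E_cases k)[] -> u; rewrite big_mkcond !big_ord_recl big_ord0;
  do 8?[case: u => [|u]].
Qed.

End Tree.

Lemma ADE_tree k (Delta : rel 'I_k) : (2 <= k)%N -> ADE_graph Delta ->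
  exists (s : 'S_k) (par y : nat -> nat) (c : nat),
    [/\ forall j, (0 < j < k)%N -> (par j < j)%N,
        forall i j, Delta i j = tree_edge par (s i) (s j), (0 < c)%N,
        forall u, (u < k)%N -> (0 < y u)%N & harmonic k par y c].
Proof.
move=> k2 [[s sE]|[k4 [s sE]]|[k68 [s sE]]].
- exists s, predn, (weightA k), 2%N; split=> //; last exact: harmonicA.
  + by case.
  + by move=> i j; rewrite sE /edgeA /tree_edge; case: (nat_of_ord _) => [|?]; case: (nat_of_ord _) => [|?]; lia.
  + by move=> u uk; rewrite /weightA muln_gt0 subn_gt0 uk.
- exists s, (branch_par k (k - 3)), (weightD k), 4%N.
  split=> //; last exact: harmonicD.
  + by move=> j jk; rewrite /branch_par; case: eqP; lia.
  + by move=> i j; rewrite sE edge_branchE//; lia.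
  + by move=> u uk; rewrite /weightD; case: ifP => _; rewrite !muln_gt0; lia.
exists s, (branch_par k 2), (weightE k), 2%N; split=> //; last exact: harmonicE.
- by move=> j jk; rewrite /branch_par; case: eqP; lia.
- by move=> i j; rewrite sE edge_branchE//; lia.
by have [] := E_cases _ k68 => -> u; do 8?[case: u => [|u]].
Qed.

Section Orientation.
Variables (F : fieldType) (k : nat) (Delta : rel 'I_k) (Q0 : quiver k).
Hypothesis hQ : underlying_graph Q0 Delta.
Variables (s : 'S_k) (par : nat -> nat).
Hypothesis par_lt : forall j, (0 < j < k)%N -> (par j < j)%N.
Hypothesis edgeE : forall i j, Delta i j = tree_edge par (s i) (s j).
Notation D := (arrow (double_quiver Q0)).

Lemma edge_sym i j : Delta i j = Delta j i.
Proof. by rewrite !edgeE /tree_edge orbC. Qed.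

Lemma edge_irr i : Delta i i = false.
Proof.
rewrite edgeE /tree_edge orbb; apply/negbTE/negP => /andP[s0 /eqP sp].
by have := par_lt (j := s i); rewrite s0 ltn_ord -sp ltnn => /(_ isT).
Qed.

Lemma arrow_edge (b : D) : Delta (src b) (tgt b).
Proof. by case: b => a /=; [|rewrite edge_sym]; apply: hQ.1. Qed.

Lemma arrow_exists i j : Delta i j -> exists b : D, src b = i /\ tgt b = j.
Proof.
by case/(hQ.2 i j) => a [[[sa ta]|[sa ta]] _]; [exists (inl a)|exists (inr a)].
Qed.

Lemma edge_arrow_inj (b c : D) : src b = src c -> tgt b = tgt c -> b = c.
Proof.
have uniq (a a' : arrow Q0) : (src a = src a' /\ tgt a = tgt a') \/ (src a = tgt a' /\ tgt a = src a') -> a = a'.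
  move=> h; have [a0 [_ U]] := hQ.2 _ _ (hQ.1 a').
  by rewrite -(U a h) -(U a' (or_introl (conj erefl erefl))).
have flip (a a' : arrow Q0) : src a = tgt a' -> tgt a = src a' -> False.
  move=> h1 h2; have aa : a = a' by apply: uniq; right.
  by have := hQ.1 a; rewrite {1}h1 aa edge_irr.
case: b c => b [] c /= h1 h2.
- by rewrite (uniq b c) //; left.
- by case: (flip b c).
- by case: (flip c b).
- by rewrite (uniq b c) //; left.
Qed.

#[local] Arguments src : simpl never.
#[local] Arguments tgt : simpl never.

Lemma neighbour_sum (u : 'I_k) (y : nat -> nat) :
  (\sum_(b : D | src b == u) y (s (tgt b)) = \sum_(v < k | tree_edge par (s u) v) y v)%N.
Proof.
rewrite (reindex_inj (@perm_inj _ s)) /=.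
rewrite (partition_big (fun b : D => tgt b) (fun v => tree_edge par (s u) (s v))) /=; last first.
  by move=> b /eqP <-; rewrite -edgeE arrow_edge.
apply: eq_bigr => v; rewrite -edgeE => /arrow_exists[b [sb tb]].
rewrite (big_pred1 b) ?tb// => c; apply/andP/eqP => [[/eqP sc /eqP tc]|->]; last by rewrite sb tb !eqxx.
by apply: edge_arrow_inj; rewrite ?sc ?tc.
Qed.

Lemma tree_connected (P : 'I_k -> Prop) : (exists j, P j) ->
  (forall b : D, P (src b) -> P (tgt b)) -> forall j, P j.
Proof.
case=> j0 Pj0 Pb; have step i j : Delta i j -> P i -> P j.
  by move=> /arrow_exists[b [<- <-]]; apply: Pb.
have to_root j : exists r, [/\ s r = 0 :> nat, P j -> P r & P r -> P j].
  have [n] := ubnP (s j); elim: n j => // n IH j; rewrite ltnS => sj.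
  have [j0'|jpos] := posnP (s j); first by exists j; split.
  have lt := par_lt (j := s j); rewrite jpos ltn_ord in lt; have {}lt := lt isT.
  pose i := (s^-1)%g (Ordinal (ltn_trans lt (ltn_ord (s j)))).
  have si : s i = par (s j) :> nat by rewrite permKV.
  have ij : Delta i j by rewrite edgeE /tree_edge jpos si eqxx.
  have [|r [r0 ir ri]] := IH i; first by rewrite si; exact: leq_trans (lt) sj.
  exists r; split=> // [Pj|/ri]; last exact: step.
  by apply/ir/(step j) => //; rewrite edge_sym.
move=> j; have [r [r0 _ rj]] := to_root j; have [r' [r0' jr' _]] := to_root j0.
apply: rj; suff -> : r = r' by apply: jr'.
by apply: (@perm_inj _ s); apply: val_inj; rewrite /= r0 r0'.
Qed.

(** The potential is [1] at the root, and each vertex gets its value from its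
    parent. *)
Lemma tree_potential (h : D -> F) : (forall b, h b * h (dbar b) = 1) ->
  exists xi : 'I_k -> F, (forall i, xi i != 0) /\ forall b, h b = xi (src b) / xi (tgt b).
Proof.
move=> h1; have h0 b : h b != 0.
  by apply: contraTneq (oner_neq0 F) => b0; rewrite -(h1 b) b0 mul0r eqxx.
have extend m : (m <= k)%N -> exists X : nat -> F, (forall v, X v != 0) /\
    forall b : D, (s (tgt b) < m)%N -> (0 < s (tgt b))%N ->
      s (src b) = par (s (tgt b)) :> nat -> h b = X (s (src b)) / X (s (tgt b)).
  elim: m => [|m IH] mk; first by exists (fun=> 1); split=> [v|b //]; apply: oner_neq0.
  have [X [X0 XE]] := IH (ltnW mk).
  have [|none] := pselect (exists b : D, [/\ s (tgt b) = m :> nat, (0 < m)%N & s (src b) = par m :> nat]).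
    case=> b [tb m0 sb]; exists (fun v => if v == m then X (par m) / h b else X v).
    have pm : par m == m = false by apply/negbTE; rewrite neq_ltn par_lt// m0.
    split=> [v|c] /=; first by case: ifP => _; rewrite ?X0 // mulf_neq0 ?invr_neq0.
    rewrite ltnS leq_eqVlt => /orP[/eqP tc|lt] c0 sc.
      have -> : c = b.
        apply: edge_arrow_inj; apply: (@perm_inj _ s); apply: val_inj => /=.
          by rewrite sc sb tc.
        by rewrite tc tb.
      by rewrite tb sb eqxx pm invf_div mulrC divfK.
    have pc := par_lt (j := s (tgt c)); rewrite c0 ltn_ord in pc; have {}pc := pc isT.
    by rewrite sc !ifN_eq ?neq_ltn ?lt// ?(ltn_trans pc lt)// -sc XE.
  exists X; split=> // b; rewrite ltnS leq_eqVlt => /orP[/eqP tb b0 sb|]; last exact: XE.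
  by case: none; exists b; rewrite sb tb; split=> //; rewrite -tb.
have [X [X0 XE']] := extend k (leqnn k).
have XE b := XE' b (ltn_ord _).
exists (fun i => X (s i)); split=> // b.
have := arrow_edge b; rewrite edgeE /tree_edge => /orP[/andP[b0 /eqP sb]|/andP[b0 /eqP tb]].
  exact: XE.
have tgt_dbar : tgt (dbar b) = src b by rewrite -src_dbar dbarK.
have := XE (dbar b); rewrite src_dbar tgt_dbar => /(_ b0 tb) E.
by apply: (mulIf (h0 (dbar b))); rewrite (h1 b) E mulrA divfK// divff.
Qed.

End Orientation.

(** * The Frobenius structure on the preprojective algebra *)

Section Main.
Variables (F : fieldType) (k : nat) (k2 : (2 <= k)%N) (two0 : (2%:R : F) != 0).
Variables (Delta : rel 'I_k) (hDelta : ADE_graph Delta).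
Variables (Q : quiver k) (hQ : underlying_graph Q Delta).

Lemma coordinates_axiom (A : algType F) (SQ : signed_quiver F k) (e : 'I_k -> A)
    (x : arrow SQ -> A) n (w : 'I_n -> 'I_k * seq (arrow SQ)) (cf : A -> 'I_n -> F) :
  word_basis e x w cf -> Vector.axiom n A.
Proof.
move=> wb; exists (fun a => \row_p cf a p).
  by move=> c a b; apply/rowP => p; rewrite !mxE; apply: (wb_lin wb p).
exists (fun v : 'rV_n => \sum_p v 0 p *: (e (w p).1 * word x (w p).2)).
  by move=> a; rewrite [RHS](wb_span wb); apply: eq_bigr => p _; rewrite mxE.
move=> v; apply/rowP => q; rewrite mxE.
have lf : linear (cf^~ q : A -> F^o) := wb_lin wb q.
have cfZ c a : cf (c *: a) q = c * cf a q := linear_scale lf c a.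
transitivity (\sum_p cf (v 0 p *: (e (w p).1 * word x (w p).2)) q).
  exact: (linear_sum_of lf).
rewrite (bigD1 q)//= cfZ (wb_id wb) eqxx mulr1 big1 ?addr0 => [|p pq].
  by congr (v _ _); apply/esym/ord1.
by rewrite cfZ (wb_id wb) (negPf pq) mulr0.
Qed.

Theorem preprojective_frobenius :
  exists (N : nat) (ax : Vector.axiom N (preproj F Q))
         (W : bimod F k) (n : 'Hom(preproj_obj ax, W)),
    [/\ frobenius_structure n, invertible_obj W & nakayama_order (nakayama n) 2].
Proof.
have k0 : (0 < k)%N by apply: ltnW.
have ne := @pathquot_neq0 F k Q (Ordinal k0).
have [s [par [y [c [par_lt edgeE c0 y0 hy]]]]] := ADE_tree k2 hDelta.
have yC i : (2 * y (s i) = \sum_(b : arrow (double_quiver Q) | src b == i) y (s (tgt b)) + c)%N.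
  by rewrite (neighbour_sum hQ par_lt edgeE) hy.
have y0' (i : 'I_k) : (0 < y (s i))%N by apply: y0.
have [n [w [cf [d0 [wb tb van]]]]] := finite_dimensional (preproj_presents ne) y0' c0 yC.
(* The coordinates in a basis of words are what makes the algebra an object of
   the category. *)
have ax : Vector.axiom n (preproj F Q) := coordinates_axiom wb.
have pres := preproj_fin_presents ne ax.
have conn := tree_connected hQ par_lt edgeE.
have inj := edge_arrow_inj hQ par_lt edgeE.
have pot := @tree_potential F _ _ _ hQ _ _ par_lt edgeE.
pose cf' : preproj_finalg ax ne -> 'I_n -> F := cf.
have wb' : word_basis (A := preproj_finalg ax ne) _ _ w cf' := wb.
have [nu [m [nuK soc_dim top_dim above [cheb_m cheb_m1]]]] :=
  nakayama_data pres wb' van tb conn k0.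
pose bt := nakayama_aut wb' van nuK soc_dim top_dim.
pose lm : preproj_finalg ax ne -> F := top_form w cf' m.
have [u [v uv]] : exists u v, Delta u v.
  pose v := (s^-1)%g (Ordinal k2); pose r := (s^-1)%g (Ordinal k0).
  exists r, v; rewrite edgeE /tree_edge !permKV /=.
  by have := par_lt 1%N; rewrite k2 => /(_ isT); case: (par 1).
have [b0 _] := arrow_exists hQ uv.
have mb := pathquot_mul_bilinear (preproj_relation F Q).
pose n0 := @twisted_form F k (pathquot_vect ax) (fun a b : preproj_finalg ax ne => a * b) 1
  (qidem _) mb (@mulrA _) (@mul1r _) (@mulr1 _) (@qidem_mul _ _ _ _) (@qidem_sum _ _ _ _) nu lm.
have lm_lin : scalar lm by exact: lam_linear wb' m.
have lm_e := lam_e wb' nuK top_dim.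
have ndr b : (forall a, lm (a * b) = 0) -> b = 0.
  move=> h; apply: (lam_injr wb' van nuK soc_dim top_dim) => a.
  by rewrite [LHS]h mulr0; have := lm_lin (-1) 0 0; rewrite scaler0 addr0 mulN1r addNr.
have ndl b : (forall a, lm (b * a) = 0) -> b = 0.
  move=> h; apply: (lam_injl wb' van nuK soc_dim top_dim) => a.
  by rewrite [LHS]h mul0r; have := lm_lin (-1) 0 0; rewrite scaler0 addr0 mulN1r addNr.
exists n, ax, (twisted F nu), n0; split.
- exact: form_frobenius.
- exact: twisted_invertible.
apply: (@form_order2 _ _ _ _ _ _ _ _ _ _ _ _ nu lm bt nuK lm_lin lm_e ndr ndl).
- exact: betaE.
- exact: beta_linear.
- exact: betaM.
- exact: beta_e.
- have [xi [xi0 xiE]] := beta_square wb' van inj nuK soc_dim top_dim above cheb_m cheb_m1 pot.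
  by exists xi; split=> // i j a; exact: (xiE i j a).
- move=> zeta nu1 z0.
  have ni := @beta_not_inner _ _ _ _ _ _ pres _ w cf' d0 wb' van inj nu m nuK soc_dim top_dim above cheb_m cheb_m1 b0 zeta nu1 two0 z0.
  by move=> E; apply: ni => i j a; exact: (E i j a).
Qed.

End Main.

Local Open Scope complex_scope.
Theorem corollary3p24 (R : realType) (k : nat) (hk : (2 <= k)%N)
    (Delta : rel 'I_k) (hDelta : ADE_graph Delta)
    (Q : quiver k) (hQ : underlying_graph Q Delta) :
  exists (N : nat) (ax : Vector.axiom N (preproj R[i] Q))
         (W : bimod R[i] k) (n : 'Hom(preproj_obj ax, W)),
    [/\ frobenius_structure n, invertible_obj W & nakayama_order (nakayama n) 2].
Proof.
by apply: (preprojective_frobenius hk _ hDelta hQ); rewrite pnatr_eq0.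
Qed.
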